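(* Let $R\in(0,\infty]$, $k\in\mathbb{Z}$, $n\in\mathbb{N}_0$ and $0\le i\le n$. Suppose that $\hat f_k\in L^2(B_R(\mathbf 0);\mathbb{C})$ is a mode $k$ function with radial coefficient $f_k$, and that $\hat g_{k+n-2i}\in L^2(B_R(\mathbf 0);\mathbb{C})$ is a mode $k+n-2i$ function with radial coefficient $g_{k+n-2i}$. The function $\hat g_{k+n-2i}$ is the weak derivative $\partial_{\overline\zeta}^{\,n-i}\partial_\zeta^{\,i}\hat f_k$ of $\hat f_k$ if and only if $$(-1)^n\int_{B_R(\mathbf 0)}\hat f_k\,\partial_\zeta^{\,i}\partial_{\overline\zeta}^{\,n-i}\hat\phi_{-k-n+2i}=\int_{B_R(\mathbf 0)}\hat g_{k+n-2i}\,\hat\phi_{-k-n+2i}$$ for all $\hat\phi_{-k-n+2i}\in\hat{\mathscr D}_{(-k-n+2i)}(B_R(\mathbf 0);\mathbb{C})$, and this condition holds if and only if $$(-1)^n\int_0^R f_k(r)\,2^{-\frac n2}\mathcal{D}_{k+n-i}^{\,n-i}\mathcal{D}_{-k-n+2i}^{\,i}\phi_{-k-n+2i}(r)\,r\,\mathrm dr=\int_0^R g_{k+n-2i}(r)\,\phi_{-k-n+2i}(r)\,r\,\mathrm dr$$ for all $\phi_{-k-n+2i}\in\mathscr D_{(-k-n+2i)}([0,R);\mathbb{C})$.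
   Context: $B_R(\mathbf 0)$ is the open ball of radius $R$ in $\mathbb{R}^2$ ($B_\infty(\mathbf 0)=\mathbb{R}^2$). A mode $k$ function is a function of the form $\hat f_k(r\cos\theta,r\sin\theta)=\mathrm{e}^{\mathrm{i}k\theta}f_k(r)$, where $f_k$ is called its radial coefficient and $f_k(0)=0$ if $k\ne0$ (for $L^2$ functions these relations hold almost everywhere). $\partial_\zeta:=\frac1{\sqrt2}(\partial_x-\mathrm{i}\partial_y)$, $\partial_{\overline\zeta}:=\frac1{\sqrt2}(\partial_x+\mathrm{i}\partial_y)$. For $j\in\mathbb{Z}$, $\mathcal{D}_j:=\frac{\mathrm d}{\mathrm dr}+\frac jr$ and $\mathcal{D}_j^n:=\mathcal{D}_{j-(n-1)}\cdots\mathcal{D}_{j-1}\mathcal{D}_j$. The space $\hat{\mathscr D}_{(j)}(B_R(\mathbf 0);\mathbb{C})$ consists of all mode $j$ functions in the space $\mathscr D(B_R(\mathbf 0);\mathbb{C})$ of smooth functions with compact support in $B_R(\mathbf 0)$. The space $\mathscr D_{(j)}([0,R);\mathbb{C})$ consists of all $\phi:[0,R)\to\mathbb{C}$ with compact support in $[0,R)$ such that for all $0\le i\le n$, $n\in\mathbb{N}_0$, the function $\mathcal{D}_{-j+i}^{\,n-i}\mathcal{D}_j^{\,i}\phi$ belongs to $C^0([0,R);\mathbb{C})$ (that is, exists and is continuous for $r>0$ and extends continuously to $r=0$) and $(j+n-2i)\,\mathcal{D}_{-j+i}^{\,n-i}\mathcal{D}_j^{\,i}\phi|_{r=0}=0$.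 The weak derivative is the usual one: $\hat g=\partial_{\overline\zeta}^{\,n-i}\partial_\zeta^{\,i}\hat f$ means $(-1)^n\int\hat f\,\partial_{\overline\zeta}^{\,n-i}\partial_\zeta^{\,i}\hat\phi=\int\hat g\,\hat\phi$ for all $\hat\phi\in\mathscr D(B_R(\mathbf 0);\mathbb{C})$. *)

(* Defs.v *)
From HB Require Import structures.
From mathcomp Require Import all_boot all_order all_algebra.
From mathcomp Require Import all_classical all_reals all_analysis.
From mathcomp Require Import complex.

Set Implicit Arguments.
Unset Strict Implicit.
Unset Printing Implicit Defensive.

Import Order.TTheory GRing.Theory Num.Theory.
Import numFieldTopology.Exports numFieldNormedType.Exports.

Local Open Scope classical_set_scope.
Local Open Scope ring_scope.
Local Open Scope complex_scope.

(* Throughout, [K] is the field of real numbers, [K[i]] the field of complex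
   numbers, [K * K] the plane and [R : \bar K] the radius of the disc, [+oo]
   included.  Continuity, differentiation and integration of complex-valued
   functions are defined through the real and imaginary parts. *)

Section Complex_valued_functions.
Context {K : realType}.

Definition re_part {T : Type} (f : T -> K[i]) : T -> K := fun x => complex.Re (f x).
Definition im_part {T : Type} (f : T -> K[i]) : T -> K := fun x => complex.Im (f x).

Definition cintegral d (T : measurableType d) (mu : {measure set T -> \bar K})
    (A : set T) (f : T -> K[i]) : K[i] :=
  Rintegral mu A (re_part f) +i* Rintegral mu A (im_part f).

Definition square_integrable d (T : measurableType d)
    (mu : {measure set T -> \bar K}) (A : set T) (f : T -> K[i]) : Prop :=
  [/\ measurable_fun A (re_part f), measurable_fun A (im_part f)
    & mu.-integrable A (fun x => ((Normc.normc (f x)) ^+ 2)%:E)].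

Definition ccontinuous_within (T : topologicalType) (A : set T)
    (f : T -> K[i]) : Prop :=
  {within A, continuous (re_part f)} /\ {within A, continuous (im_part f)}.

Definition cderivable (V : normedModType K) (f : V -> K[i]) (p v : V) : Prop :=
  derivable (re_part f) p v /\ derivable (im_part f) p v.

Definition cderive (V : normedModType K) (v : V) (f : V -> K[i]) (p : V) : K[i] :=
  'D_v (re_part f) p +i* 'D_v (im_part f) p.

Definition expi (t : K) : K[i] := cos t +i* sin t.

End Complex_valued_functions.

Section Plane.
Context {K : realType}.

Definition plane_measure :
    {measure set (measurableTypeR K * measurableTypeR K) -> \bar K} :=
  (lebesgue_measure \x lebesgue_measure)%E.

Definition disc (R : \bar K) : set (K * K) :=
  [set p | ((Num.sqrt (p.1 ^+ 2 + p.2 ^+ 2))%:E < R)%E].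

Definition polar (r t : K) : K * K := (r * cos t, r * sin t).

Definition ex : K * K := (1, 0).
Definition ey : K * K := (0, 1).

Definition dzeta (f : K * K -> K[i]) : K * K -> K[i] := fun p =>
  ((Num.sqrt 2)^-1)%:C * (cderive ex f p - 'i%C * cderive ey f p).

Definition dzetabar (f : K * K -> K[i]) : K * K -> K[i] := fun p =>
  ((Num.sqrt 2)^-1)%:C * (cderive ex f p + 'i%C * cderive ey f p).

(* The letters [true] and [false] of [w] stand for d/dx and d/dy. *)
Definition partials (w : seq bool) (f : K * K -> K[i]) : K * K -> K[i] :=
  foldr (fun (b : bool) => cderive (if b then ex else ey)) f w.

Definition smooth (f : K * K -> K[i]) : Prop := forall w : seq bool,
  [/\ ccontinuous_within setT (partials w f),
      forall p, cderivable (partials w f) p ex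
    & forall p, cderivable (partials w f) p ey].

(* Test functions on the disc are identified with their extension by zero to
   the whole plane. *)
Definition test_fun (R : \bar K) (f : K * K -> K[i]) : Prop :=
  let supp := closure [set p | f p != 0] in
  [/\ smooth f, compact supp & supp `<=` disc R].

Definition mode_fun (R : \bar K) (k : int) (f : K * K -> K[i])
    (fk : K -> K[i]) : Prop :=
  (forall r t : K, 0 <= r -> (r%:E < R)%E ->
     f (polar r t) = expi (k%:~R * t) * fk r)
  /\ (k != 0 -> fk 0 = 0).

(* For square-integrable functions the mode relation is only required at almost
   every point of the disc, in all its polar representations; the value of [fk]
   at the single point 0 is then irrelevant. *)
Definition mode_fun_ae (R : \bar K) (k : int) (f : K * K -> K[i])
    (fk : K -> K[i]) : Prop :=
  {ae plane_measure, forall p, disc R p ->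
     forall r t : K, 0 <= r -> p = polar r t -> f p = expi (k%:~R * t) * fk r}.

Definition mode_test_fun (R : \bar K) (j : int) (f : K * K -> K[i]) : Prop :=
  test_fun R f /\ exists fj : K -> K[i], mode_fun R j f fj.

(* [g] is the weak derivative dzetabar^(n - i) dzeta^i [f] on the disc; meant
   for [i <= n]. *)
Definition weak_deriv (R : \bar K) (n i : nat) (f g : K * K -> K[i]) : Prop :=
  forall phi : K * K -> K[i], test_fun R phi ->
    (-1) ^+ n * cintegral plane_measure (disc R)
                  (fun p => f p * iter (n - i) dzetabar (iter i dzeta phi) p)
    = cintegral plane_measure (disc R) (fun p => g p * phi p).

End Plane.

Section Radial.
Context {K : realType}.

Definition itv0R (R : \bar K) : set K := [set r | 0 <= r /\ (r%:E < R)%E].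
Definition pos_itv0R (R : \bar K) : set K := [set r | 0 < r /\ (r%:E < R)%E].

(* Only the values at [r > 0] of the following derivatives are meaningful. *)
Definition radD (j : int) (phi : K -> K[i]) : K -> K[i] := fun r =>
  cderive (1 : K) phi r + (j%:~R / r)%:C * phi r.

Fixpoint radDn (j : int) (n : nat) (phi : K -> K[i]) : K -> K[i] :=
  if n is n'.+1 then radD (j - n'%:Z) (radDn j n' phi) else phi.

(* [derive] is total, hence the explicit differentiability of each iterate that
   [radDn j n phi] differentiates. *)
Definition radDn_exists (R : \bar K) (j : int) (n : nat) (phi : K -> K[i]) :=
  forall m : nat, (m < n)%N -> forall r : K, pos_itv0R R r ->
    cderivable (radDn j m phi) r (1 : K).

(* Only the values of [phi] on [0, R) matter.  The first two clauses are for
   [phi] itself, including its value at 0; in the third one [g] is the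
   continuous extension of the iterated derivative to [r = 0]. *)
Definition radial_test_fun (R : \bar K) (j : int) (phi : K -> K[i]) : Prop :=
  let supp := closure [set r | itv0R R r /\ phi r != 0] in
  [/\ compact supp /\ supp `<=` itv0R R,
      ccontinuous_within (itv0R R) phi
    & forall n i : nat, (i <= n)%N ->
        [/\ radDn_exists R j i phi,
            radDn_exists R (- j + i%:Z) (n - i) (radDn j i phi)
          & exists g : K -> K[i],
              [/\ ccontinuous_within (itv0R R) g,
                  forall r, pos_itv0R R r ->
                    g r = radDn (- j + i%:Z) (n - i) (radDn j i phi) r
                & (j + n%:Z - 2 * i%:Z)%:~R * g 0 = 0]]].

End Radial.

(* Main.v *)
(* A test function phi is averaged over rotations,
   psi(p) = int_0^{2 pi} e^{-i j t} phi(rot_t p) dt.  This psi is again a test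
   function, of mode j, and the average of dzetabar^b dzeta^a phi against
   e^{-i (j + b - a) t} is dzetabar^b dzeta^a psi, since dzeta (phi o rot_t) is
   e^{i t} (dzeta phi) o rot_t.  By Fubini and the rotation invariance of
   Lebesgue measure, testing a mode k function against h or against the average
   of h over e^{i k t} is the same up to the factor 2 pi; so testing with mode
   functions suffices.  Rotation invariance is obtained from shears.

   In polar coordinates, a plane integral of a radial function is a constant
   times the integral against r dr, whatever the constant (scaling), which is
   all that the passage to radial coefficients needs.  Finally, off the origin
   dzeta maps e^{i m theta} G(r) to 2^{-1/2} e^{i (m - 1) theta} (D_m G)(r), and
   likewise for dzetabar; the boundary conditions at r = 0 in the definition of
   the radial test functions make all these expressions continuous at the
   origin, where they are derivatives of each other by the mean value theorem. *)
Require Import Defs.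
From HB Require Import structures.
From mathcomp Require Import all_boot all_order all_algebra.
From mathcomp Require Import all_classical all_reals all_analysis.
From mathcomp Require Import measurable_realfun.
From mathcomp Require Import complex ring lra zify.

Set SsrOldRewriteGoalsOrder.
Set Implicit Arguments.
Unset Strict Implicit.
Unset Printing Implicit Defensive.

Import Order.TTheory GRing.Theory Num.Theory.
Import numFieldTopology.Exports numFieldNormedType.Exports.

Local Open Scope classical_set_scope.
Local Open Scope ring_scope.
Local Open Scope complex_scope.

(** * Lebesgue measure of the plane in polar coordinates *)

(** Two obstacles shape the proof. The radial coefficients [fk] and [gk] are arbitrary functions,
    tied to [f] and [g] only almost everywhere in the plane: nothing says beforehand that they are
    measurable, yet their integrals against r dr must be compared with plane integrals. The remedy
    is a ray on which the planar relation holds at almost every radius ([null_polar_section]). The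
    other obstacle is that smoothness speaks of all iterated partial derivatives in x and y, while
    both constructions of test functions, the angular average and the lift of a radial function, are
    controlled through dzeta and dzetabar. They meet in the notion of [jet]: a doubly indexed family
    closed under both operators, whose member at (0, 0) is then smooth with the other members as its
    derivatives. Each construction is carried out on the whole family at once, so that the
    derivatives of the new test function come with it. *)

Section PlaneMeasure0.
(** The measure structure on a pushforward depends on a proof of measurability. Packing it in an
    existential gives a bundled measure, to which uniqueness theorems apply. *)
Lemma ex_pushforward_measure d d' (T1 : measurableType d) (T2 : measurableType d')
    (R : realFieldType) (m : {measure set T1 -> \bar R}) (f : T1 -> T2) :
  measurable_fun setT f ->
  exists m' : {measure set T2 -> \bar R}, m' = pushforward m f :> (set T2 -> \bar R).
Proof. by move=> mf; unshelve eexists (pushforward m f). Qed.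

Lemma ge0_integral_ex_pushforward d d' (T1 : measurableType d) (T2 : measurableType d')
    (R : realType) (m : {measure set T1 -> \bar R}) (m' : {measure set T2 -> \bar R})
    (f : T1 -> T2) (g : T2 -> \bar R) :
  measurable_fun setT f -> m' = pushforward m f :> (set T2 -> \bar R) ->
  measurable_fun setT g -> (forall y, (0 <= g y)%E) ->
  (\int[m']_y g y = \int[m]_x g (f x))%E.
Proof.
move=> mf m'E mg g0.
by rewrite m'E ge0_integral_pushforward.
Qed.
End PlaneMeasure0.

Section PlaneMeasure.
Context {K : realType}.
Notation mu := (@lebesgue_measure K).
Notation P := (@plane_measure K).

(** The transported measure agrees with Lebesgue measure on half-open intervals, which characterizes
    it; scaling is handled alike. *)
Lemma lebesgue_measure_shift (a : K) (A : set (measurableTypeR K)) :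
  measurable A -> mu ((fun x => x + a) @^-1` A) = mu A.
Proof.
move=> mA.
have mf : measurable_fun setT (fun x : measurableTypeR K => x + a : measurableTypeR K).
  exact: measurable_funD.
have [m' m'E] := ex_pushforward_measure mu mf.
rewrite -[LHS]/(pushforward mu _ A) -m'E.
apply/esym/lebesgue_measure_unique => // X [[u v]/= _ <-].
rewrite m'E /pushforward.
have -> : (fun x => x + a) @^-1` `]u, v]%classic = `]u - a, v - a]%classic.
  apply/seteqP; split => x /=; rewrite !in_itv/=; lra.
rewrite lebesgue_measure_itv [RHS]lebesgue_measure_itv /= !lte_fin.
have -> : (u - a < v - a) = (u < v) by apply/idP/idP; lra.
by case: ifP => // _; rewrite -!EFinD; congr EFin; lra.
Qed.

Lemma lebesgue_measure_scale (s : K) (A : set (measurableTypeR K)) : 0 < s ->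
  measurable A -> (s%:E * mu ((fun x => (s * x)%R) @^-1` A) = mu A)%E.
Proof.
move=> s0 mA.
have mf : measurable_fun setT (fun x : measurableTypeR K => s * x : measurableTypeR K).
  exact: measurable_funM.
have [m' m'E] := ex_pushforward_measure mu mf.
rewrite -[X in (_ * X)%E]/(pushforward mu _ A) -m'E.
rewrite -[LHS]/(mscale (NngNum (ltW s0)) m' A).
apply/esym/lebesgue_measure_unique => // X [[u v]/= _ <-].
rewrite /= /mscale m'E /pushforward /=.
have -> : (fun x => s * x) @^-1` `]u, v]%classic = `]u / s, v / s]%classic.
  by apply/seteqP; split => x /=; rewrite !in_itv/= ltr_pdivrMr// ler_pdivlMr// (mulrC x).
rewrite !lebesgue_measure_itv/= !lte_fin.
rewrite ltr_pM2r ?invr_gt0//.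
case: ifP => [_|]; last by rewrite mule0.
by rewrite -!EFinD -EFinM; congr EFin; rewrite -mulrBl mulrC divfK ?gt_eqF.
Qed.

(** [plane_measure] integrates the measures of vertical sections. This form uses horizontal ones,
    along which [hshear] is a translation. *)
Lemma plane_measure2E (B : set (measurableTypeR K * measurableTypeR K)) :
  measurable B -> P B = (mu \x^ mu)%E B.
Proof.
move=> mB; apply: product_measure_unique => // A1 A2 mA1 mA2.
exact: product_measure2E.
Qed.

Definition hshear (a : K) (p : K * K) : K * K := (p.1 + a * p.2, p.2).
Definition vshear (a : K) (p : K * K) : K * K := (p.1, p.2 + a * p.1).

Lemma measurable_fun_plane d (T : measurableType d) (f g : T -> K) :
  measurable_fun setT f -> measurable_fun setT g ->
  measurable_fun setT (fun p => (f p, g p) : measurableTypeR K * measurableTypeR K).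
Proof. by move=> mf mg; exact/measurable_fun_pair. Qed.

Lemma measurable_hshear a : measurable_fun setT (hshear a : measurableTypeR K * measurableTypeR K -> measurableTypeR K * measurableTypeR K).
Proof.
apply: measurable_fun_plane; last exact: measurable_snd.
by apply: measurable_funD; [exact: measurable_fst|apply: measurable_funM => //; exact: measurable_snd].
Qed.

Lemma plane_measure_hshear a (B : set (measurableTypeR K * measurableTypeR K)) :
  measurable B -> P (hshear a @^-1` B) = P B.
Proof.
move=> mB.
have mB' : measurable (hshear a @^-1` B).
  by rewrite -[X in measurable X]setTI; apply: measurable_hshear.
rewrite !plane_measure2E//; apply: eq_integral => y _ /=.
rewrite -[RHS](lebesgue_measure_shift (a * y)); last exact: measurable_ysection.
by congr (mu _); apply/seteqP; split => x; rewrite /ysection/= !inE.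
Qed.

Lemma plane_measure_vshear a (B : set (measurableTypeR K * measurableTypeR K)) :
  measurable B -> P (vshear a @^-1` B) = P B.
Proof.
move=> mB; apply: eq_integral => x _ /=.
rewrite -[RHS](lebesgue_measure_shift (a * x)); last exact: measurable_xsection.
by congr (mu _); apply/seteqP; split => y; rewrite /xsection/= !inE.
Qed.

Notation plane := (measurableTypeR K * measurableTypeR K)%type.

(** A rotation given by its cosine and sine, so that invariance becomes polynomial algebra modulo
    [c ^+ 2 + s ^+ 2 = 1]. *)
Definition rotcs (c s : K) (p : K * K) : K * K :=
  (c * p.1 - s * p.2, s * p.1 + c * p.2).

Lemma measurable_rotcs c s : measurable_fun setT (rotcs c s : plane -> plane).
Proof.
apply: measurable_fun_plane.
  by apply: measurable_funB; apply: measurable_funM.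
by apply: measurable_funD; apply: measurable_funM.
Qed.

Lemma measurable_preimage_rotcs c s (B : set plane) : measurable B ->
  measurable (rotcs c s @^-1` B : set plane).
Proof. by move=> mB; rewrite -[X in measurable X]setTI; apply: measurable_rotcs. Qed.

(** A rotation is a product of three shears, each of which preserves the measure. The factorization
    divides by [1 + c], so the half turn is treated separately, as a quarter turn done twice. *)
Lemma plane_measure_rotcs c s (B : set plane) : c ^+ 2 + s ^+ 2 = 1 ->
  measurable B -> P (rotcs c s @^-1` B) = P B.
Proof.
have shears (c' s' : K) (B' : set plane) : c' ^+ 2 + s' ^+ 2 = 1 -> 1 + c' != 0 ->
    measurable B' -> P (rotcs c' s' @^-1` B') = P B'.
  (* [tau] is the tangent of half the angle. *)
  move=> cs c1 mB; pose tau := s' / (1 + c').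
  have -> : rotcs c' s' = hshear (- tau) \o vshear s' \o hshear (- tau).
    apply/funext => -[x y]; rewrite /rotcs /hshear /vshear /= /tau.
    have cE : s' * s' = (1 - c') * (1 + c') by move: cs; rewrite !expr2; lra.
    have H : s' / (1 + c') * s' = 1 - c' by rewrite mulrAC cE mulfK.
    have H2 : s' / (1 + c') * (1 + c') = s' by rewrite divfK.
    set u := s' / (1 + c') in H H2 *.
    congr pair; last by ring: H.
    by rewrite -[in LHS]H2; ring: H.
  rewrite !comp_preimage.
  have m1 : measurable (hshear (- tau) @^-1` B' : set plane).
    by rewrite -[X in measurable X]setTI; apply: measurable_hshear.
  have m2 : measurable (vshear s' @^-1` (hshear (- tau) @^-1` B') : set plane).
    rewrite -[X in measurable X]setTI.
    suff mv : measurable_fun setT (vshear s' : plane -> plane) by exact: mv.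
    apply: measurable_fun_plane; first exact: measurable_fst.
    by apply: measurable_funD => //; exact: measurable_funM.
  by rewrite (plane_measure_hshear _ m2) (plane_measure_vshear _ m1) (plane_measure_hshear _ mB).
move=> cs mB; have [c1|] := eqVneq (1 + c) 0; last by move=> ?; exact: shears.
have cE : c = -1 by lra.
have sE : s = 0 by apply/eqP; rewrite -sqrf_eq0; apply/eqP; rewrite cE in cs; lra.
have -> : rotcs c s = rotcs 0 1 \o rotcs 0 1.
  by apply/funext => -[x y]; rewrite /rotcs /= cE sE; congr pair; ring.
have cs0 : 0 ^+ 2 + 1 ^+ 2 = 1 :> K by ring.
have d0 : 1 + 0 != 0 :> K by rewrite addr0.
by rewrite comp_preimage !shears//; exact: measurable_preimage_rotcs.
Qed.

Lemma plane_measure_setX (X Y : set (measurableTypeR K)) :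
  measurable X -> measurable Y -> P (X `*` Y) = (mu X * mu Y)%E.
Proof. exact: product_measure1E. Qed.

Definition dilate (s : K) (p : K * K) : K * K := (s * p.1, s * p.2).

Lemma measurable_dilate s : measurable_fun setT (dilate s : plane -> plane).
Proof.
by apply: measurable_fun_plane; apply: measurable_funM.
Qed.

Lemma plane_measure_dilate s (B : set plane) : 0 < s ->
  measurable B -> ((s ^+ 2)%:E * P (dilate s @^-1` B) = P B)%E.
Proof.
move=> s0 mB.
have [m' m'E] := ex_pushforward_measure P (measurable_dilate s).
rewrite -[X in (_ * X)%E]/(pushforward P _ B) -m'E.
have s20 : 0 <= s ^+ 2 by exact: sqr_ge0.
rewrite -[LHS]/(mscale (NngNum s20) m' B).
apply/esym/product_measure_unique => // X Y mX mY.
rewrite /= /mscale m'E /pushforward.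
have mf : measurable_fun setT (fun x : measurableTypeR K => s * x : measurableTypeR K).
  exact: measurable_funM.
rewrite -(lebesgue_measure_scale s0 mX) -(lebesgue_measure_scale s0 mY).
have -> : dilate s @^-1` (X `*` Y) = ((fun x => s * x) @^-1` X) `*` ((fun x => s * x) @^-1` Y).
  by apply/seteqP; split => -[x y].
rewrite plane_measure_setX; last 2 first.
- by rewrite -[X in measurable X]setTI; exact: mf.
- by rewrite -[X in measurable X]setTI; exact: mf.
rewrite [X in (X * _)%E = _](_ : _ = (s%:E * s%:E)%E); first by rewrite muleACA.
by rewrite -EFinM /= expr2.
Qed.

Definition pnorm (p : K * K) : K := Num.sqrt (p.1 ^+ 2 + p.2 ^+ 2).

Lemma measurable_pnorm : measurable_fun setT (pnorm : plane -> measurableTypeR K).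
Proof.
apply: (@measurableT_comp _ _ _ _ _ _ (@Num.sqrt K)) => //.
  exact: (continuous_measurable_fun (@sqrt_continuous K)).
by apply: measurable_funD; apply: measurable_funX; [exact: measurable_fst|exact: measurable_snd].
Qed.

Lemma pnorm_ge0 p : 0 <= pnorm p. Proof. exact: sqrtr_ge0. Qed.

Lemma pnorm_rotcs c s p : c ^+ 2 + s ^+ 2 = 1 -> pnorm (rotcs c s p) = pnorm p.
Proof.
move=> cs; rewrite /pnorm /rotcs /=; congr Num.sqrt.
transitivity ((c ^+ 2 + s ^+ 2) * (p.1 ^+ 2 + p.2 ^+ 2)); first by ring.
by rewrite cs mul1r.
Qed.

Lemma pnorm_dilate s p : 0 <= s -> pnorm (dilate s p) = s * pnorm p.
Proof.
move=> s0; rewrite /pnorm /dilate /= !exprMn -mulrDr sqrtrM ?sqr_ge0//.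
by rewrite sqrtr_sqr ger0_norm.
Qed.

Lemma ge0_integral_mrestr d (T : measurableType d) (m : {measure set T -> \bar K})
    (D : set T) (mD : measurable D) (f : T -> \bar K) :
  measurable_fun setT f -> (forall x, (0 <= f x)%E) ->
  (\int[mrestr m mD]_x f x = \int[m]_(x in D) f x)%E.
Proof.
move=> mf f0.
have mDC : measurable (~` D) by exact: measurableC.
rewrite [LHS](ge0_negligible_integral mDC)//; last first.
  by rewrite /= /mrestr setICl measure0.
rewrite setTD setCK; apply: eq_measure_integral => A mA AD.
by rewrite /= /mrestr setIidl.
Qed.

(* A cone carries a measure proportional to [x ^+ 2] below the level [x] of a
   homogeneous function. *)
Lemma plane_measure_cone (B : set plane) (h : plane -> K) (x : K) : measurable B ->
  measurable_fun setT h -> (forall s p, 0 < s -> B (dilate s p) <-> B p) ->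
  (forall s p, 0 < s -> h (dilate s p) = s * h p) -> 0 < x ->
  P (B `&` [set p | (h p < x)%R]) = ((x ^+ 2)%:E * P (B `&` [set p | (h p < 1)%R]))%E.
Proof.
move=> mB mh hB hh x0.
have mh' y : measurable [set p : plane | h p < y].
  rewrite -[X in measurable X]setTI (_ : [set p | h p < y] = h @^-1` `]-oo, y[%classic).
    exact: mh.
  by apply/seteqP; split => p /=; rewrite in_itv.
rewrite -(plane_measure_dilate x0 (measurableI _ _ mB (mh' x))).
congr (_ * P _)%E; apply/seteqP; split => p [Bp hp]; split.
- exact/(hB x p x0).
- move: hp; rewrite /= hh// -[X in _ < X -> _]mulr1 ltr_pM2l//.
- by move: Bp => /(hB x p x0).
- by rewrite /= hh// -[X in _ < X]mulr1 ltr_pM2l.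
Qed.

(** Boxes inside and outside give positivity and finiteness, so that two such measures have a
    positive real ratio. *)
Lemma plane_measure_box (B : set plane) (a b : K) : measurable B ->
  0 < b -> `]a, a + b]%classic `*` `]0, b]%classic `<=` B ->
  B `<=` `]-1, 1]%classic `*` `]-1, 1]%classic ->
  (0 < P B < +oo)%E.
Proof.
move=> mB b0 sB Bs; apply/andP; split.
  apply: (@lt_le_trans _ _ (P (`]a, a + b]%classic `*` `]0, b]%classic))).
    rewrite plane_measure_setX//= !lebesgue_measure_itv/= !lte_fin ltrDl b0.
    by rewrite -!EFinD -EFinM lte_fin subr0 addrAC subrr add0r mulr_gt0.
  by apply: le_measure; rewrite ?inE//; exact: measurableX.
apply: (@le_lt_trans _ _ (P (`]-1, 1]%classic `*` `]-1, 1]%classic))).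
  by apply: le_measure; rewrite ?inE//; exact: measurableX.
rewrite plane_measure_setX//= !lebesgue_measure_itv/= !lte_fin.
by case: ifP => _; rewrite ?mule0 ?ltry// -!EFinD -EFinM ltry.
Qed.

Lemma pnorm_lt1_box : (0 < P [set p | (pnorm p < 1)%R] < +oo)%E.
Proof.
apply: (@plane_measure_box _ 0 (1 / 2)) => //.
- rewrite -[X in measurable X]setTI (_ : [set p | pnorm p < 1] = pnorm @^-1` `]-oo, 1[%classic).
    exact: measurable_pnorm.
  by apply/seteqP; split => p /=; rewrite in_itv.
- move=> [x y] [/=]; rewrite !in_itv/= => /andP[x0 x1] /andP[y0 y1].
  rewrite /pnorm /= -[X in _ < X]sqrtr1 ltr_sqrt//; nra.
- move=> [x y]; rewrite /= /pnorm /= -[X in _ < X]sqrtr1 ltr_sqrt// => h.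
  have := sqr_ge0 x; have := sqr_ge0 y; rewrite !in_itv/= => y2 x2.
  by split; apply/andP; split; nra.
Qed.

(** The law of [pnorm] and the law of the first coordinate on a wedge both give mass proportional to
    [x ^+ 2] below level [x], by homogeneity. Hence they are proportional, and on the wedge Fubini
    computes the integral directly. *)
Lemma ge0_integral_pnorm : exists2 kap : K, 0 < kap &
  forall f : measurableTypeR K -> \bar K, measurable_fun setT f -> (forall x, (0 <= f x)%E) ->
  (\int[P]_p f (pnorm p) = kap%:E * \int[mu]_(r in `]0%R, +oo[) (f r * r%:E))%E.
Proof.
(* The vertical section of this wedge at abscissa r is []0, r]], whose length is the weight r. *)
pose D : set plane := [set p | 0 < p.1 /\ 0 < p.2 <= p.1].
have mD : measurable D.
  have -> : D = fst @^-1` `]0, +oo[%classic `&` (snd @^-1` `]0, +oo[%classic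
      `&` (fun p => p.1 - p.2) @^-1` `[0, +oo[%classic).
    apply/seteqP; split => p /=; rewrite !in_itv/= !andbT subr_ge0.
      by move=> [-> /andP[-> ->]].
    by move=> [p1 [p2 p12]]; split=> //; rewrite p2 p12.
  apply: measurableI; last apply: measurableI.
  - by rewrite -[X in measurable X]setTI; apply: (@measurable_fst _ _ (measurableTypeR K) (measurableTypeR K)).
  - by rewrite -[X in measurable X]setTI; apply: (@measurable_snd _ _ (measurableTypeR K) (measurableTypeR K)).
  - have m12 : measurable_fun setT (fun p : plane => p.1 - p.2 : measurableTypeR K).
      by apply: measurable_funB.
    by rewrite -[X in measurable X]setTI; apply: m12.
have aa : (0 < P (D `&` [set p | (p.1 < 1)%R]) < +oo)%E.
  apply: (@plane_measure_box _ (1/2) (1/4)) => //.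
  - apply: measurableI => //.
    rewrite -[X in measurable X]setTI (_ : [set p : plane | p.1 < 1] = fst @^-1` `]-oo, 1[%classic).
      by apply: (@measurable_fst _ _ (measurableTypeR K) (measurableTypeR K)).
    by apply/seteqP; split => p /=; rewrite in_itv.
  - move=> [x y] [/=]; rewrite !in_itv/= => /andP[x0 x1] /andP[y0 y1].
    by rewrite /D /=; split; [split|]; lra.
  - move=> [x y]; rewrite /D /= !in_itv/= => -[[x0 /andP[y0 yx]] x1].
    by split; apply/andP; split; lra.
have bb := pnorm_lt1_box.
set al := P (D `&` _) in aa; set be := P [set p | _] in bb.
have [a0 aoo] := andP aa; have [b0 boo] := andP bb.
have afin : al \is a fin_num by rewrite fin_numElt aoo (lt_trans _ a0)// ltNy0.
have bfin : be \is a fin_num by rewrite fin_numElt boo (lt_trans _ b0)// ltNy0.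
have fa0 : 0 < fine al by rewrite fine_gt0 // a0.
have fb0 : 0 < fine be by rewrite fine_gt0 // b0.
have ballE y : 0 < y -> P (pnorm @^-1` `]-oo, y[%classic) = ((y ^+ 2)%:E * be)%E.
  move=> y0; rewrite /be.
  have := @plane_measure_cone setT pnorm y measurableT measurable_pnorm.
  rewrite !setTI => <- //; last by move=> s p s0; rewrite pnorm_dilate// ltW.
have triE y : 0 < y -> P (fst @^-1` `]-oo, y[%classic `&` D) = ((y ^+ 2)%:E * al)%E.
  move=> y0; rewrite /al setIC.
  have m1 : measurable_fun setT (fst : plane -> K) by exact: measurable_fst.
  rewrite -(plane_measure_cone mD m1 _ _ y0) //.
  by move=> s p s0; rewrite /D /dilate /= !pmulr_rgt0// ler_pM2l.
(* The area of the unit disc over that of the part of the wedge with abscissa below 1; in effect 2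
   pi. *)
exists (fine be / fine al); first by rewrite divr_gt0.
move=> f mf f0.
have mfst : measurable_fun setT (fst : plane -> measurableTypeR K) by exact: measurable_fst.
have [m1 m1E] := ex_pushforward_measure P measurable_pnorm.
have [m2 m2E] := ex_pushforward_measure (mrestr P mD) mfst.
pose kap := NngNum (ltW (divr_gt0 fb0 fa0)).
have m12 A : measurable A -> m1 A = mscale kap m2 A.
  (* Open left rays are stable under intersection, generate the Borel sets and exhaust the line with
     finite mass, so agreement on them is enough. *)
  apply: (@measure_unique _ K (measurableTypeR K) (@RGenInftyO.G K) (fun n => `]-oo, n%:R[%classic)).
  - exact: RGenInftyO.measurableE.
  - move=> _ _ [x ->] [y ->]; exists (Num.min x y).
    by apply/seteqP; split => z /=; rewrite !in_itv/= lt_min => /andP.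
  - by move=> n; exists n%:R.
  - apply/seteqP; split => // x _; exists (Num.truncn `|x|).+1 => //=.
    by rewrite in_itv/= (le_lt_trans (ler_norm _))// truncnS_gt.
  - move=> _ [x ->].
    rewrite -[RHS]/((fine be / fine al)%:E * m2 `]-oo, x[%classic)%E m1E m2E.
    rewrite -[LHS]/(P (pnorm @^-1` `]-oo, x[%classic)).
    rewrite -[X in (_ * X)%E]/(P (fst @^-1` `]-oo, x[%classic `&` D)).
    have [x0|x0] := leP x 0.
      rewrite (_ : _ @^-1` _ = set0) ?measure0; last first.
        apply/seteqP; split => p //=; rewrite in_itv/= => /lt_le_trans/(_ x0).
        by rewrite ltNge pnorm_ge0.
      rewrite (_ : _ `&` _ = set0) ?measure0 ?mule0//.
      apply/seteqP; split => p //=; rewrite in_itv/= /D/= => -[px [p0 _]].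
      by move: (lt_trans p0 px); rewrite ltNge x0.
    rewrite ballE// triE// -(fineK afin) -(fineK bfin) -!EFinM; congr EFin.
    by rewrite /= mulrCA divfK// gt_eqF.
  - move=> n; rewrite m1E -[X in (X < _)%E]/(P (pnorm @^-1` `]-oo, n%:R[%classic)).
    have [->|n0] := posnP n.
      rewrite (_ : _ @^-1` _ = set0) ?measure0//.
      apply/seteqP; split => p //=; rewrite in_itv/=.
      by rewrite ltNge pnorm_ge0.
    by rewrite ballE ?ltr0n// -(fineK bfin) -EFinM ltry.
rewrite -(ge0_integral_ex_pushforward measurable_pnorm m1E mf f0).
rewrite (eq_measure_integral (mscale kap m2)); last by move=> A mA _; exact: m12.
rewrite ge0_integral_mscale//=; congr (_ * _)%E.
rewrite (ge0_integral_ex_pushforward mfst m2E mf f0).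
rewrite ge0_integral_mrestr//; last exact: measurableT_comp.
rewrite integral_mkcond /plane_measure fubini_tonelli1//=; last 2 first.
- have mfD : measurable_fun D (fun p : plane => f p.1).
    by apply: measurable_funTS; exact: measurableT_comp.
  exact: (measurable_restrictT _ mD).1 mfD.
- by move=> p; rewrite patchE; case: ifPn.
rewrite [RHS]integral_mkcond; apply: eq_integral => r _.
rewrite /fubini_F patchE; case: ifPn => r0.
  move: r0; rewrite inE/= in_itv/= andbT => r0.
  transitivity (\int[mu]_(y in `]0%R, r]) (cst (f r) y))%E.
    rewrite [RHS]integral_mkcond; apply: eq_integral => y _.
    rewrite !patchE; congr (if _ then _ else _).
    by apply/idP/idP; rewrite !inE /D/= in_itv/=; [case|split].
  rewrite integral_cst//= lebesgue_measure_itv/= lte_fin r0.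
  by rewrite -EFinD subr0.
rewrite integral0_eq// => y _; rewrite patchE; case: ifPn => //.
rewrite inE /D/= => -[r1 _]; move: r0; rewrite notin_setE/= in_itv/= r1//.
Qed.

End PlaneMeasure.

(** * Null sets along rays and integrals of radial functions *)

Section RadialIntegral.
Context {K : realType}.
Notation mu := (@lebesgue_measure K).
Notation P := (@plane_measure K).
Notation plane := (measurableTypeR K * measurableTypeR K)%type.

Lemma sigma_finite_plane : sigma_finite setT P.
Proof.
exists (fun n => `]-n%:R, n%:R]%classic `*` `]-n%:R, n%:R]%classic).
  apply/esym/seteqP; split => // -[x y] _.
  exists (maxn (Num.truncn `|x|).+1 (Num.truncn `|y|).+1) => //=.
  have xn : `|x| < (maxn (Num.truncn `|x|).+1 (Num.truncn `|y|).+1)%:R.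
    by apply: (lt_le_trans (truncnS_gt _)); rewrite ler_nat leq_maxl.
  have yn : `|y| < (maxn (Num.truncn `|x|).+1 (Num.truncn `|y|).+1)%:R.
    by apply: (lt_le_trans (truncnS_gt _)); rewrite ler_nat leq_maxr.
  move: xn yn; rewrite !in_itv/= !ltr_norml => /andP[? xn] /andP[? yn].
  by split; apply/andP; split => //; exact: ltW.
move=> n; split; first exact: measurableX.
rewrite plane_measure_setX//= !lebesgue_measure_itv/= !lte_fin.
by case: ifP => _; rewrite ?mule0 ?ltry// -!EFinD -EFinM ltry.
Qed.

(* The declared type of [plane_measure] hides its sigma-finiteness; [planeS] is
   a copy that Fubini's theorem accepts. *)
Definition planeF : set plane -> \bar K := P.
HB.instance Definition _ := Measure.copy planeF P.
HB.instance Definition _ := Measure_isSigmaFinite.Build _ _ _ planeF sigma_finite_plane.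
Definition planeS : {sigma_finite_measure set plane -> \bar K} := planeF.

Lemma product_measureE d1 d2 (T1 : measurableType d1) (T2 : measurableType d2)
    (m1 : {sigma_finite_measure set T1 -> \bar K}) (m2 : {sigma_finite_measure set T2 -> \bar K})
    (A : set (T1 * T2)) : measurable A -> (m1 \x m2)%E A = (m1 \x^ m2)%E A.
Proof.
by move=> mA; apply: product_measure_unique => // A1 A2 mA1 mA2; exact: product_measure2E.
Qed.

(** The integral of a nonnegative function is a supremum over the simple functions below it, so
    monotonicity makes sense for arbitrary functions such as radial coefficients. *)
Lemma ge0_le_integral_nonmeas d (T : measurableType d) (m : {measure set T -> \bar K})
    (D : set T) (f g : T -> \bar K) :
  (forall x, D x -> (0 <= f x)%E) -> (forall x, D x -> (f x <= g x)%E) ->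
  (\int[m]_(x in D) f x <= \int[m]_(x in D) g x)%E.
Proof.
move=> f0 fg.
rewrite !ge0_integralE//; last by move=> x Dx; exact: le_trans (f0 _ Dx) (fg _ Dx).
apply: ereal_sup_le => _ [h /= hf <-]; exists h => //= x.
apply: (le_trans (hf x)); rewrite !patchE; case: ifPn => //; rewrite inE; exact: fg.
Qed.

(** Transfers an integral from the measurable [g] to an arbitrary [f] by squeezing [f] between
    functions whose integrals are known. *)
Lemma ge0_integral_eq_off_null d (T : measurableType d) (m : {measure set T -> \bar K})
    (D N : set T) (f g : T -> \bar K) : measurable D -> measurable N -> m N = 0 ->
  measurable_fun D g -> (forall x, D x -> (0 <= f x)%E) -> (forall x, D x -> (0 <= g x)%E) ->
  (forall x, D x -> ~ N x -> f x = g x) ->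
  (\int[m]_(x in D) f x = \int[m]_(x in D) g x)%E.
Proof.
move=> mD mN N0 mg f0 g0 fg.
have step (h1 h2 : T -> \bar K) : measurable_fun D h1 -> (forall x, D x -> (0 <= h1 x)%E) ->
    (forall x, D x -> (0 <= h2 x)%E) -> (forall x, D x -> ~ N x -> (h1 x <= h2 x)%E) ->
    (\int[m]_(x in D) h1 x <= \int[m]_(x in D) h2 x)%E.
  move=> mh1 h10 h20 h12.
  rewrite (ge0_negligible_integral mN)//.
  rewrite [leLHS]integral_mkcond [leRHS]integral_mkcond.
  apply: ge0_le_integral_nonmeas => x _.
    by rewrite patchE; case: ifPn => //; rewrite inE => -[Dx _]; exact: h10.
  rewrite !patchE; case: ifPn => [|_]; last by case: ifPn => //; rewrite inE; exact: h20.
  by rewrite inE => -[Dx Nx]; rewrite (mem_set Dx); exact: h12.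
apply/eqP; rewrite eq_le; apply/andP; split; last first.
  by apply: step => // x Dx Nx; rewrite fg.
(* Raising [g] to infinity on [N] gives a measurable majorant of [f] with the same integral as
   [g]. *)
pose g' x := if x \in N then +oo%E else g x.
have mg' : measurable_fun D g'.
  apply: measurable_fun_if => //=.
  - by apply: measurable_funTS; apply: (measurable_fun_bool true); rewrite setTI preimage_mem_true.
  - exact: measurable_funS mg.
have g'0 x : D x -> (0 <= g' x)%E by rewrite /g'; case: ifPn => // _; exact: g0.
apply: (@le_trans _ _ (\int[m]_(x in D) g' x)%E).
  apply: ge0_le_integral_nonmeas => // x Dx; rewrite /g'; case: ifPn; first by rewrite leey.
  by rewrite notin_setE => Nx; rewrite fg.
by apply: step => // x Dx Nx; rewrite /g' memNset.
Qed.

Lemma measurable_polar (t : K) : measurable_fun setT (polar ^~ t : measurableTypeR K -> plane).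
Proof. by apply: measurable_fun_plane; apply: measurable_funM. Qed.

Lemma measurable_cosR : measurable_fun setT (@cos K : measurableTypeR K -> measurableTypeR K).
Proof. exact: continuous_measurable_fun (@continuous_cos K). Qed.

Lemma measurable_sinR : measurable_fun setT (@sin K : measurableTypeR K -> measurableTypeR K).
Proof. exact: continuous_measurable_fun (@continuous_sin K). Qed.

Lemma measurable_polar2 :
  measurable_fun setT ((fun q => polar q.1 q.2) : plane -> plane).
Proof.
apply: measurable_fun_plane; apply: measurable_funM => //.
  by apply: measurableT_comp => //; exact: measurable_cosR.
by apply: measurableT_comp => //; exact: measurable_sinR.
Qed.

Lemma measurable_rot : measurable_fun setT
  ((fun q => rotcs (cos q.2) (sin q.2) q.1) : plane * measurableTypeR K -> plane).
Proof.
have mc : measurable_fun setT (fun q : plane * measurableTypeR K => cos q.2 : measurableTypeR K).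
  by apply: measurableT_comp => //; exact: measurable_cosR.
have ms : measurable_fun setT (fun q : plane * measurableTypeR K => sin q.2 : measurableTypeR K).
  by apply: measurableT_comp => //; exact: measurable_sinR.
have m1 : measurable_fun setT (fun q : plane * measurableTypeR K => q.1.1 : measurableTypeR K).
  by apply: measurableT_comp.
have m2 : measurable_fun setT (fun q : plane * measurableTypeR K => q.1.2 : measurableTypeR K).
  by apply: measurableT_comp.
by apply: measurable_fun_plane; [apply: measurable_funB|apply: measurable_funD]; apply: measurable_funM.
Qed.

Lemma pnorm_polar (r t : K) : 0 <= r -> pnorm (polar r t) = r.
Proof.
move=> r0; rewrite /pnorm /polar /= !exprMn -mulrDr cos2Dsin2 mulr1 sqrtr_sqr.
by rewrite ger0_norm.
Qed.

Lemma rot_polar (r s t : K) : rotcs (cos t) (sin t) (polar r s) = polar r (s + t).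
Proof. by rewrite /rotcs /polar /= cosD sinD; congr pair; ring. Qed.

Lemma pnorm_eq0 (p : K * K) : pnorm p = 0 -> p = 0.
Proof.
move/eqP; rewrite /pnorm sqrtr_eq0 => h; have := sqr_ge0 p.1; have := sqr_ge0 p.2 => h2 h1.
have /eqP : p.1 ^+ 2 = 0 by lra.
have /eqP : p.2 ^+ 2 = 0 by lra.
by rewrite !sqrf_eq0; case: p {h h1 h2} => x y /= /eqP -> /eqP ->.
Qed.

(** The angle is an arc cosine, up to the sign prescribed by the second coordinate. *)
Lemma polarP (p : K * K) : exists t, p = polar (pnorm p) t.
Proof.
have [/pnorm_eq0 ->|r0] := eqVneq (pnorm p) 0.
  by exists 0; rewrite /pnorm /polar /= expr0n addr0 sqrtr0 !mul0r.
set r := pnorm p in r0 *.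
have r2 : r ^+ 2 = p.1 ^+ 2 + p.2 ^+ 2 by rewrite sqr_sqrtr// addr_ge0// sqr_ge0.
have cs : (p.1 / r) ^+ 2 + (p.2 / r) ^+ 2 = 1.
  by rewrite !exprMn -mulrDl -r2 exprVn divff// sqrf_eq0.
have c1 : -1 <= p.1 / r <= 1.
  have := sqr_ge0 (p.2 / r) => s2.
  by rewrite -ler_norml -[X in _ <= X]sqrtr1 -sqrtr_sqr; apply: ler_wsqrtr; lra.
have sE : (sin (acos (p.1 / r))) ^+ 2 = (p.2 / r) ^+ 2.
  by rewrite sin2cos2 acosK ?in_itv//=; lra.
have pE : p = (r * (p.1 / r), r * (p.2 / r)).
  by case: (p) => x y /=; rewrite !(mulrC r) !divfK.
move/eqP: sE; rewrite eqf_sqr => /orP[/eqP sE|/eqP sE].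
  by exists (acos (p.1 / r)); rewrite {1}pE /polar acosK ?in_itv//= sE.
exists (- acos (p.1 / r)).
by rewrite {1}pE /polar cosN sinN acosK ?in_itv//= sE opprK.
Qed.

Lemma measurable_Ioo_ind (B : set plane) : measurable B ->
  measurable_fun setT (fun q : plane => ((0 < q.1) && (polar q.1 q.2 \in B))%:R%:E * `|q.1|%:E : \bar K)%E.
Proof.
move=> mB; apply: emeasurable_funM; last first.
  by apply/measurable_EFinP; apply: measurableT_comp.
apply/measurable_EFinP.
rewrite (_ : (fun q => _) = (fun q => \1_([set q : plane | 0 < q.1] `&`
    ((fun q => polar q.1 q.2) @^-1` B)) q)); last first.
  apply/funext => q; rewrite indicE in_setI; congr ((_ : bool)%:R).
  by congr andb; apply/idP/idP; rewrite inE.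
apply: measurable_indic; apply: measurableI.
  rewrite (_ : [set _ | _] = fst @^-1` `]0, +oo[%classic).
    by rewrite -[X in measurable X]setTI; apply: (@measurable_fst _ _ (measurableTypeR K) (measurableTypeR K)).
  by apply/seteqP; split => q /=; rewrite in_itv/= andbT.
by rewrite -[X in measurable X]setTI; apply: measurable_polar2.
Qed.

Lemma measurable_section_polar (B : set plane) (t : K) : measurable B ->
  measurable ([set r | 0 < r /\ B (polar r t)] : set (measurableTypeR K)).
Proof.
move=> mB; rewrite (_ : [set _ | _] = `]0, +oo[%classic `&` (polar ^~ t @^-1` B)).
  by apply: measurableI => //; rewrite -[X in measurable X]setTI; exact: measurable_polar.
by apply/seteqP; split => q /=; rewrite in_itv/= andbT.
Qed.

(** The set of pairs (point, angle) such that the point turned by the angle lies in [B] is null,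
    since each rotated copy of [B] is. Its section over a point has a measure depending only on the
    radius, so [ge0_integral_pnorm] turns this into a statement on radii and angles, and Tonelli
    exchanges the two. *)
Lemma null_polar_section (B : set plane) : measurable B -> P B = 0 ->
  exists t, mu [set r | 0 < r /\ B (polar r t)] = 0.
Proof.
move=> mB B0.
(* The angle runs over the whole line, so this may be infinite; only its vanishing matters, and
   translations of the angle are then available. *)
pose b (r : measurableTypeR K) := mu [set t | B (polar r t)].
have mBr (r : K) : measurable ([set t | B (polar r t)] : set (measurableTypeR K)).
  rewrite (_ : [set t | _] = xsection ((fun q : plane => polar q.1 q.2) @^-1` B) r).
    by apply: measurable_xsection; rewrite -[X in measurable X]setTI; apply: measurable_polar2.
  by apply/seteqP; split => t; rewrite /xsection/= inE.
have mb : measurable_fun setT b.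
  rewrite (_ : b = mu \o xsection ((fun q : plane => polar q.1 q.2) @^-1` B)).
    by apply: measurable_fun_xsection; rewrite -[X in measurable X]setTI; apply: measurable_polar2.
  by apply/funext => r /=; congr (mu _); apply/seteqP; split => t; rewrite /xsection/= inE.
pose E : set (plane * measurableTypeR K) := (fun q => rotcs (cos q.2) (sin q.2) q.1) @^-1` B.
have mE : measurable E by rewrite -[X in measurable X]setTI; apply: measurable_rot.
(* Passing from the positive axis to the polar angle of [p] translates the set of angles. *)
have bE p : b (pnorm p) = mu (xsection E p).
  have [s {2}->] := polarP p.
  rewrite /b -(lebesgue_measure_shift s (mBr _)).
  congr (mu _); apply/seteqP; split => t; rewrite /xsection/= inE /E /= rot_polar (addrC s)//.
have PE0 : (planeS \x mu)%E E = 0%E.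
  rewrite (product_measureE _ _ mE).
  apply: integral0_eq => t _ /=.
  rewrite (_ : ysection E t = rotcs (cos t) (sin t) @^-1` B).
    by rewrite (plane_measure_rotcs (cos2Dsin2 t) mB).
  by apply/seteqP; split => p; rewrite /ysection/= inE.
have int0 : (\int[mu]_(r in `]0%R, +oo[) (b r * r%:E) = 0)%E.
  have [kap kap0 H] := @ge0_integral_pnorm K.
  have := H b mb (fun=> measure_ge0 _ _).
  under eq_integral do rewrite bE.
  rewrite -[LHS]/((planeS \x mu)%E E) PE0 => /esym/eqP.
  by rewrite mule_eq0 eqe gt_eqF//= => /eqP.
(* The indicator cuts down to positive radii; the absolute value keeps both factors nonnegative. *)
pose phi (q : plane) := (((0 < q.1) && (polar q.1 q.2 \in B))%:R%:E * `|q.1|%:E : \bar K)%E.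
have phi0 q : (0 <= phi q)%E by rewrite /phi mule_ge0 ?lee_fin.
have mphi : measurable_fun setT phi by exact: measurable_Ioo_ind.
have : (\int[mu]_t \int[mu]_r phi (r, t) = 0)%E.
  rewrite -fubini_tonelli// -[RHS]int0 [RHS]integral_mkcond.
  apply: eq_integral => r _; rewrite patchE; case: ifPn; last first.
    rewrite notin_setE/= in_itv/= andbT => /negP/negbTE r0.
    by apply: integral0_eq => t _; rewrite /phi/= r0 mul0e.
  rewrite inE/= in_itv/= andbT => r0.
  rewrite /phi /= r0 /= gtr0_norm//.
  transitivity (\int[mu]_t (r%:E * (\1_[set t | B (polar r t)] t)%:E))%E.
    by apply: eq_integral => t _; rewrite muleC indicE; congr (_ * (_ : bool)%:R%:E)%E; apply/idP/idP; rewrite !inE.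
  rewrite ge0_integralZl ?lee_fin ?(ltW r0)//.
  - by rewrite integral_indic// setIT muleC.
  - by apply/measurable_EFinP; exact: measurable_indic.
move=> int2.
have mG : measurable_fun setT (fun t => \int[mu]_r phi (r, t))%E.
  exact: measurable_fun_fubini_tonelli_G.
have G0 t : (0 <= \int[mu]_r phi (r, t))%E by exact: integral_ge0.
have /(ae_eq_integral_abs _ measurableT mG) [Z [mZ Z0 HZ]] :
    (\int[mu]_t `|\int[mu]_r phi (r, t)| = 0)%E.
  by rewrite -[RHS]int2; apply: eq_integral => t _; rewrite gee0_abs.
have [t Zt] : exists t, ~ Z t.
  apply/existsNP => ZT; have : mu Z = mu setT by congr (mu _); apply/seteqP; split.
  rewrite Z0 => /esym; apply/eqP; rewrite gt_eqF//.
  apply: (@lt_le_trans _ _ (mu `]0, 1]%classic)).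
    by rewrite lebesgue_measure_itv/= lte_fin ltr01 -EFinD subr0 lte_fin.
  by apply: le_measure; rewrite ?inE.
exists t; pose S : set (measurableTypeR K) := [set r | 0 < r /\ B (polar r t)].
rewrite -[X in mu X]/S; have mS : measurable S by exact: measurable_section_polar.
have /(_ I) intt : setT t -> (\int[mu]_r phi (r, t) = 0)%E.
  by move=> _; apply: contrapT => h; apply: Zt; apply: HZ => /= /(_ I).
have mphit : measurable_fun setT (fun r => phi (r, t)) by apply: measurableT_comp.
have /(ae_eq_integral_abs _ measurableT mphit) [W [mW W0 HW]] :
    (\int[mu]_r `|phi (r, t)| = 0)%E.
  by rewrite -[RHS]intt; apply: eq_integral => r _; rewrite gee0_abs.
suff SW : S `<=` W by exact: (subset_measure0 mS mW SW W0).
move=> r [r0 Br]; apply: HW => /= /(_ I).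
rewrite /phi/= r0 mem_set//= mul1e => -[/eqP].
by rewrite normr_eq0 gt_eqF.
Qed.

Lemma measure_setU_eq0 d (T : measurableType d) (m : {measure set T -> \bar K}) (A B : set T) :
  measurable A -> measurable B -> m A = 0 -> m B = 0 -> m (A `|` B) = 0.
Proof.
move=> mA mB A0 B0; apply/eqP; rewrite -measure_le0.
by apply: (le_trans (measureU2 _ mA mB)); rewrite /= A0 B0 add0e.
Qed.

Lemma ae_mono d (T : measurableType d) (m : {measure set T -> \bar K}) (Q1 Q2 : T -> Prop) :
  (forall x, Q1 x -> Q2 x) -> {ae m, forall x, Q1 x} -> {ae m, forall x, Q2 x}.
Proof.
move=> h [N [mN N0 sN]]; exists N; split => //.
by apply: subset_trans sN => x /= nQ Q; apply: nQ; exact: h.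
Qed.

Lemma measurable_disc (R : \bar K) : measurable (disc R : set plane).
Proof.
rewrite (_ : disc R = [set: plane] `&` (fun p => (pnorm p)%:E) @^-1` `]-oo, R[%classic).
  have m1 : measurable_fun setT (fun p : plane => (pnorm p)%:E).
    by apply/measurable_EFinP; exact: measurable_pnorm.
  by apply: m1 => //; exact: emeasurable_itv.
by rewrite setTI; apply/seteqP; split => p; rewrite /= in_itv.
Qed.

Lemma measurable_pos_itv0R (R : \bar K) : measurable (pos_itv0R R : set (measurableTypeR K)).
Proof.
rewrite (_ : pos_itv0R R = `]0, +oo[%classic `&` (EFin @^-1` `]-oo, R[%classic)).
  apply: measurableI => //; rewrite -[X in measurable X]setTI.
  by apply: (@EFin_measurable K setT) => //; exact: emeasurable_itv.
by apply/seteqP; split => p; rewrite /= !in_itv/= andbT.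
Qed.

(** The arbitrary [H] is replaced by the values [H1] of [G] along a ray on which the two agree at
    almost every radius; [H1] is measurable, so [ge0_integral_pnorm] applies to it. *)
Lemma ge0_integral_radial : exists2 kap : K, 0 < kap &
  forall (R : \bar K) (G : plane -> \bar K) (H : K -> \bar K),
  measurable_fun (disc R) G -> (forall p, (0 <= G p)%E) -> (forall r, (0 <= H r)%E) ->
  {ae P, forall p, disc R p -> G p = H (pnorm p)} ->
  (\int[P]_(p in disc R) G p = kap%:E * \int[mu]_(r in pos_itv0R R) (H r * r%:E))%E.
Proof.
have [kap kap0 kapE] := @ge0_integral_pnorm K; exists kap => //.
move=> R G H mG G0 H0 [N [mN N0 GH]].
have [t tN] := null_polar_section mN N0.
pose S : set (measurableTypeR K) := [set r | 0 < r /\ N (polar r t)].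
have mS : measurable S := measurable_section_polar t mN.
rewrite -[X in mu X = _]/S in tN.
have mD := measurable_disc R.
pose G1 := G \_ (disc R).
have mG1 : measurable_fun setT G1 by exact: (measurable_restrictT _ mD).1 mG.
have G10 p : (0 <= G1 p)%E by rewrite /G1 patchE; case: ifPn.
pose H1 (r : measurableTypeR K) := G1 (polar r t).
have mH1 : measurable_fun setT H1.
  by apply: measurableT_comp => //; exact: measurable_polar.
(* The exceptional radii: those at which the ray meets [N], and 0, about which [S] says nothing. *)
pose A := S `|` [set 0].
have mA : measurable A by apply: measurableU.
have A0 : mu A = 0.
  by apply: measure_setU_eq0 => //; exact: lebesgue_measure_set1.
(* The polar formula for the indicator of [A] shows that the circles of exceptional radius form a
   planar null set. *)
have PA0 : P (pnorm @^-1` A) = 0.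
  have mpA : measurable (pnorm @^-1` A : set plane).
    by rewrite -[X in measurable X]setTI; apply: measurable_pnorm.
  have := kapE (fun r => (\1_A r)%:E).
  have mi : measurable_fun setT (fun r : measurableTypeR K => (\1_A r)%:E : \bar K).
    by apply/measurable_EFinP; exact: measurable_indic.
  move=> /(_ mi (fun r => ltac:(by rewrite lee_fin indicE))).
  rewrite (_ : (\int[P]_p _)%E = P (pnorm @^-1` A)); last first.
    by rewrite -[pnorm @^-1` A]setIT -(integral_indic _ measurableT mpA).
  move=> ->; rewrite (_ : (\int[mu]_(r in _) _)%E = 0%E) ?mule0//.
  rewrite (@ge0_negligible_integral _ _ _ mu _ A)//.
  - apply: integral0_eq => r [_ rA]; rewrite indicE memNset// mul0e//.
  - by apply: emeasurable_funM; [exact: measurable_funTS|exact: measurable_funTS].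
  - by move=> r /=; rewrite in_itv/= andbT => r0; rewrite mule_ge0// ?lee_fin ?indicE// ltW.
have HN p : disc R p -> ~ N p -> G p = H (pnorm p).
  by move=> Rp; apply: contra_notP => GHp; apply: GH => /= /(_ Rp).
have discE p q : pnorm p = pnorm q -> disc R p = disc R q.
  by rewrite /disc /= -!/(pnorm _) => ->.
transitivity (\int[P]_p H1 (pnorm p))%E.
  rewrite integral_mkcond; apply: ge0_ae_eq_integral => //.
  - by apply: measurableT_comp => //; exact: measurable_pnorm.
  - by move=> p _; exact: G10.
  suff h : {ae P, forall p, G1 p = H1 (pnorm p)} by exact: (ae_mono (fun p e _ => e) h).
  exists (N `|` pnorm @^-1` A); split.
  - by apply: measurableU => //; rewrite -[X in measurable X]setTI; apply: measurable_pnorm.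
  - apply: measure_setU_eq0 => //.
    by rewrite -[X in measurable X]setTI; apply: measurable_pnorm.
  move=> p /=; apply: contra_notP => /not_orP[Np /not_orP[Sp p0]].
  have {}p0 : 0 < pnorm p by rewrite lt_neqAle pnorm_ge0 andbT eq_sym; apply/eqP.
  have nE : pnorm (polar (pnorm p) t) = pnorm p by rewrite pnorm_polar ?pnorm_ge0.
  rewrite /H1 /G1 !patchE.
  have [Rp|Rp] := pselect (disc R p); last first.
    by rewrite !memNset// (discE _ _ nE).
  rewrite !mem_set// ?(discE _ _ nE)// HN// HN// ?(discE _ _ nE)// ?nE//.
  by move=> Np'; apply: Sp.
rewrite (kapE _ mH1 (fun r => G10 _)); congr (_ * _)%E.
have mR := measurable_pos_itv0R R.
rewrite [LHS]integral_mkcond (_ : (fun r => _) \_ _ =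
    (fun r => H1 r * r%:E)%E \_ (pos_itv0R R)); last first.
  apply/funext => r; rewrite !patchE; case: ifPn; rewrite ?inE ?notin_setE /= in_itv/= andbT => r0.
    case: ifPn => //; rewrite notin_setE /pos_itv0R/= => /not_andP[//|rR].
    rewrite /H1 /G1 patchE memNset ?mul0e//.
    by rewrite -[disc R _]/(is_true ((pnorm (polar r t))%:E < R)%E) pnorm_polar// ltW.
  by rewrite memNset// => -[].
rewrite -integral_mkcond; apply/esym.
apply: (ge0_integral_eq_off_null mR mA A0).
- by apply: measurable_funTS; apply: emeasurable_funM => //; exact/measurable_EFinP.
- by move=> r [r0 _]; rewrite mule_ge0// lee_fin ltW.
- by move=> r [r0 _]; apply: mule_ge0; [exact: G10|rewrite lee_fin ltW].
move=> r [r0 rR] /not_orP[Sr _]; congr (_ * _)%E.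
have nE : pnorm (polar r t) = r by rewrite pnorm_polar// ltW.
have Rp : disc R (polar r t) by rewrite -[disc R _]/(is_true ((pnorm (polar r t))%:E < R)%E) nE.
rewrite /H1 /G1 patchE mem_set// HN ?nE// => Np.
by apply: Sr.
Qed.

Lemma Rintegral_radial : exists2 kap : K, 0 < kap &
  forall (R : \bar K) (G : plane -> K) (H : K -> K),
  measurable_fun (disc R) G -> {ae P, forall p, disc R p -> G p = H (pnorm p)} ->
  \int[P]_(p in disc R) G p = kap * \int[mu]_(r in pos_itv0R R) (H r * r).
Proof.
have [kap kap0 kapE] := ge0_integral_radial; exists kap => //.
move=> R G H mG GH.
have mG' : measurable_fun (disc R) (fun p => (G p)%:E) by exact/measurable_EFinP.
rewrite /Rintegral integralE [X in _ = _ * fine X]integralE.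
rewrite (kapE R _ (fun r => (EFin \o H)^\+ r)%E) //; last 2 first.
- exact: measurable_funepos.
- by apply: ae_mono GH => p h Rp; rewrite !funeposE /= h.
rewrite (kapE R _ (fun r => (EFin \o H)^\- r)%E) //; last 2 first.
- exact: measurable_funeneg.
- by apply: ae_mono GH => p h Rp; rewrite !funenegE /= h.
rewrite -[X in _ = X * _]/(fine kap%:E).
have posE (h : K -> \bar K) (h' : K -> \bar K) :
   (forall r : K, 0 < r -> (h r * r%:E)%E = h' r) ->
   (\int[mu]_(r in pos_itv0R R) (h r * r%:E) = \int[mu]_(r in pos_itv0R R) h' r)%E.
  by move=> hh'; apply: eq_integral => r; rewrite inE => -[r0 _]; exact: hh'.
rewrite (posE _ (fun r => (H r * r)%:E)^\+)%E; last first.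
  move=> r r0; rewrite !funeposE /= -!EFin_max -EFinM.
  by rewrite maxr_pMl ?ltW// mul0r.
rewrite (posE _ (fun r => (H r * r)%:E)^\-)%E; last first.
  move=> r r0; rewrite !funenegE /= -!EFin_max -EFinM.
  by rewrite maxr_pMl ?ltW// mul0r mulNr.
set a := (\int[_]_(_ in _) _)%E; set c := (\int[_]_(_ in _) _)%E.
have a0 : (0 <= a)%E by apply: integral_ge0.
have c0 : (0 <= c)%E by apply: integral_ge0.
clearbody a c.
(* [fine] sends infinite values to 0, so the two sides also agree when a part is infinite. *)
have kinf : (kap%:E * +oo = +oo)%E by rewrite gt0_muley// lte_fin.
case: a a0 => [a| |] // _; case: c c0 => [c| |] // _; rewrite ?kinf -?EFinM -?EFinB /= ?mulr0 //.
by rewrite mulrBr.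
Qed.

End RadialIntegral.

(** * Partial derivatives and smooth functions *)

Section RealCalculus.
Context {K : realType}.
Implicit Types (u : K * K -> K) (g : K -> K).

Lemma is_derive_line (V : normedModType K) (f : V -> K) (g : K -> K) (p v : V) (t l : K) :
  (forall h, f (h *: v + p) = g (h + t)) -> is_derive p v f l <-> is_derive t 1 g l.
Proof.
move=> fg.
have E : (fun h : K => h^-1 *: ((f \o shift p) (h *: v) - f p)) =
         (fun h : K => h^-1 *: ((g \o shift t) (h *: 1) - g t)).
  apply/funext => h /=; rewrite fg [h *: 1]mulr1.
  by have := fg 0; rewrite scale0r !add0r => ->.
by split=> -[d e]; split; move: d e; rewrite /derivable /derive ?E// -?E.
Qed.

(** The difference quotient in product form: errors add up without division, and the increment 0 is
    no exception. *)
Lemma is_deriveP (V : normedModType K) (f : V -> K) (p v : V) (l : K) :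
  is_derive p v f l <->
  forall e, 0 < e -> \forall h \near (0 : K), `|f (h *: v + p) - f p - h * l| <= e * `|h|.
Proof.
split=> [[df <-] e e0|H].
  move: df => /cvgrPdist_le /(_ e e0) H.
  rewrite -/(derive f p v) in H.
  have : \forall h \near 0^', `|f (h *: v + p) - f p - h * 'D_v f p| <= e * `|h|.
    near=> h.
    have h0 : h != 0 by near: h; exact: nbhs_dnbhs_neq.
    have : `|'D_v f p - h^-1 *: (f (h *: v + p) - f p)| <= e by near: h.
    rewrite distrC -(ler_pM2r (_ : 0 < `|h|)) ?normr_gt0// -normrM mulrBl.
    by rewrite [_ *: _ * h]mulrAC mulVf// mul1r (mulrC h).
  rewrite near_withinE => Hn; near=> h.
  have [->|h0] := eqVneq h 0; first by rewrite scale0r add0r subrr mul0r subrr normr0 mulr0.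
  by move: h0; near: h.
have cv : (fun h : K => h^-1 *: ((f \o shift p) (h *: v) - f p)) @ 0^' --> l.
  apply/cvgrPdist_le => e e0; have := H e e0 => He.
  rewrite near_withinE; near=> h => h0.
  rewrite distrC -(ler_pM2r (_ : 0 < `|h|)) ?normr_gt0// -normrM mulrBl.
  rewrite [_ *: _ * h]mulrAC mulVf// mul1r (mulrC l).
  by near: h.
split; first by apply/cvg_ex; exists l.
by apply: cvg_lim.
Unshelve. all: by end_near. Qed.

Lemma is_derive_scale_dir (V : normedModType K) (f : V -> K) (p v : V) (l b : K) :
  is_derive p v f l -> is_derive p (b *: v) f (b * l).
Proof.
have [->|b0] := eqVneq b 0; first by rewrite scale0r mul0r => _; exact: is_derive0.
move/is_deriveP => H; apply/is_deriveP => e e0.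
have eb0 : 0 < e / `|b| by rewrite divr_gt0 // normr_gt0.
have Hb := H _ eb0.
have {}Hb := @near0Z _ K^o b _ Hb.
apply: filterS Hb => h.
rewrite -[h *: b]/(h * b).
by rewrite scalerA mulrA normrM (mulrC `|h|) mulrA divfK ?normr_eq0.
Qed.

(** The endpoints come in either order, so increments may have any sign. Differentiability is asked
    strictly between them, which permits a singular endpoint. *)
Lemma MVT_le (g dg : K -> K) (a b : K) : continuous g ->
  (forall t, Num.min a b < t < Num.max a b -> is_derive t 1 g (dg t)) ->
  exists2 c, `|c - a| <= `|b - a| & g b - g a = dg c * (b - a).
Proof.
move=> cg dg_; have [ab|ba|->] := ltgtP a b; last first.
- by exists b; rewrite ?subrr ?mulr0 ?normr0.
- have [|c] := @MVT K g dg b a ba _ (continuous_subspaceT cg).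
    by move=> x; rewrite in_itv/= => xab; apply: dg_; rewrite minEle maxEle leNgt ba/=.
  rewrite in_itv/= => /andP[bc ca] E; exists c; last by rewrite -opprB E -mulrN opprB.
  by rewrite !ltr0_norm ?subr_lt0// lerN2 lerD2r ltW.
- have [|c] := @MVT K g dg a b ab _ (continuous_subspaceT cg).
    by move=> x; rewrite in_itv/= => xab; apply: dg_; rewrite minEle maxEle (ltW ab).
  rewrite in_itv/= => /andP[ac cb] E; exists c => //.
  by rewrite !gtr0_norm ?subr_gt0// lerD2r ltW.
Qed.

Lemma is_derive_continuous g (dg : K -> K) :
  (forall t : K, is_derive t 1 g (dg t)) -> continuous g.
Proof.
by move=> H t; apply: differentiable_continuous; apply/derivable1_diffP; case: (H t).
Qed.

Lemma is_derive_exP u (x y l : K) :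
  is_derive (x, y) ex u l <-> is_derive x 1 (fun t => u (t, y)) l.
Proof.
apply: is_derive_line => h; congr u.
by rewrite /ex; congr pair => /=; [rewrite [_ *: _]mulr1|rewrite [_ *: _]mulr0 add0r].
Qed.

Lemma is_derive_eyP u (x y l : K) :
  is_derive (x, y) ey u l <-> is_derive y 1 (fun t => u (x, t)) l.
Proof.
apply: is_derive_line => h; congr u.
by rewrite /ey; congr pair => /=; [rewrite [_ *: _]mulr0 add0r|rewrite [_ *: _]mulr1].
Qed.

Lemma near_square (p : K * K) (Q : K * K -> Prop) : (\forall q \near p, Q q) ->
  exists2 e, 0 < e & forall x y, `|x - p.1| <= e -> `|y - p.2| <= e -> Q (x, y).
Proof.
move=> /nbhs_ballP[e /= e0 He]; exists (e / 2); first by rewrite divr_gt0.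
move=> x y xp yp; apply: He; split => /=; rewrite /ball/= distrC.
  by apply: (le_lt_trans xp); rewrite ltr_pdivrMr// ltr_pMr// ltr1n.
by apply: (le_lt_trans yp); rewrite ltr_pdivrMr// ltr_pMr// ltr1n.
Qed.

Lemma near_squareP (p : K * K) (Q : K * K -> Prop) (e : K) : 0 < e ->
  (forall x y, `|x - p.1| < e -> `|y - p.2| < e -> Q (x, y)) -> \forall q \near p, Q q.
Proof.
move=> e0 H; apply/nbhs_ballP; exists e => //= -[x y] [/= xp yp].
by apply: H; rewrite distrC.
Qed.

(** Move first along y from [p], where differentiability at [p] gives the increment, then along x by
    the mean value theorem, where continuity of [ux] at [p] controls the error. *)
Lemma is_derive_dir u (ux uy : K * K -> K) (p : K * K) (a b : K) :
  (forall q, is_derive q ex u (ux q)) -> is_derive p ey u (uy p) ->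
  {for p, continuous ux} ->
  is_derive p (a, b) u (a * ux p + b * uy p).
Proof.
move=> dx dy cx; apply/is_deriveP => e e0.
have e2 : 0 < e / 2 by rewrite divr_gt0.
have /is_deriveP/(_ _ e2) Hy := @is_derive_scale_dir _ u p ey (uy p) b dy.
(* Adding 1 keeps the denominator positive when [a] is 0. *)
have eA : 0 < e / 2 / (`|a| + 1) by rewrite divr_gt0// ltr_wpDl.
move: cx => /cvgrPdist_le /(_ _ eA) /near_square[d d0 Hd].
near=> h.
have hA : `|h * a| <= d.
  have : `|h| * (`|a| + 1) <= d.
    rewrite -ler_pdivlMr ?ltr_wpDl//; near: h.
    by apply: (@nbhs0_le _ K^o); rewrite divr_gt0// ltr_wpDl.
  rewrite normrM; apply: le_trans; rewrite ler_wpM2l// lerDl//.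
have hB : `|h * b| <= d.
  have : `|h| * (`|b| + 1) <= d.
    rewrite -ler_pdivlMr ?ltr_wpDl//; near: h.
    by apply: (@nbhs0_le _ K^o); rewrite divr_gt0// ltr_wpDl.
  rewrite normrM; apply: le_trans; rewrite ler_wpM2l// lerDl//.
have T2 : `|u (h *: (b *: ey) + p) - u p - h * (b * uy p)| <= e / 2 * `|h| by near: h.
have pE : p = (p.1, p.2) by case: (p).
have -> : h *: (a, b) + p = (p.1 + h * a, p.2 + h * b).
  by rewrite {1}pE; congr pair => /=; rewrite addrC.
have vE : h *: (b *: ey) + p = (p.1, p.2 + h * b).
  rewrite {1}pE /ey; congr pair => /=; rewrite addrC.
    by rewrite [b *: 0]mulr0 [h *: 0]mulr0 addr0.
  by rewrite [b *: 1]mulr1.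
rewrite vE in T2.
set y := p.2 + h * b in T2 *.
have dgx (t : K) : is_derive t 1 (fun t => u (t, y)) (ux (t, y)) by exact/is_derive_exP.
have [c cp cE] := @MVT_le (fun t => u (t, y)) (fun t => ux (t, y)) p.1 (p.1 + h * a)
  (is_derive_continuous dgx) (fun t _ => dgx t).
have ca : `|ux p - ux (c, y)| <= e / 2 / (`|a| + 1).
  apply: Hd; last by rewrite /y addrAC subrr add0r.
  by apply: (le_trans cp); rewrite addrAC subrr add0r.
rewrite addrAC subrr add0r in cE.
have -> : u (p.1 + h * a, y) - u p - h * (a * ux p + b * uy p) =
  (u (p.1, y) - u p - h * (b * uy p)) + (ux (c, y) - ux p) * (h * a).
  by rewrite mulrBl -cE; ring.
apply: (le_trans (ler_normD _ _)).
rewrite [leRHS](_ : _ = e / 2 * `|h| + e / 2 * `|h|); last by field.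
rewrite lerD// normrM distrC normrM.
apply: (@le_trans _ _ (e / 2 / (`|a| + 1) * (`|h| * (`|a| + 1)))).
  apply: ler_pM => //; rewrite ?mulr_ge0//.
  by rewrite ler_wpM2l// lerDl.
by rewrite (mulrC `|h|) mulrA divfK// gt_eqF// ltr_wpDl.
Unshelve. all: by end_near. Qed.

(** Bounded partial derivatives make [u] Lipschitz. This is how angular averages are shown to be
    continuous. *)
Lemma bounded_partials_continuous u (ux uy : K * K -> K) (M : K) :
  (forall q, is_derive q ex u (ux q)) -> (forall q, is_derive q ey u (uy q)) ->
  (forall q, `|ux q| <= M) -> (forall q, `|uy q| <= M) -> continuous u.
Proof.
move=> dx dy Mx My [x y]; apply/cvgrPdist_le => e e0.
have M0 : 0 <= M by apply: le_trans (Mx 0).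
have M1 : 0 < 2 * (M + 1) by rewrite mulr_gt0// ltr_wpDl.
apply: (@near_squareP _ _ (e / (2 * (M + 1)))); first by rewrite divr_gt0.
move=> x' y' /= xx yy.
have dgx (t : K) : is_derive t 1 (fun t => u (t, y')) (ux (t, y')) by exact/is_derive_exP.
have dgy (t : K) : is_derive t 1 (fun t => u (x, t)) (uy (x, t)) by exact/is_derive_eyP.
have [c _ cE] := @MVT_le _ _ x x' (is_derive_continuous dgx) (fun t _ => dgx t).
have [d _ dE] := @MVT_le _ _ y y' (is_derive_continuous dgy) (fun t _ => dgy t).
have -> : u (x, y) - u (x', y') = - (ux (c, y') * (x' - x) + uy (x, d) * (y' - y)).
  by rewrite -cE -dE; ring.
rewrite normrN; apply: (le_trans (ler_normD _ _)); rewrite !normrM.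
have H z z' (w : K) : `|w| <= M -> `|z' - z| < e / (2 * (M + 1)) -> `|w| * `|z' - z| <= e / 2.
  move=> wM zz; apply: (@le_trans _ _ ((M + 1) * (e / (2 * (M + 1))))).
    by apply: ler_pM => //; [apply: (le_trans wM); rewrite lerDl|exact: ltW].
  by rewrite le_eqVlt; apply/orP; left; apply/eqP; field; rewrite gt_eqF// ltr_wpDl.
by rewrite [leRHS](_ : _ = e / 2 + e / 2); [rewrite lerD// H|field].
Qed.

(** Schwarz's theorem: by the mean value theorem, the second difference over a small square, divided
    by [h * h], is a value of [uxy] in the square and also a value of [uyx] in it. *)
Lemma derive_swap u (ux uy uxy uyx : K * K -> K) :
  (forall q, is_derive q ex u (ux q)) -> (forall q, is_derive q ey u (uy q)) ->
  (forall q, is_derive q ey ux (uxy q)) -> (forall q, is_derive q ex uy (uyx q)) ->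
  continuous uxy -> continuous uyx -> uxy = uyx.
Proof.
move=> dx dy dxy dyx cxy cyx; apply/funext => -[x y].
apply/eqP; rewrite eq_le; apply/andP.
suff H e : 0 < e -> `|uxy (x, y) - uyx (x, y)| <= e.
  by apply/andP; rewrite -eq_le -subr_eq0 -normr_le0; apply/ler_addgt0Pl => e e0; rewrite addr0 H.
move=> e0; have e2 : 0 < e / 2 by rewrite divr_gt0.
have := cxy (x, y) => /cvgrPdist_le /(_ _ e2) /near_square[d1 d10 H1].
have := cyx (x, y) => /cvgrPdist_le /(_ _ e2) /near_square[d2 d20 H2].
pose h := Num.min d1 d2.
have h0 : 0 < h by rewrite lt_min d10 d20.
pose x' := x + h; pose y' := y + h.
have xh : x' - x = h by rewrite /x' addrAC subrr add0r.
have yh : y' - y = h by rewrite /y' addrAC subrr add0r.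
pose A t := u (t, y') - u (t, y); pose B t := u (x', t) - u (x, t).
have dA (t : K) : is_derive t 1 A (ux (t, y') - ux (t, y)).
  by apply: is_deriveB; exact/is_derive_exP.
have dB (t : K) : is_derive t 1 B (uy (x', t) - uy (x, t)).
  by apply: is_deriveB; exact/is_derive_eyP.
have [c cx cE] := @MVT_le A _ x x' (is_derive_continuous dA) (fun t _ => dA t).
have [d dy' dE] := @MVT_le B _ y y' (is_derive_continuous dB) (fun t _ => dB t).
have dcx (t : K) : is_derive t 1 (fun t => ux (c, t)) (uxy (c, t)) by exact/is_derive_eyP.
have ddy (t : K) : is_derive t 1 (fun t => uy (t, d)) (uyx (t, d)) by exact/is_derive_exP.
have [c' cy' c'E] := @MVT_le _ _ y y' (is_derive_continuous dcx) (fun t _ => dcx t).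
have [d' dx' d'E] := @MVT_le _ _ x x' (is_derive_continuous ddy) (fun t _ => ddy t).
rewrite c'E xh yh in cE; rewrite d'E xh yh in dE.
have E : uxy (c, c') = uyx (d', d).
  have hn : h * h != 0 by rewrite mulf_neq0 ?gt_eqF.
  by apply: (mulIf hn); rewrite !mulrA -cE -dE /A /B; ring.
have h1 : h <= d1 by rewrite ge_min lexx.
have h2 : h <= d2 by rewrite ge_min lexx orbT.
rewrite xh (gtr0_norm h0) in cx; rewrite yh (gtr0_norm h0) in dy'.
rewrite yh (gtr0_norm h0) in cy'; rewrite xh (gtr0_norm h0) in dx'.
have : `|uxy (x, y) - uxy (c, c')| <= e / 2 by apply: H1; [exact: (le_trans cx h1)|exact: (le_trans cy' h1)].
have : `|uyx (x, y) - uyx (d', d)| <= e / 2 by apply: H2; apply: (le_trans _ h2).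
rewrite E => E2 E1.
rewrite [X in `|X|](_ : _ = (uxy (x, y) - uyx (d', d)) - (uyx (x, y) - uyx (d', d))); last by ring.
by apply: (le_trans (ler_normB _ _)); rewrite [leRHS](_ : _ = e / 2 + e / 2); [exact: lerD|field].
Qed.

Lemma is_derive_removable g (dg : K -> K) : continuous g ->
  (forall t : K, t != 0 -> is_derive t 1 g (dg t)) -> {for 0, continuous dg} ->
  is_derive (0 : K) 1 g (dg 0).
Proof.
move=> cg dg_ cdg; apply/is_deriveP => e e0.
move: cdg => /cvgrPdist_le /(_ _ e0) /nbhs_ballP [d /= d0 Hd].
near=> h.
have [|c ch E] := @MVT_le g dg 0 h cg.
  move=> t /andP[t1 t2]; apply: dg_; apply/eqP => t0; move: t1 t2; rewrite t0.
  by rewrite gt_min lt_max !ltxx/= => /lt_trans/[apply]; rewrite ltxx.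
rewrite !subr0 in ch E.
rewrite addr0 [h *: 1]mulr1 E [X in `|X|](_ : _ = (dg c - dg 0) * h); last by ring.
rewrite normrM ler_wpM2r// distrC; apply: Hd; rewrite /ball/= sub0r normrN.
apply: (le_lt_trans ch); near: h; exact: (@nbhs0_lt _ K^o).
Unshelve. all: by end_near. Qed.

End RealCalculus.

(** * Complex-valued derivatives and jets *)

Section ComplexCalculus.
Context {K : realType}.
Local Notation C := K[i].
Local Notation Re := (@complex.Re K).
Local Notation Im := (@complex.Im K).

Lemma cReD (z w : C) : Re (z + w) = Re z + Re w. Proof. by case: z; case: w. Qed.
Lemma cImD (z w : C) : Im (z + w) = Im z + Im w. Proof. by case: z; case: w. Qed.
Lemma cReN (z : C) : Re (- z) = - Re z. Proof. by case: z. Qed.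
Lemma cImN (z : C) : Im (- z) = - Im z. Proof. by case: z. Qed.
Lemma cReM (z w : C) : Re (z * w) = Re z * Re w - Im z * Im w.
Proof. by case: z; case: w. Qed.
Lemma cImM (z w : C) : Im (z * w) = Re z * Im w + Im z * Re w.
Proof. by case: z; case: w. Qed.
Lemma complexP (z w : C) : Re z = Re w -> Im z = Im w -> z = w.
Proof. by case: z => a b; case: w => c d /= -> ->. Qed.
Lemma Re_i : Re 'i%C = 0. Proof. by []. Qed.
Lemma Im_i : Im 'i%C = 1. Proof. by []. Qed.
Lemma sqr_iC : 'i%C * 'i%C = -1 :> C.
Proof. by apply: complexP; rewrite ?cReM ?cImM ?cReN ?cImN /= ; ring. Qed.

Definition ReImE := (cReD, cImD, cReN, cImN, cReM, cImM, Re_i, Im_i).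

Lemma leibniz_re (a b c d x y z t : K) :
  a *: b + c *: d - (x *: y + z *: t) = d * c - t * z + (a * b - x * y).
Proof. by rewrite -![_ *: _]/(_ * _); ring. Qed.

Lemma leibniz_im (a b c d x y z t : K) :
  a *: b + c *: d + (x *: y + z *: t) = d * c + t * z + (a * b + x * y).
Proof. by rewrite -![_ *: _]/(_ * _); ring. Qed.

(** [cderive] is total, so existence and value are carried together. *)
Definition is_cder (V : normedModType K) (p v : V) (f : V -> C) (l : C) :=
  is_derive p v (re_part f) (Re l) /\ is_derive p v (im_part f) (Im l).

Section Rules.
Variables (V : normedModType K) (p v : V).
Implicit Types f g : V -> C.

Lemma is_cder_derivable f l : is_cder p v f l -> cderivable f p v.
Proof. by move=> [[d _] [d' _]]; split. Qed.

Lemma is_cder_val f l : is_cder p v f l -> cderive v f p = l.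
Proof. by move=> [[_ e] [_ e']]; apply: complexP. Qed.

Lemma cderivableP f : cderivable f p v -> is_cder p v f (cderive v f p).
Proof. by move=> [d d']; split; exact: derivableP. Qed.

Lemma is_cder_cst (c : C) : is_cder p v (fun=> c) 0.
Proof. by split; exact: is_derive_cst. Qed.

Lemma is_cderD f g l m : is_cder p v f l -> is_cder p v g m ->
  is_cder p v (fun q => f q + g q) (l + m).
Proof.
move=> [d1 d2] [e1 e2]; split.
- rewrite (_ : re_part _ = re_part f + re_part g) ?cReD; first exact: is_deriveD.
  by apply/funext => q; rewrite /re_part cReD.
- rewrite (_ : im_part _ = im_part f + im_part g) ?cImD; first exact: is_deriveD.
  by apply/funext => q; rewrite /im_part cImD.
Qed.

Lemma is_cderM f g l m : is_cder p v f l -> is_cder p v g m ->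
  is_cder p v (fun q => f q * g q) (l * g p + f p * m).
Proof.
move=> [d1 d2] [e1 e2]; split.
- rewrite (_ : re_part _ = re_part f * re_part g - im_part f * im_part g); last first.
    by apply/funext => q; rewrite /re_part cReM.
  have D := is_deriveB (is_deriveM d1 e1) (is_deriveM d2 e2).
  apply: (is_derive_eq D); rewrite !ReImE /re_part /im_part.
  exact: leibniz_re.
- rewrite (_ : im_part _ = re_part f * im_part g + im_part f * re_part g); last first.
    by apply/funext => q; rewrite /im_part cImM.
  have D := is_deriveD (is_deriveM d1 e2) (is_deriveM d2 e1).
  apply: (is_derive_eq D); rewrite !ReImE /re_part /im_part.
  exact: leibniz_im.
Qed.

Lemma is_cder_eq f l l' : is_cder p v f l -> l = l' -> is_cder p v f l'.
Proof. by move=> h <-. Qed.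

Lemma is_cderZ (c : C) f l : is_cder p v f l -> is_cder p v (fun q => c * f q) (c * l).
Proof.
by move=> d; apply: (is_cder_eq (is_cderM (is_cder_cst c) d)); rewrite mul0r add0r.
Qed.

Lemma is_cder_sum I (r : seq I) (F : I -> V -> C) (l : I -> C) :
  (forall i, is_cder p v (F i) (l i)) ->
  is_cder p v (fun q => \sum_(i <- r) F i q) (\sum_(i <- r) l i).
Proof.
move=> H; elim: r => [|i r IH].
  rewrite big_nil (_ : (fun q => _) = fun=> 0); first exact: is_cder_cst.
  by apply/funext => q; rewrite big_nil.
rewrite big_cons (_ : (fun q => _) = fun q => F i q + \sum_(i <- r) F i q).
  exact: is_cderD.
by apply/funext => q; rewrite big_cons.
Qed.

Lemma is_cder_near f g l : (\near p, f p = g p) -> is_cder p v f l -> is_cder p v g l.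
Proof.
move=> fg [d1 d2]; split; [apply: near_eq_is_derive d1|apply: near_eq_is_derive d2].
- by apply: filterS fg => q; rewrite /re_part => ->.
- by apply: filterS fg => q; rewrite /im_part => ->.
Qed.

Lemma is_cder_line f (g : K -> C) (t : K) l :
  (forall h, f (h *: v + p) = g (h + t)) -> is_cder p v f l <-> is_cder t (1 : K) g l.
Proof.
move=> fg; have fr h : re_part f (h *: v + p) = re_part g (h + t) by rewrite /re_part fg.
have fi h : im_part f (h *: v + p) = im_part g (h + t) by rewrite /im_part fg.
by split=> -[]; split; move: a b => /(is_derive_line _ fr) a /(is_derive_line _ fi) b.
Qed.

End Rules.

Lemma is_cder_exP (f : K * K -> C) (x y : K) l :
  is_cder (x, y) ex f l <-> is_cder x (1 : K) (fun t => f (t, y)) l.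
Proof. by split=> -[d1 d2]; split; exact/is_derive_exP. Qed.

Lemma is_cder_eyP (f : K * K -> C) (x y : K) l :
  is_cder (x, y) ey f l <-> is_cder y (1 : K) (fun t => f (x, t)) l.
Proof. by split=> -[d1 d2]; split; exact/is_derive_eyP. Qed.

Definition ccont (T : topologicalType) (f : T -> C) :=
  continuous (re_part f) /\ continuous (im_part f).

Lemma ccont_within (T : topologicalType) (f : T -> C) :
  ccontinuous_within setT f <-> ccont f.
Proof.
have H (g : T -> K) := continuous_subspace_setT g.
by split=> -[f1 f2]; split; [exact: (H _).2 f1|exact: (H _).2 f2|exact: (H _).1 f1|exact: (H _).1 f2].
Qed.

Lemma ccont_comb (T : topologicalType) (c : C) (f g : T -> C) : ccont f -> ccont g ->
  ccont (fun q => f q + c * g q).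
Proof.
move=> [f1 f2] [g1 g2]; split => x.
- rewrite (_ : re_part _ = fun q => re_part f q + (Re c * re_part g q - Im c * im_part g q)).
    apply: cvgD; first exact: f1.
    by apply: cvgB; apply: cvgMr; [exact: g1|exact: g2].
  by apply/funext => q; rewrite /re_part /im_part !ReImE.
- rewrite (_ : im_part _ = fun q => im_part f q + (Re c * im_part g q + Im c * re_part g q)).
    apply: cvgD; first exact: f2.
    by apply: cvgD; apply: cvgMr; [exact: g2|exact: g1].
  by apply/funext => q; rewrite /re_part /im_part !ReImE.
Qed.

Lemma ccont_cst (T : topologicalType) (c : C) : ccont ((fun=> c) : T -> C).
Proof. by split => x; exact: cvg_cst. Qed.

Definition evec (b : bool) : K * K := if b then ex else ey.

Lemma smoothP (f : K * K -> C) : smooth f <->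
  forall w, ccont (partials w f) /\ forall b p, cderivable (partials w f) p (evec b).
Proof.
split=> H w.
  have [c d e] := H w; split; first exact/ccont_within.
  by case=> p; [exact: d|exact: e].
by have [c d] := H w; split; [exact/ccont_within|exact: (d true)|exact: (d false)].
Qed.

Lemma partials_rcons w b (f : K * K -> C) :
  partials (rcons w b) f = partials w (cderive (evec b) f).
Proof. by rewrite /partials -cats1 foldr_cat. Qed.

Lemma smooth_cderive b (f : K * K -> C) : smooth f -> smooth (cderive (evec b) f).
Proof. by move=> sf w; have := sf (rcons w b); rewrite partials_rcons. Qed.

Lemma partials_comb w (c : C) (f g : K * K -> C) : smooth f -> smooth g ->
  partials w (fun q => f q + c * g q) = fun q => partials w f q + c * partials w g q.
Proof.
move=> /smoothP sf /smoothP sg; elim: w => //= b w ->.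
apply/funext => p; apply: is_cder_val.
have [_ df] := sf w; have [_ dg] := sg w.
apply: is_cderD; first exact/cderivableP/(df b).
exact/is_cderZ/cderivableP/(dg b).
Qed.

Lemma smooth_comb (c : C) (f g : K * K -> C) : smooth f -> smooth g ->
  smooth (fun q => f q + c * g q).
Proof.
move=> sf sg; apply/smoothP => w; rewrite partials_comb//.
move: sf sg => /smoothP/(_ w)[cf df] /smoothP/(_ w)[cg dg].
split=> [|b p]; first exact: ccont_comb.
apply: is_cder_derivable; apply: is_cderD; first exact/cderivableP/(df b p).
exact/is_cderZ/cderivableP/(dg b p).
Qed.

Lemma smooth_cst (c : C) : smooth (fun=> c).
Proof.
apply/smoothP => w; suff [d ->] : exists d, partials w (fun=> c) = fun=> d.
  by split=> [|b p]; [exact: ccont_cst|exact: is_cder_derivable (is_cder_cst _ _ _)].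
elim: w => [|b w [d IH]] /=; first by exists c.
exists 0; rewrite IH; apply/funext => p; apply: is_cder_val; exact: is_cder_cst.
Qed.

Lemma smooth_scale (c : C) (f : K * K -> C) : smooth f -> smooth (fun q => c * f q).
Proof.
move=> sf; have := smooth_comb c (smooth_cst 0) sf.
by congr smooth; apply/funext => q; rewrite add0r.
Qed.

Lemma smooth_swap (f : K * K -> C) : smooth f ->
  cderive ey (cderive ex f) = cderive ex (cderive ey f).
Proof.
move=> sf.
have sx := smooth_cderive true sf; have sy := smooth_cderive false sf.
have sxy := smooth_cderive false sx; have syx := smooth_cderive true sy.
have [_ df] := (smoothP f).1 sf [::]; have [_ dx] := (smoothP _).1 sx [::].
have [_ dy] := (smoothP _).1 sy [::].
have [cxy _] := (smoothP _).1 sxy [::]; have [cyx _] := (smoothP _).1 syx [::].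
suff [ER EI] : re_part (cderive ey (cderive ex f)) = re_part (cderive ex (cderive ey f)) /\
    im_part (cderive ey (cderive ex f)) = im_part (cderive ex (cderive ey f)).
  by apply/funext => q; apply: complexP; [move: ER|move: EI] => /(congr1 (@^~ q)).
have D b g : (forall b p, cderivable g p (evec b)) -> forall q,
    is_derive q (evec b) (re_part g) (re_part (cderive (evec b) g) q) /\
    is_derive q (evec b) (im_part g) (im_part (cderive (evec b) g) q).
  by move=> dg q; have := cderivableP (dg b q).
split.
- apply: (@derive_swap _ (re_part f) (re_part (cderive ex f)) (re_part (cderive ey f))).
  + by move=> q; exact: (D true f df q).1.
  + by move=> q; exact: (D false f df q).1.
  + by move=> q; exact: (D false _ dx q).1.
  + by move=> q; exact: (D true _ dy q).1.
  + exact: cxy.1.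
  + exact: cyx.1.
- apply: (@derive_swap _ (im_part f) (im_part (cderive ex f)) (im_part (cderive ey f))).
  + by move=> q; exact: (D true f df q).2.
  + by move=> q; exact: (D false f df q).2.
  + by move=> q; exact: (D false _ dx q).2.
  + by move=> q; exact: (D true _ dy q).2.
  + exact: cxy.2.
  + exact: cyx.2.
Qed.

Notation s2 := (((Num.sqrt 2)^-1)%:C : C).

Lemma s2_sqr : s2 * s2 * 2 = 1 :> C.
Proof.
have h : (Num.sqrt 2)^-1 * (Num.sqrt 2)^-1 * 2 = 1 :> K.
  by rewrite -invfM -expr2 sqr_sqrtr ?mulVf.
have e2 : (2 : C) = (2 : K)%:C by apply: complexP; rewrite /= ?addr0.
by rewrite e2 -!rmorphM h.
Qed.

Lemma smooth_dzeta (f : K * K -> C) : smooth f -> smooth (dzeta f).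
Proof.
move=> sf; rewrite /dzeta; apply: smooth_scale.
have := smooth_comb (- 'i%C) (smooth_cderive true sf) (smooth_cderive false sf).
by congr smooth; apply/funext => q; rewrite mulNr.
Qed.

Lemma smooth_dzetabar (f : K * K -> C) : smooth f -> smooth (dzetabar f).
Proof.
move=> sf; rewrite /dzetabar; apply: smooth_scale.
exact: smooth_comb (smooth_cderive true sf) (smooth_cderive false sf).
Qed.

Lemma cderive_smooth_comb b (c d : C) (f g : K * K -> C) q : smooth f -> smooth g ->
  cderive (evec b) (fun p => c * (f p + d * g p)) q =
  c * (cderive (evec b) f q + d * cderive (evec b) g q).
Proof.
move=> /smoothP/(_ [::])[_ df] /smoothP/(_ [::])[_ dg]; apply: is_cder_val.
apply: is_cderZ; apply: is_cderD; first exact/cderivableP/(df b).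
exact/is_cderZ/cderivableP/(dg b).
Qed.

Lemma dzeta_swap_ring (R : comNzRingType) (s i x y z : R) :
  s * (s * (x + i * y) - i * (s * (y + i * z))) =
  s * (s * (x + - i * y) + i * (s * (y + - i * z))).
Proof. by ring. Qed.

(** The passage between the x, y derivatives and dzeta, dzetabar in both directions, with [s] for
    1/sqrt 2 and [i] for the imaginary unit, which in an abstract ring are known only through their
    equations. *)
Lemma wirtinger_ring (R : comNzRingType) (s i x y : R) : s * s * 2 = 1 -> i * i = -1 ->
  [/\ s * (s * (x + y) - i * (s * i * (x - y))) = x,
      s * (s * (x + y) + i * (s * i * (x - y))) = y,
      s * (s * (x - i * y) + s * (x + i * y)) = x
    & s * i * (s * (x - i * y) - s * (x + i * y)) = y].
Proof.
move=> hs hi; split.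
- by transitivity (s * s * ((1 - i * i) * x + (1 + i * i) * y)); [ring|rewrite hi; ring: hs].
- by transitivity (s * s * ((1 + i * i) * x + (1 - i * i) * y)); [ring|rewrite hi; ring: hs].
- by transitivity (s * s * 2 * x); [ring|rewrite hs mul1r].
- by transitivity (s * s * 2 * (- (i * i) * y)); [ring|rewrite hs hi opprK !mul1r].
Qed.

Lemma dzeta_dzetabar (f : K * K -> C) : smooth f -> dzeta (dzetabar f) = dzetabar (dzeta f).
Proof.
move=> sf; have sx := smooth_cderive true sf; have sy := smooth_cderive false sf.
have E1 : dzetabar f = fun p => s2 * (cderive ex f p + 'i%C * cderive ey f p) by [].
have E2 : dzeta f = fun p => s2 * (cderive ex f p + - 'i%C * cderive ey f p).
  by apply/funext => p; rewrite /dzeta mulNr.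
apply/funext => q; rewrite {1}/dzeta [in RHS]/dzetabar E1 E2.
rewrite -[ex]/(evec true) -[ey]/(evec false) !cderive_smooth_comb//.
rewrite /evec (smooth_swap sf).
exact: dzeta_swap_ring.
Qed.

(** To be read as: [F a b] is dzeta^a dzetabar^b of [F 0 0]. The conditions bear on the derivatives
    in x and y because smoothness asks for those; dzeta and dzetabar follow by [wirtinger_ring]. *)
Definition jet (F : nat -> nat -> K * K -> C) := forall a b,
  [/\ ccont (F a b),
    forall p, is_cder p ex (F a b) (s2 * (F a.+1 b p + F a b.+1 p))
  & forall p, is_cder p ey (F a b) (s2 * 'i%C * (F a.+1 b p - F a b.+1 p))].

Lemma jet_dzeta F : jet F -> forall a b, dzeta (F a b) = F a.+1 b.
Proof.
move=> jF a b; have [_ dx dy] := jF a b; apply/funext => p.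
rewrite /dzeta (is_cder_val (dx p)) (is_cder_val (dy p)).
by have [] := wirtinger_ring (F a.+1 b p) (F a b.+1 p) s2_sqr sqr_iC.
Qed.

Lemma jet_dzetabar F : jet F -> forall a b, dzetabar (F a b) = F a b.+1.
Proof.
move=> jF a b; have [_ dx dy] := jF a b; apply/funext => p.
rewrite /dzetabar (is_cder_val (dx p)) (is_cder_val (dy p)).
by have [] := wirtinger_ring (F a.+1 b p) (F a b.+1 p) s2_sqr sqr_iC.
Qed.

Lemma jet_iter_swap F : jet F -> forall a b, iter a dzeta (iter b dzetabar (F 0%N 0%N)) = F a b.
Proof.
move=> jF a b; elim: a => [|a /= ->]; last by rewrite jet_dzeta.
by elim: b => [|b /= ->] //=; rewrite jet_dzetabar.
Qed.

(** Finite linear combinations of members of the jet, coded by [ev] as lists of coefficients with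
    indices, are continuous and stable under both partial derivatives. Hence every iterated partial
    derivative of [F 0 0] is one of them. *)
Lemma jet_smooth F : jet F -> smooth (F 0%N 0%N).
Proof.
move=> jF; pose ev (s : seq (C * (nat * nat))) p := \sum_(x <- s) x.1 * F x.2.1 x.2.2 p.
have dev b s : exists s', forall p, is_cder p (evec b) (ev s) (ev s' p).
  pose c1 := if b then s2 else s2 * 'i%C; pose c2 := if b then s2 else - (s2 * 'i%C).
  exists (flatten [seq [:: (x.1 * c1, (x.2.1.+1, x.2.2)); (x.1 * c2, (x.2.1, x.2.2.+1))] | x <- s]).
  move=> p; rewrite [X in is_cder _ _ _ X](_ : _ =
      \sum_(x <- s) x.1 * (c1 * F x.2.1.+1 x.2.2 p + c2 * F x.2.1 x.2.2.+1 p)).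
    apply: is_cder_sum => -[c [i j]]; apply: is_cderZ => /=.
    have [_ dx dy] := jF i j; rewrite /c1 /c2; case: (b).
      by apply: is_cder_eq (dx p) _; ring.
    by apply: is_cder_eq (dy p) _; ring.
  rewrite /ev big_flatten big_map; apply: eq_bigr => x _.
  by rewrite !big_cons big_nil /=; ring.
have cev s : ccont (ev s).
  elim: s => [|x s IH]; first by rewrite (_ : ev [::] = fun=> 0); [exact: ccont_cst|apply/funext => p; exact: big_nil].
  rewrite (_ : ev (x :: s) = fun p => ev s p + x.1 * F x.2.1 x.2.2 p).
    by apply: ccont_comb => //; have [] := jF x.2.1 x.2.2.
  by apply/funext => p; rewrite /ev big_cons addrC.
apply/smoothP => w; suff [s ->] : exists s, partials w (F 0%N 0%N) = ev s.
  by split=> [//|b p]; have [s' /(_ p)/is_cder_derivable] := dev b s.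
elim: w => [|b w [s IH]].
  by exists [:: (1, (0%N, 0%N))]; apply/funext => p; rewrite /ev big_seq1 mul1r.
have [s' ds'] := dev b s; exists s'.
by rewrite /= IH; apply/funext => p; exact: is_cder_val (ds' p).
Qed.

Definition jet_of (f : K * K -> C) a b := iter b dzetabar (iter a dzeta f).

Lemma smooth_jet_of (f : K * K -> C) a b : smooth f -> smooth (jet_of f a b).
Proof.
move=> sf; rewrite /jet_of; elim: b => [|b IH] /=; last exact: smooth_dzetabar.
by elim: a => [//|a IH]; exact: smooth_dzeta.
Qed.

(** In [jet_of] the dzeta are innermost, so a new one has to be commuted past all the dzetabar. *)
Lemma dzeta_jet_of (f : K * K -> C) a b : smooth f -> dzeta (jet_of f a b) = jet_of f a.+1 b.
Proof.
move=> sf; elim: b => [//|b IH].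
rewrite -[jet_of f a b.+1]/(dzetabar (jet_of f a b)) (dzeta_dzetabar (smooth_jet_of a b sf)).
by rewrite IH.
Qed.

Lemma jet_of_jet (f : K * K -> C) : smooth f -> jet (jet_of f).
Proof.
move=> sf a b; have sab := smooth_jet_of a b sf.
have [cf df] := (smoothP _).1 sab [::].
rewrite -dzeta_jet_of// -[jet_of f a b.+1]/(dzetabar (jet_of f a b)); split=> // p.
- apply: is_cder_eq (cderivableP (df true p)) _.
  by have [_ _ ->] := wirtinger_ring (cderive ex (jet_of f a b) p) (cderive ey (jet_of f a b) p) s2_sqr sqr_iC.
- apply: is_cder_eq (cderivableP (df false p)) _.
  by have [_ _ _ ->] := wirtinger_ring (cderive ex (jet_of f a b) p) (cderive ey (jet_of f a b) p) s2_sqr sqr_iC.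
Qed.

End ComplexCalculus.

(** * Functions of the form exp(i m theta) G(r) *)

Section Angular.
Context {K : realType}.
Local Notation C := K[i].
Local Notation Re := (@complex.Re K).
Local Notation Im := (@complex.Im K).

Lemma expiD (s t : K) : expi (s + t) = expi s * expi t.
Proof. by apply: complexP; rewrite !ReImE /= ?cosD ?sinD //; ring. Qed.

Lemma expi0 : expi (0 : K) = 1.
Proof. by rewrite /expi cos0 sin0. Qed.

Lemma expiN (t : K) : expi (- t) = conjc (expi t).
Proof. by apply: complexP; rewrite /= ?cosN ?sinN. Qed.

Lemma expi_inv (t : K) : (expi t)^-1 = conjc (expi t).
Proof.
have h : conjc (expi t) * expi t = 1 by rewrite -expiN -expiD addNr expi0.
apply: (mulIf (x := expi t)); last by rewrite h mulVf//; apply: contra_eq_neq h => ->; rewrite mulr0 eq_sym oner_eq0.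
by apply: contra_eq_neq h => ->; rewrite mulr0 eq_sym oner_eq0.
Qed.

Lemma expi_int (m : int) (t : K) : expi (m%:~R * t) = expi t ^ m.
Proof.
have pos (n : nat) : expi (n%:R * t) = expi t ^+ n.
  elim: n => [|n IH]; first by rewrite mul0r expi0.
  by rewrite exprS -IH -expiD -natr1 mulrDl mul1r addrC.
case: m => n; first exact: pos.
by rewrite NegzE mulrNz mulNr expiN -expi_inv [X in X^-1]pos.
Qed.

(** The number exp(i theta) without a choice of angle. Since the inverse of 0 is 0, it vanishes at
    the origin, and its power [m] there is 1 for [m = 0] and 0 otherwise: this fits the convention
    for mode functions. *)
Definition uvec (p : K * K) : C := (p.1 +i* p.2) * ((pnorm p)^-1)%:C.

Lemma uvec_polar (r t : K) : 0 < r -> uvec (polar r t) = expi t.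
Proof.
move=> r0; rewrite /uvec pnorm_polar ?ltW//.
have rn : r != 0 by rewrite gt_eqF.
by apply: complexP; rewrite ReImE /= mulr0 ?subr0 ?add0r; field.
Qed.

Lemma uvec0 : uvec 0 = 0.
Proof. by rewrite /uvec; apply: complexP; rewrite ReImE /= !mul0r ?subr0 ?addr0. Qed.

Lemma uvecP (p : K * K) : p = 0 \/ exists t, [/\ 0 < pnorm p, p = polar (pnorm p) t & uvec p = expi t].
Proof.
have [/pnorm_eq0 ->|r0] := eqVneq (pnorm p) 0; first by left.
right; have [t pE] := polarP p; exists t.
have rp : 0 < pnorm p by rewrite lt_neqAle eq_sym r0 pnorm_ge0.
by split => //; rewrite {1}pE uvec_polar.
Qed.

Lemma uvec_inv (p : K * K) : (uvec p)^-1 = conjc (uvec p).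
Proof.
have [->|[t [_ _ ->]]] := uvecP p; last exact: expi_inv.
by rewrite uvec0 invr0 conjc0.
Qed.

Lemma uvec_conj (p : K * K) : 0 < pnorm p -> uvec p * conjc (uvec p) = 1.
Proof.
move=> p0; have [E|[t [_ _ ->]]] := uvecP p.
  by move: p0; rewrite E /pnorm /= expr0n addr0 sqrtr0 ltxx.
by rewrite -expiN -expiD subrr expi0.
Qed.

Lemma uvec_neq0 (p : K * K) : 0 < pnorm p -> uvec p != 0.
Proof. by move=> /uvec_conj; apply: contra_eq_neq => ->; rewrite mul0r eq_sym oner_eq0. Qed.

Lemma deriv_exp_ring (R : comNzRingType) (c w n x : R) :
  c * w * x + w * (n * c * x) = (n + 1) * c * (w * x).
Proof. by ring. Qed.

Lemma is_derive_line0 (V : normedModType K) (f : V -> K) (p v : V) (l : K) :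
  is_derive p v f l <-> is_derive (0 : K) 1 (fun t => f (t *: v + p)) l.
Proof. by apply: is_derive_line => t; rewrite addr0. Qed.

Lemma is_derive_comp (V : normedModType K) (p v : V) (h : V -> K) (g : K -> K) (l d : K) :
  is_derive p v h l -> is_derive (h p) (1 : K) g d -> is_derive p v (fun q => g (h q)) (d * l).
Proof.
move=> /is_derive_line0 dh dg; apply/is_derive_line0.
apply: (@is_derive1_comp K g (fun t => h (t *: v + p)) 0 d l) => //.
by rewrite scale0r add0r.
Qed.

Section PointRules.
Variables (V : normedModType K) (p v : V).

Lemma is_cder_conj (f : V -> C) l : is_cder p v f l ->
  is_cder p v (fun q => conjc (f q)) (conjc l).
Proof.
move=> [d1 d2]; split.
- rewrite (_ : re_part _ = re_part f); last by apply/funext => q; rewrite /re_part; case: (f q).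
  by case: l d1 d2.
- rewrite (_ : im_part _ = - im_part f); last by apply/funext => q; rewrite /im_part fctE; case: (f q).
  by rewrite (_ : Im _ = - Im l); [exact: is_deriveN|case: l d1 d2].
Qed.

(** With the derivative in logarithmic form, a multiple of [w p], the power rule keeps the exponent
    [n]. *)
Lemma is_cderX (w : V -> C) (c : C) (n : nat) : is_cder p v w (c * w p) ->
  is_cder p v (fun q => w q ^+ n) (n%:R * c * w p ^+ n).
Proof.
move=> dw; elim: n => [|n IH].
  by rewrite !mul0r; under eq_fun do rewrite expr0; exact: is_cder_cst.
under eq_fun do rewrite exprS.
apply: is_cder_eq (is_cderM dw IH) _.
by rewrite exprS -natr1; exact: deriv_exp_ring.
Qed.

Lemma is_cder_comp (h : V -> K) (g : K -> C) (l : K) (g' : C) :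
  is_derive p v h l -> is_cder (h p) (1 : K) g g' ->
  is_cder p v (fun q => g (h q)) (g' * l%:C).
Proof.
move=> dh [g1 g2].
split.
- have -> : Re (g' * l%:C) = Re g' * l by rewrite ReImE /= mulr0 subr0.
  exact: is_derive_comp.
- have -> : Im (g' * l%:C) = Im g' * l by rewrite ReImE /= mulr0 add0r.
  exact: is_derive_comp.
Qed.

End PointRules.

Lemma is_derive_fst (p v : K * K) : is_derive p v (fst : K * K -> K) v.1.
Proof.
apply/(@is_derive_line K _ _ (fun t => t * v.1 + p.1) p v 0).
  by move=> h /=; rewrite addr0.
have D : is_derive (0 : K) 1 (fun t => t * v.1 + p.1) (v.1 + 0).
  apply: is_deriveD; have := is_deriveM (is_derive_id (0 : K) 1) (is_derive_cst v.1 (0 : K) 1).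
  by move=> H; apply: (is_derive_eq H); rewrite scaler0 add0r [_ *: _]mulr1.
by rewrite addr0 in D.
Qed.

Lemma is_derive_snd (p v : K * K) : is_derive p v (snd : K * K -> K) v.2.
Proof.
apply/(@is_derive_line K _ _ (fun t => t * v.2 + p.2) p v 0).
  by move=> h /=; rewrite addr0.
have D : is_derive (0 : K) 1 (fun t => t * v.2 + p.2) (v.2 + 0).
  apply: is_deriveD; have := is_deriveM (is_derive_id (0 : K) 1) (is_derive_cst v.2 (0 : K) 1).
  by move=> H; apply: (is_derive_eq H); rewrite scaler0 add0r [_ *: _]mulr1.
by rewrite addr0 in D.
Qed.

Lemma sqr_pnorm (p : K * K) : pnorm p ^+ 2 = p.1 ^+ 2 + p.2 ^+ 2.
Proof. by rewrite sqr_sqrtr// addr_ge0// sqr_ge0. Qed.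

Lemma is_derive_pnorm (p v : K * K) : 0 < pnorm p ->
  is_derive p v pnorm ((p.1 * v.1 + p.2 * v.2) / pnorm p).
Proof.
move=> p0.
have dq : is_derive p v (fst * fst + snd * snd : K * K -> K)
    ((p.1 *: v.1 + p.1 *: v.1) + (p.2 *: v.2 + p.2 *: v.2)).
  apply: is_deriveD; apply: is_deriveM; by [exact: is_derive_fst|exact: is_derive_snd].
have pE : (fst * fst + snd * snd : K * K -> K) p = pnorm p ^+ 2.
  by rewrite sqr_pnorm !expr2.
have q0 : 0 < (fst * fst + snd * snd : K * K -> K) p by rewrite pE exprn_gt0.
have ds := is_derive1_sqrt q0.
have D := is_derive_comp dq ds.
rewrite (_ : pnorm = fun q => Num.sqrt ((fst * fst + snd * snd : K * K -> K) q)); last first.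
  by apply/funext => q; rewrite /pnorm !expr2.
apply: (is_derive_eq D); rewrite !pE !sqrtr_sqr !gtr0_norm//.
rewrite -![_ *: _]/(_ * _); field; rewrite gt_eqF//.
Qed.

Lemma is_cder_cplx (V : normedModType K) (p v : V) (f g : V -> K) (a b : K) :
  is_derive p v f a -> is_derive p v g b -> is_cder p v (fun q => f q +i* g q) (a +i* b).
Proof. by []. Qed.

(** The real factor is the derivative of the polar angle in the direction [v]. *)
Lemma is_cder_uvec (p v : K * K) : 0 < pnorm p ->
  is_cder p v uvec ('i%C * ((p.1 * v.2 - p.2 * v.1) / pnorm p ^+ 2)%:C * uvec p).
Proof.
move=> p0; have pn : pnorm p != 0 by rewrite gt_eqF.
have dz : is_cder p v (fun q : K * K => q.1 +i* q.2) (v.1 +i* v.2).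
  by apply: is_cder_cplx; [exact: is_derive_fst|exact: is_derive_snd].
have dr : is_cder (pnorm p) (1 : K) (fun r => (r^-1)%:C) ((- pnorm p ^- 2)%:C).
  split; last exact: is_derive_cst.
  have D := is_deriveV (pn : (idfun : K -> K) (pnorm p) != 0) (is_derive_id (pnorm p) 1).
  by apply: (is_derive_eq D); rewrite [_ *: _]mulr1.
apply: is_cder_eq (is_cderM dz (is_cder_comp (is_derive_pnorm v p0) dr)) _.
have h := sqr_pnorm p; rewrite /uvec.
set r := pnorm p in pn h *.
have hx : p.1 * v.1 * p.1 = p.1 ^+ 2 * v.1 by ring.
apply: complexP; rewrite !ReImE /=.
- apply: (mulIf (x := r ^+ 3)); first by rewrite expf_neq0.
  transitivity (v.1 * r ^+ 2 - p.1 * (p.1 * v.1 + p.2 * v.2)); first by field.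
  transitivity (- (p.1 * v.2 - p.2 * v.1) * p.2); last by field.
  by rewrite h; ring.
- apply: (mulIf (x := r ^+ 3)); first by rewrite expf_neq0.
  transitivity (v.2 * r ^+ 2 - p.2 * (p.1 * v.1 + p.2 * v.2)); first by field.
  transitivity ((p.1 * v.2 - p.2 * v.1) * p.1); last by field.
  by rewrite h; ring.
Qed.

Lemma is_cder_uvecX (p v : K * K) (m : int) : 0 < pnorm p ->
  is_cder p v (fun q => uvec q ^ m)
    (m%:~R * ('i%C * ((p.1 * v.2 - p.2 * v.1) / pnorm p ^+ 2)%:C) * uvec p ^ m).
Proof.
move=> p0; have du := is_cder_uvec v p0.
case: m => n; first exact: is_cderX.
(* Inverse and conjugate agree, even at the origin where both are 0, so negative powers are powers
   of the conjugate. *)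
have E q : uvec q ^ (Negz n) = conjc (uvec q) ^+ n.+1 by rewrite -uvec_inv exprVn.
under eq_fun do rewrite E; rewrite E.
have dc := is_cder_conj du.
have {}dc : is_cder p v (fun q => conjc (uvec q))
   (- ('i%C * ((p.1 * v.2 - p.2 * v.1) / pnorm p ^+ 2)%:C) * conjc (uvec p)).
  apply: is_cder_eq dc _.
  set a := (_ / _); set z := uvec p.
  by apply: complexP; case: z => x y; rewrite !ReImE /=; ring.
apply: is_cder_eq (is_cderX n.+1 dc) _.
by rewrite NegzE mulrNz mulNr mulrN.
Qed.

Definition hat (m : int) (G : K -> C) (p : K * K) : C := uvec p ^ m * G (pnorm p).

Lemma uvec_re (p : K * K) : uvec p + conjc (uvec p) = (2 * (p.1 / pnorm p))%:C.
Proof. by rewrite /uvec; apply: complexP; rewrite /= ; ring. Qed.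

Lemma uvec_im (p : K * K) : uvec p - conjc (uvec p) = 'i%C * (2 * (p.2 / pnorm p))%:C.
Proof. by rewrite /uvec; apply: complexP; rewrite /= ; ring. Qed.

(** The letters stand for: [u], [v] the unit number and its conjugate, [X], [Y] their real and
    imaginary parts x/r and y/r, [rho] = 1/r, [M] the mode, [W] = [u ^ m], [h] = 1/2, and [g], [g']
    the profile and its derivative at r. *)
Lemma hat_partials_ring (R : comNzRingType) (i u v W X Y M rho h g g' : R) :
  u + v = 2 * X -> u - v = i * (2 * Y) -> 2 * h = 1 -> i * i = -1 ->
  M * (i * (- (Y * rho))) * W * g + W * (g' * X) =
    h * (W * v * (g' + M * rho * g) + W * u * (g' - M * rho * g)) /\
  M * (i * (X * rho)) * W * g + W * (g' * Y) =
    i * h * (W * v * (g' + M * rho * g) - W * u * (g' - M * rho * g)).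
Proof.
move=> e1 e2 e3 e4; split.
- transitivity (2 * h * (M * (i * (- (Y * rho))) * W * g + W * (g' * X))); first by rewrite e3 mul1r.
  transitivity (h * W * ((u + v) * g' - (u - v) * (M * rho * g))); last by ring.
  by rewrite e1 e2; ring.
- transitivity (2 * h * (M * (i * (X * rho)) * W * g + W * (g' * Y))); first by rewrite e3 mul1r.
  transitivity (h * W * (i * (u + v) * (M * rho * g) - i * (u - v) * g')); last by ring.
  rewrite e1 e2 [i * (i * _)]mulrA e4; ring.
Qed.

Lemma real_complexM (a b : K) : (a * b)%:C = a%:C * b%:C :> C.
Proof. exact: rmorphM. Qed.

Lemma half_complex : 2 * (2^-1)%:C = 1 :> C.
Proof.
have e2 : (2 : C) = (2 : K)%:C by apply: complexP; rewrite /= ?addr0.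
by rewrite e2 -rmorphM mulfV.
Qed.

(** [A] and [B] are sqrt 2 times the future dzeta and dzetabar of [hat m G]. The conclusion is left
    in terms of partial derivatives, as [jet] requires. *)
Lemma is_cder_hat (m : int) (G : K -> C) (g' : C) (p : K * K)
    (A := uvec p ^ (m - 1) * (g' + (m%:~R / pnorm p)%:C * G (pnorm p)))
    (B := uvec p ^ (m + 1) * (g' - (m%:~R / pnorm p)%:C * G (pnorm p))) :
  0 < pnorm p -> is_cder (pnorm p) (1 : K) G g' ->
  is_cder p ex (hat m G) ((2^-1)%:C * (A + B)) /\
  is_cder p ey (hat m G) ('i%C * (2^-1)%:C * (A - B)).
Proof.
move=> p0 dG; have un := uvec_neq0 p0.
have dh v := is_cderM (is_cder_uvecX v m p0) (is_cder_comp (is_derive_pnorm v p0) dG).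
rewrite /A /B !(expfzDr _ _ un) expr1z -[X in _ ^ m * X]/((uvec p)^-1) uvec_inv.
rewrite real_complexM (rmorph_int (real_complex K)).
have E2 : (2 : K)%:C = (2 : C) by apply: complexP; rewrite /= ?addr0.
have h1 : uvec p + conjc (uvec p) = 2 * (p.1 / pnorm p)%:C.
  by rewrite uvec_re real_complexM E2.
have h2 : uvec p - conjc (uvec p) = 'i%C * (2 * (p.2 / pnorm p)%:C).
  by rewrite uvec_im real_complexM E2.
have [HA HB] := hat_partials_ring (uvec p ^ m) m%:~R ((pnorm p)^-1)%:C (G (pnorm p)) g' h1 h2 half_complex (@sqr_iC K).
split.
- apply: is_cder_eq (dh ex) _; rewrite -HA /=; congr (_ * ('i%C * _) * _ * _ + _ * (_ * _)).
  + have -> : (p.1 * 0 - p.2 * 1) / pnorm p ^+ 2 = - (p.2 / pnorm p * (pnorm p)^-1).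
      by rewrite expr2 invfM; ring.
    by rewrite rmorphN /= !real_complexM.
  + by rewrite mulr1 mulr0 addr0.
- apply: is_cder_eq (dh ey) _; rewrite -HB /=; congr (_ * ('i%C * _) * _ * _ + _ * (_ * _)).
  + have -> : (p.1 * 1 - p.2 * 0) / pnorm p ^+ 2 = p.1 / pnorm p * (pnorm p)^-1.
      by rewrite expr2 invfM; ring.
    by rewrite !real_complexM.
  + by rewrite mulr1 mulr0 add0r.
Qed.

End Angular.

(** * Continuity and differentiability at the origin *)

Section HatContinuity.
Context {K : realType}.
Local Notation C := K[i].
Local Notation Re := (@complex.Re K).
Local Notation Im := (@complex.Im K).
Local Notation s2 := (((Num.sqrt 2)^-1)%:C : C).

Definition ccont_at (T : topologicalType) (p : T) (f : T -> C) :=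
  {for p, continuous (re_part f)} /\ {for p, continuous (im_part f)}.

Lemma ccont_atM (T : topologicalType) (p : T) (f g : T -> C) :
  ccont_at p f -> ccont_at p g -> ccont_at p (fun q => f q * g q).
Proof.
move=> [f1 f2] [g1 g2]; split.
- rewrite (_ : re_part _ = fun q => re_part f q * re_part g q - im_part f q * im_part g q).
    by apply: cvgB; apply: cvgM; [exact: f1|exact: g1|exact: f2|exact: g2].
  by apply/funext => q; rewrite /re_part /im_part cReM.
- rewrite (_ : im_part _ = fun q => re_part f q * im_part g q + im_part f q * re_part g q).
    by apply: cvgD; apply: cvgM; [exact: f1|exact: g2|exact: f2|exact: g1].
  by apply/funext => q; rewrite /re_part /im_part cImM.
Qed.

Lemma ccont_at_conj (T : topologicalType) (p : T) (f : T -> C) :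
  ccont_at p f -> ccont_at p (fun q => conjc (f q)).
Proof.
move=> [f1 f2]; split.
- rewrite (_ : re_part _ = re_part f); first exact: f1.
  by apply/funext => q; rewrite /re_part; case: (f q).
- rewrite (_ : im_part _ = fun q => - im_part f q); first by apply: cvgN; exact: f2.
  by apply/funext => q; rewrite /im_part; case: (f q).
Qed.

Lemma ccont_atX (T : topologicalType) (p : T) (f : T -> C) (n : nat) :
  ccont_at p f -> ccont_at p (fun q => f q ^+ n).
Proof.
move=> cf; elim: n => [|n IH].
  by split; exact: cvg_cst.
by under eq_fun do rewrite exprS; exact: ccont_atM.
Qed.

Lemma continuous_pnorm : continuous (pnorm : K * K -> K).
Proof.
move=> p; apply: (@continuous_comp _ _ _ (fun p : K * K => p.1 ^+ 2 + p.2 ^+ 2) Num.sqrt).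
  apply: cvgD; apply: (@continuous_comp _ _ _ _ (fun x : K => x ^+ 2)).
  - exact: cvg_fst.
  - exact: exprn_continuous.
  - exact: cvg_snd.
  - exact: exprn_continuous.
exact: sqrt_continuous.
Qed.

Lemma ccont_at_uvec (p : K * K) : 0 < pnorm p -> ccont_at p uvec.
Proof.
move=> p0; have ci : {for p, continuous (fun q : K * K => (pnorm q)^-1)}.
  by apply: cvgV; [rewrite gt_eqF|exact: continuous_pnorm].
split.
- rewrite (_ : re_part _ = fun q : K * K => q.1 * (pnorm q)^-1).
    by apply: cvgM; [exact: cvg_fst|exact: ci].
  by apply/funext => q; rewrite /re_part /uvec cReM /= mulr0 subr0.
- rewrite (_ : im_part _ = fun q : K * K => q.2 * (pnorm q)^-1).
    by apply: cvgM; [exact: cvg_snd|exact: ci].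
  by apply/funext => q; rewrite /im_part /uvec cImM /= mulr0 add0r.
Qed.

Lemma ccont_at_uvecX (p : K * K) (m : int) : 0 < pnorm p -> ccont_at p (fun q => uvec q ^ m).
Proof.
move=> p0; have cu := ccont_at_uvec p0.
case: m => n; first exact: ccont_atX.
have E q : uvec q ^ (Negz n) = conjc (uvec q) ^+ n.+1 by rewrite -uvec_inv exprVn.
by under eq_fun do rewrite E; apply: ccont_atX; exact: ccont_at_conj.
Qed.

Lemma norm_expiX_le (p : K * K) (m : int) : 0 < pnorm p ->
  `|Re (uvec p ^ m)| <= 1 /\ `|Im (uvec p ^ m)| <= 1.
Proof.
move=> p0; have [E|[t [_ _ ->]]] := uvecP p.
  by move: p0; rewrite E /pnorm /= expr0n addr0 sqrtr0 ltxx.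
rewrite -expi_int /=; split.
  by rewrite ler_norml cos_geN1 cos_le1.
by rewrite ler_norml sin_geN1 sin_le1.
Qed.

Lemma pnorm0 : pnorm (0 : K * K) = 0.
Proof. by rewrite /pnorm /= expr0n addr0 sqrtr0. Qed.

(** Composing with the absolute value makes continuity of [G] on the half-line a statement on the
    line. At the origin, for nonzero [m], the angular factor is bounded and [G] tends to 0. *)
Lemma ccont_hat (m : int) (G : K -> C) : ccont (fun r : K => G `|r|) ->
  (m != 0 -> G 0 = 0) -> ccont (hat m G).
Proof.
move=> [cG1 cG2] G0.
have nE p : G (pnorm p) = G `|pnorm p| by rewrite ger0_norm// pnorm_ge0.
have cGn : ccont (fun p : K * K => G (pnorm p)).
  split => p.
  - rewrite (_ : re_part _ = re_part (fun r : K => G `|r|) \o pnorm); last first.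
      by apply/funext => q; rewrite /re_part /= -nE.
    by apply: continuous_comp; [exact: continuous_pnorm|exact: cG1].
  - rewrite (_ : im_part _ = im_part (fun r : K => G `|r|) \o pnorm); last first.
      by apply/funext => q; rewrite /im_part /= -nE.
    by apply: continuous_comp; [exact: continuous_pnorm|exact: cG2].
suff H p : ccont_at p (hat m G) by split=> p; have [] := H p.
have [p0|] := ltP 0 (pnorm p).
  apply: ccont_atM; first exact: ccont_at_uvecX.
  by split; [exact: cGn.1|exact: cGn.2].
move=> p0; have {p0}-> : p = 0 by apply: pnorm_eq0; apply/eqP; rewrite eq_le p0 pnorm_ge0.
have [m0|m0] := eqVneq m 0.
  have -> : hat m G = fun p => G (pnorm p) by apply/funext => q; rewrite /hat m0 mul1r.
  by split; [exact: cGn.1|exact: cGn.2].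
have h0 : hat m G 0 = 0 by rewrite /hat pnorm0 G0// mulr0.
have bound q : `|Re (hat m G q)| <= `|Re (G (pnorm q))| + `|Im (G (pnorm q))| /\
    `|Im (hat m G q)| <= `|Re (G (pnorm q))| + `|Im (G (pnorm q))|.
  have [q0|] := ltP 0 (pnorm q); last first.
    move=> q0; have {q0}-> : q = 0 by apply: pnorm_eq0; apply/eqP; rewrite eq_le q0 pnorm_ge0.
    by rewrite h0 /= normr0; split; rewrite addr_ge0.
  have [u1 u2] := norm_expiX_le m q0.
  rewrite /hat cReM cImM; split.
    by apply: (le_trans (ler_normB _ _)); rewrite !normrM lerD// ler_piMl.
  by apply: (le_trans (ler_normD _ _)); rewrite !normrM addrC lerD// ler_piMl.
have lim0 : (fun q : K * K => `|Re (G (pnorm q))| + `|Im (G (pnorm q))|) @ (0 : K * K) --> (0 : K).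
  rewrite -[X in _ --> X](_ : `|Re (G (pnorm 0))| + `|Im (G (pnorm 0))| = 0); last first.
    by rewrite pnorm0 G0//= normr0 addr0.
  by apply: cvgD; apply: cvg_norm; [exact: (cGn.1 0)|exact: (cGn.2 0)].
split.
- change (re_part (hat m G) @ (0 : K * K) --> Re (hat m G 0)); rewrite h0; apply: (@norm_cvg0 K K); apply: (squeeze_cvgr _ (cvg_cst 0) lim0).
  by near=> q; rewrite normr_ge0/=; have [] := bound q.
- change (im_part (hat m G) @ (0 : K * K) --> Im (hat m G 0)); rewrite h0; apply: (@norm_cvg0 K K); apply: (squeeze_cvgr _ (cvg_cst 0) lim0).
  by near=> q; rewrite normr_ge0/=; have [] := bound q.
Unshelve. all: by end_near. Qed.

Lemma s2_half : s2 * s2 = (2^-1)%:C :> C.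
Proof. by rewrite -rmorphM /= -invfM -expr2 sqr_sqrtr. Qed.

(** A partial derivative at the origin is a one-variable derivative along a coordinate axis, where
    [is_derive_removable] applies. *)
Lemma is_cder_removable (f : K * K -> C) (l : K * K -> C) (b : bool) : ccont f ->
  (forall p, p != 0 -> is_cder p (evec b) f (l p)) -> ccont l ->
  is_cder (0 : K * K) (evec b) f (l 0).
Proof.
move=> [cf1 cf2] dl [cl1 cl2].
pose line (t : K) : K * K := if b then (t, 0) else (0, t).
have cline : continuous line.
  have -> : line = fun t : K => t *: evec b.
    by apply/funext => t; rewrite /line /evec; case: (b); congr pair; rewrite -[_ *: _]/(_ * _) ?mulr1 ?mulr0.
  exact: scalel_continuous.
have dirP p l' : is_cder (line p) (evec b) f l' <-> is_cder p (1 : K) (f \o line) l'.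
  rewrite /line /evec; case: (b); [exact: is_cder_exP|exact: is_cder_eyP].
have l0 : (0 : K * K) = line 0 by rewrite /line; case: (b).
have ln t : t != 0 -> line t != 0.
  by rewrite /line; case: (b); apply: contra_neq => -[].
rewrite l0; apply/dirP; split.
- apply: (@is_derive_removable K (re_part (f \o line)) (re_part (l \o line))).
  + by move=> t; apply: (@continuous_comp _ _ _ line (re_part f)); [exact: cline|exact: cf1].
  + by move=> t t0; have /dirP[] := dl _ (ln _ t0).
  + by apply: (@continuous_comp _ _ _ line (re_part l)); [exact: cline|exact: cl1].
- apply: (@is_derive_removable K (im_part (f \o line)) (im_part (l \o line))).
  + by move=> t; apply: (@continuous_comp _ _ _ line (im_part f)); [exact: cline|exact: cf2].
  + by move=> t t0; have /dirP[] := dl _ (ln _ t0).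
  + by apply: (@continuous_comp _ _ _ line (im_part l)); [exact: cline|exact: cl2].
Qed.

Lemma pnorm_gt0 (p : K * K) : p != 0 -> 0 < pnorm p.
Proof.
move=> p0; rewrite lt_neqAle pnorm_ge0 andbT eq_sym.
by apply: contra_neq p0; exact: pnorm_eq0.
Qed.

(** Lifts a family of radial profiles to a jet. The hypotheses are the jet relations read at
    positive radii, and the vanishing at 0 that makes each lift continuous; the relations at the
    origin then follow from [is_cder_removable]. *)
Lemma hat_jet (j : int) (G : nat -> nat -> K -> C) :
  (forall a b, ccont (fun r : K => G a b `|r|)) ->
  (forall a b : nat, j + b%:Z - a%:Z != 0 -> G a b 0 = 0) ->
  (forall a b (r : K), 0 < r -> exists g', [/\ is_cder r (1 : K) (G a b) g',
     s2 * (g' + ((j + b%:Z - a%:Z)%:~R / r)%:C * G a b r) = G a.+1 b r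
   & s2 * (g' - ((j + b%:Z - a%:Z)%:~R / r)%:C * G a b r) = G a b.+1 r]) ->
  jet (fun a b => hat (j + b%:Z - a%:Z) (G a b)).
Proof.
move=> cG G0 dG.
have ch a b : ccont (hat (j + b%:Z - a%:Z) (G a b)) by apply: ccont_hat => //; exact: G0.
have E1 a b : j + b%:Z - a.+1%:Z = j + b%:Z - a%:Z - 1 by rewrite -addn1 PoszD; ring.
have E2 a b : j + b.+1%:Z - a%:Z = j + b%:Z - a%:Z + 1 by rewrite -addn1 PoszD; ring.
have off a b p : p != 0 ->
    is_cder p ex (hat (j + b%:Z - a%:Z) (G a b))
      (s2 * (hat (j + b%:Z - a.+1%:Z) (G a.+1 b) p + hat (j + b.+1%:Z - a%:Z) (G a b.+1) p)) /\
    is_cder p ey (hat (j + b%:Z - a%:Z) (G a b))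
      (s2 * 'i%C * (hat (j + b%:Z - a.+1%:Z) (G a.+1 b) p - hat (j + b.+1%:Z - a%:Z) (G a b.+1) p)).
  move=> p0; have r0 := pnorm_gt0 p0; have [g' [dg e1 e2]] := dG a b _ r0.
  have [dx dy] := is_cder_hat (j + b%:Z - a%:Z) r0 dg.
  rewrite /hat E1 E2 -e1 -e2; split.
  - apply: is_cder_eq dx _; rewrite -s2_half.
    by rewrite !(mulrCA _ s2) -mulrDr mulrA.
  - apply: is_cder_eq dy _; rewrite -s2_half.
    by rewrite !(mulrCA _ s2) -mulrBr !mulrA; congr (_ * _ * _); rewrite mulrC mulrA.
move=> a b; split=> // p; have [->|p0] := eqVneq p 0; last first.
- by have [] := off a b p p0.
- apply: (@is_cder_removable _ (fun p => s2 * 'i%C *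
    (hat (j + b%:Z - a.+1%:Z) (G a.+1 b) p - hat (j + b.+1%:Z - a%:Z) (G a b.+1) p)) false) => //.
    by move=> q /(off a b)[].
  have c1 := ccont_comb (s2 * 'i%C) (ccont_cst _ 0) (ch a.+1 b).
  have := ccont_comb (- (s2 * 'i%C)) c1 (ch a b.+1).
  by congr ccont; apply/funext => q; ring.
- by have [] := off a b p p0.
- apply: (@is_cder_removable _ (fun p => s2 *
    (hat (j + b%:Z - a.+1%:Z) (G a.+1 b) p + hat (j + b.+1%:Z - a%:Z) (G a b.+1) p)) true) => //.
    by move=> q /(off a b)[].
  have c1 := ccont_comb s2 (ccont_cst _ 0) (ch a.+1 b).
  have := ccont_comb s2 c1 (ch a b.+1).
  by congr ccont; apply/funext => q; ring.
Qed.

End HatContinuity.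

(** * Test functions on the disc, and modes of their derivatives *)

Section ModeRadial.
Context {K : realType}.
Local Notation C := K[i].
Local Notation Re := (@complex.Re K).
Local Notation Im := (@complex.Im K).
Local Notation s2 := (((Num.sqrt 2)^-1)%:C : C).

Lemma closure_sub_closed (T : topologicalType) (A B : set T) :
  closed B -> A `<=` B -> closure A `<=` B.
Proof. by move=> cB AB x cAx; apply: cB => U /cAx[y [Ay Uy]]; exists y; split => //; exact: AB. Qed.

(** The maximum of [h] on a compact set is attained, hence stays strictly below [R]: this leaves a
    margin inside the disc. *)
Lemma compact_radius (T : topologicalType) (h : T -> K) (A : set T) (R : \bar K) :
  (0 < R)%E -> continuous h -> (forall x, 0 <= h x) -> compact A ->
  (forall x, A x -> ((h x)%:E < R)%E) ->
  exists R0, [/\ 0 <= R0, (R0%:E < R)%E & forall x, A x -> h x <= R0].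
Proof.
move=> R0 ch h0 cA AR; have [->|/set0P A0] := eqVneq A set0.
  by exists 0; split.
have [c + cmax] := compact_EVT_max A0 cA (continuous_subspaceT ch).
rewrite inE => Ac; exists (h c); split => //; first exact: AR.
by move=> x Ax; apply: cmax; rewrite inE.
Qed.

Lemma closed_pnorm_le (R0 : K) : closed [set p : K * K | pnorm p <= R0].
Proof.
rewrite (_ : [set _ | _] = pnorm @^-1` [set x | x <= R0]); last by [].
by apply: closed_comp => [p _|]; [exact: continuous_pnorm|exact: closed_le].
Qed.

Lemma pnorm_ge_coord (p : K * K) : `|p.1| <= pnorm p /\ `|p.2| <= pnorm p.
Proof.
by split; rewrite -sqrtr_sqr /pnorm ler_wsqrtr// ?lerDl ?lerDr sqr_ge0.
Qed.

Lemma compact_pnorm_le (R0 : K) : compact [set p : K * K | pnorm p <= R0].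
Proof.
apply: (@subclosed_compact _ _ (`[- R0, R0]%classic `*` `[- R0, R0]%classic)).
- exact: closed_pnorm_le.
- by apply: compact_setX; exact: segment_compact.
move=> p /= pR; have [p1 p2] := pnorm_ge_coord p; rewrite !in_itv/=.
by split; rewrite -ler_norml; [exact: le_trans p1 pR|exact: le_trans p2 pR].
Qed.

(** Vanishing beyond a radius strictly below [R] is a form of compact support that rotations and
    derivatives visibly preserve. *)
Lemma test_funP (R : \bar K) (f : K * K -> C) : (0 < R)%E ->
  test_fun R f <-> smooth f /\
    exists R0, [/\ 0 <= R0, (R0%:E < R)%E & forall p, R0 < pnorm p -> f p = 0].
Proof.
move=> R0; split=> [[sf cf fR]|[sf [r [r0 rR fr]]]].
  split=> //; have [r [r0 rR Hr]] := @compact_radius _ pnorm _ R R0 continuous_pnorm (@pnorm_ge0 K) cf fR.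
  exists r; split => // p rp; apply/eqP; apply: contraTT rp => fp.
  by rewrite -leNgt; apply: Hr; exact: subset_closure.
have sub : closure [set p | f p != 0] `<=` [set p | pnorm p <= r].
  apply: closure_sub_closed; first exact: closed_pnorm_le.
  by move=> p /= fp; rewrite leNgt; apply: contra_neqN fp; exact: fr.
split => //.
- by apply: subclosed_compact sub; [exact: closed_closure|exact: compact_pnorm_le].
- by move=> p /sub /= pr; apply: le_lt_trans rR; rewrite lee_fin.
Qed.

Lemma near_pos_itv0R (R : \bar K) (r : K) : pos_itv0R R r -> \forall t \near r, pos_itv0R R t.
Proof.
move=> [r0]; case: R => [R| |] //=.
  by rewrite lte_fin => rR; near=> t; split; rewrite ?lte_fin; near: t; [exact: lt_nbhsr|exact: lt_nbhsl].
by move=> _; near=> t; split; rewrite ?ltry//; near: t; exact: lt_nbhsr.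
Unshelve. all: by end_near. Qed.

Lemma near_disc (R : \bar K) (p : K * K) : pos_itv0R R (pnorm p) ->
  \forall q \near p, pos_itv0R R (pnorm q).
Proof. by move=> /near_pos_itv0R H; have cp : pnorm @ p --> pnorm p := @continuous_pnorm K p; exact: (cp _ H). Qed.

Lemma ex_small_radius (R : \bar K) : (0 < R)%E -> exists2 d, 0 < d & (d%:E < R)%E.
Proof.
case: R => [R| |] //=; last by exists 1 => //; rewrite ltry.
by rewrite lte_fin => R0; exists (R / 2); rewrite ?lte_fin ?divr_gt0// ltr_pdivrMr// ltr_pMr// ltr1n.
Qed.

Lemma continuous_eq0_right (h : K -> K) (d : K) : 0 < d -> continuous h ->
  (forall r, 0 < r -> r < d -> h r = 0) -> h 0 = 0.
Proof.
move=> d0 ch H; apply/eqP; rewrite -normr_le0; apply/ler_addgt0Pl => e e0; rewrite addr0.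
have /cvgrPdist_le /(_ _ e0) /nbhs_ballP[c /= c0 Hc] := ch 0.
pose r := Num.min (c / 2) (d / 2).
have r0 : 0 < r by rewrite lt_min !divr_gt0.
have rd : r < d by rewrite gt_min orbC ltr_pdivrMr// ltr_pMr// ltr1n.
have rc : r < c by rewrite gt_min ltr_pdivrMr// ltr_pMr// ltr1n.
by have := Hc r; rewrite /ball/= sub0r normrN gtr0_norm// => /(_ rc); rewrite (H _ r0 rd) subr0.
Qed.

(** At positive [r] the angular factor is 1 on this axis, so this reads off the radial coefficient
    of a mode function. *)
Definition axis (f : K * K -> C) (r : K) : C := f (r, 0).

Lemma continuous_axis : continuous (fun r : K => (r, 0) : K * K).
Proof.
rewrite (_ : (fun r => _) = fun r : K => r *: (ex : K * K)); first exact: scalel_continuous.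
by apply/funext => r; rewrite /ex; congr pair; rewrite -[_ *: _]/(_ * _) ?mulr1 ?mulr0.
Qed.

Lemma ccont_axis (f : K * K -> C) : ccont f -> ccont (axis f).
Proof.
move=> [c1 c2]; split => r.
- by apply: (@continuous_comp _ _ _ (fun r : K => (r, 0) : K * K) (re_part f)); [exact: continuous_axis|exact: c1].
- by apply: (@continuous_comp _ _ _ (fun r : K => (r, 0) : K * K) (im_part f)); [exact: continuous_axis|exact: c2].
Qed.

Lemma continuous_polar (t : K) : continuous (polar ^~ t : K -> K * K).
Proof.
rewrite (_ : polar ^~ t = fun r : K => r *: ((cos t, sin t) : K * K)); first exact: scalel_continuous.
by apply/funext.
Qed.

Lemma expi_pi : expi (pi : K) = -1.
Proof. by apply: complexP; rewrite /= ?cospi ?sinpi ?oppr0. Qed.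

(** For nonzero [m] some angle makes the angular factor -1, so the values on that ray and on the
    axis are opposite; at the common endpoint they coincide, hence vanish. *)
Lemma mode_origin (R : \bar K) (m : int) (f : K * K -> C) : (0 < R)%E -> ccont f ->
  (forall p, p != 0 -> disc R p -> f p = hat m (axis f) p) ->
  forall p, disc R p -> f p = hat m (axis f) p.
Proof.
move=> R0 cf H p Rp; have [->|p0] := eqVneq p 0; last exact: H.
rewrite /hat pnorm0 uvec0 exp0rz; have [m0|m0] := eqVneq m 0; first by rewrite mul1r.
rewrite mul0r; have [d d0 dR] := ex_small_radius R0.
(* The angle at which exp(i m t) = -1. *)
pose t : K := pi / m%:~R.
have mt : m%:~R * t = pi by rewrite /t mulrC divfK// intr_eq0.
have E (r : K) : 0 < r -> r < d -> f (polar r t) + axis f r = 0.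
  move=> r0 rd; have nr : pnorm (polar r t) = r by rewrite pnorm_polar// ltW.
  rewrite H; last 2 first.
  - by apply/eqP => e; move: nr; rewrite e pnorm0 => /eqP; rewrite eq_sym gt_eqF.
  - by rewrite -[disc R _]/(is_true ((pnorm (polar r t))%:E < R)%E) nr (lt_trans _ dR)// lte_fin.
  by rewrite /hat nr uvec_polar// -expi_int mt expi_pi mulN1r addNr.
have [c1 c2] := ccont_axis cf; case: cf => cf1 cf2.
have p00 : polar 0 t = 0 :> K * K by rewrite /polar !mul0r.
have dbl (x : K) : x + x = 0 -> x = 0 by move=> ?; lra.
apply: complexP => /=; apply: dbl.
- have := @continuous_eq0_right (fun r => re_part f (polar r t) + re_part (axis f) r) d d0.
  rewrite p00; apply.
    move=> r; apply: cvgD; last exact: c1.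
    by apply: (@continuous_comp _ _ _ (polar ^~ t) (re_part f)); [exact: continuous_polar|exact: cf1].
  by move=> r r0 rd; have /(congr1 Re) := E r r0 rd; rewrite cReD.
- have := @continuous_eq0_right (fun r => im_part f (polar r t) + im_part (axis f) r) d d0.
  rewrite p00; apply.
    move=> r; apply: cvgD; last exact: c2.
    by apply: (@continuous_comp _ _ _ (polar ^~ t) (im_part f)); [exact: continuous_polar|exact: cf2].
  by move=> r r0 rd; have /(congr1 Im) := E r r0 rd; rewrite cImD.
Qed.

Lemma uvec_axis (r : K) : 0 < r -> uvec (r, 0) = 1.
Proof.
move=> r0; have := uvec_polar 0 r0; rewrite expi0 => <-; congr uvec.
by rewrite /polar cos0 sin0 mulr1 mulr0.
Qed.

Lemma pnorm_axis (r : K) : 0 < r -> pnorm (r, 0) = r.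
Proof. by move=> r0; rewrite /pnorm /= expr0n addr0 sqrtr_sqr gtr0_norm. Qed.

Lemma is_cder_axis (f : K * K -> C) (r : K) : smooth f ->
  is_cder r (1 : K) (axis f) (cderive (1 : K) (axis f) r).
Proof.
move=> /smoothP/(_ [::])[_ df]; apply: cderivableP; apply: is_cder_derivable.
by apply: (is_cder_exP f r 0 _).1; exact: cderivableP (df true _).
Qed.

(** Off the origin this is [is_cder_hat] for the profile [axis f]; the origin is added by
    [mode_origin], the derivatives being continuous. *)
Lemma mode_step (R : \bar K) (m : int) (f : K * K -> C) : (0 < R)%E -> smooth f ->
  (forall p, disc R p -> f p = hat m (axis f) p) ->
  [/\ forall r, pos_itv0R R r -> axis (dzeta f) r = s2 * radD m (axis f) r,
      forall r, pos_itv0R R r -> axis (dzetabar f) r = s2 * radD (- m) (axis f) r,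
      forall p, disc R p -> dzeta f p = hat (m - 1) (axis (dzeta f)) p
    & forall p, disc R p -> dzetabar f p = hat (m + 1) (axis (dzetabar f)) p].
Proof.
move=> R0 sf H.
have off p : pos_itv0R R (pnorm p) ->
    dzeta f p = uvec p ^ (m - 1) * (s2 * radD m (axis f) (pnorm p)) /\
    dzetabar f p = uvec p ^ (m + 1) * (s2 * radD (- m) (axis f) (pnorm p)).
  move=> Rp; have [p0 pR] := Rp.
  have [dx dy] := is_cder_hat m p0 (is_cder_axis (pnorm p) sf).
  have nf : \forall q \near p, hat m (axis f) q = f q.
    by apply: filterS (near_disc Rp) => q [_ qR]; rewrite H.
  have {}dx := is_cder_near nf dx; have {}dy := is_cder_near nf dy.
  rewrite /dzeta /dzetabar (is_cder_val dx) (is_cder_val dy).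
  have -> : radD (- m) (axis f) (pnorm p) =
      cderive (1 : K) (axis f) (pnorm p) - (m%:~R / pnorm p)%:C * axis f (pnorm p).
    by rewrite /radD mulrNz mulNr rmorphN mulNr.
  rewrite -[radD m _ _]/(cderive (1 : K) (axis f) (pnorm p) + (m%:~R / pnorm p)%:C * axis f (pnorm p)).
  set A := _ + _ * axis f _; set B := _ - _ * axis f _.
  set UA := uvec p ^ (m - 1); set UB := uvec p ^ (m + 1).
  have [e1 e2 _ _] := wirtinger_ring (UA * A) (UB * B) (@s2_sqr K) (@sqr_iC K).
  rewrite -s2_half !(mulrCA _ s2); split.
  - by rewrite -[in RHS]e1; ring.
  - by rewrite -[in RHS]e2; ring.
have ax r : pos_itv0R R r -> axis (dzeta f) r = s2 * radD m (axis f) r /\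
    axis (dzetabar f) r = s2 * radD (- m) (axis f) r.
  move=> [r0 rR]; have nr := pnorm_axis r0.
  have := off (r, 0); by rewrite nr (uvec_axis r0) !exp1rz !mul1r; apply; split.
split.
- by move=> r /ax[].
- by move=> r /ax[].
- apply: mode_origin => //; first by have := smooth_dzeta sf => /smoothP/(_ [::])[].
  move=> p p0 Rp; have Rp' : pos_itv0R R (pnorm p) by split=> //; exact: pnorm_gt0.
  by rewrite /hat (ax _ Rp').1; have [] := off p Rp'.
- apply: mode_origin => //; first by have := smooth_dzetabar sf => /smoothP/(_ [::])[].
  move=> p p0 Rp; have Rp' : pos_itv0R R (pnorm p) by split=> //; exact: pnorm_gt0.
  by rewrite /hat (ax _ Rp').2; have [] := off p Rp'.
Qed.

End ModeRadial.

(** * Radial and planar test functions *)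

Section RadialTest.
Context {K : realType}.
Local Notation C := K[i].
Local Notation Re := (@complex.Re K).
Local Notation Im := (@complex.Im K).
Local Notation s2 := (((Num.sqrt 2)^-1)%:C : C).
Local Notation c2 := ((Num.sqrt 2)%:C : C).

Lemma c2_s2 : c2 * s2 = 1.
Proof. by rewrite -rmorphM /= divff// gt_eqF// sqrtr_gt0. Qed.

Lemma radD_near (j : int) (f g : K -> C) (c : C) (r : K) :
  (\forall t \near r, f t = c * g t) -> cderivable g r (1 : K) ->
  cderivable f r (1 : K) /\ radD j f r = c * radD j g r.
Proof.
move=> fg dg; have D := is_cderZ c (cderivableP dg).
have fg' : \forall t \near r, c * g t = f t by apply: filterS fg.
have Df := is_cder_near fg' D; split; first exact: is_cder_derivable Df.
by rewrite /radD (is_cder_val Df) (nbhs_singleton fg) mulrDr (mulrCA c).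
Qed.

Lemma mode_fun_hat (R : \bar K) (j : int) (f : K * K -> C) (fj : K -> C) : (0 < R)%E ->
  mode_fun R j f fj ->
  (forall r, itv0R R r -> axis f r = fj r) /\ forall p, disc R p -> f p = hat j (axis f) p.
Proof.
move=> R0 [H H0].
have ax r : itv0R R r -> axis f r = fj r.
  move=> [r0 rR]; have := H r 0 r0 rR.
  by rewrite mulr0 expi0 mul1r /polar cos0 sin0 mulr1 mulr0.
split=> // p Rp.
have i0 : itv0R R (pnorm p) by split=> //; exact: pnorm_ge0.
have [p0|[t [p0 pE ut]]] := uvecP p.
  rewrite p0 /hat pnorm0 uvec0 exp0rz; have [j0|j0] := eqVneq j 0; first by rewrite mul1r.
  rewrite mul0r; have := H 0 0 (lexx _) R0; rewrite H0// mulr0.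
  by rewrite /polar !mul0r.
rewrite /hat ut -expi_int ax//.
by rewrite {1}pE; case: i0 => ? ?; exact: H.
Qed.

Lemma jet_of_mode (R : \bar K) (j : int) (f : K * K -> C) (fj : K -> C) (a b : nat) :
  (0 < R)%E -> smooth f -> mode_fun R j f fj ->
  forall p, disc R p -> jet_of f a b p = hat (j + b%:Z - a%:Z) (axis (jet_of f a b)) p.
Proof.
move=> R0 sf mf; elim: b => [|b IH].
  elim: a => [|a IH]; first by rewrite addr0 subr0; exact: (mode_fun_hat R0 mf).2.
  have [_ _ H _] := mode_step R0 (smooth_jet_of a 0 sf) IH.
  by rewrite (_ : j + 0%:Z - a.+1%:Z = j + 0%:Z - a%:Z - 1)//; rewrite -addn1 PoszD; ring.
have [_ _ _ H] := mode_step R0 (smooth_jet_of a b sf) IH.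
by rewrite (_ : j + b.+1%:Z - a%:Z = j + b%:Z - a%:Z + 1)//; rewrite -addn1 PoszD; ring.
Qed.

Lemma cderivable_axis (f : K * K -> C) (r : K) : smooth f -> cderivable (axis f) r (1 : K).
Proof. by move=> /(is_cder_axis r)/is_cder_derivable. Qed.

(** Each radial operator is sqrt 2 times dzeta or dzetabar read on the axis, whence the power of
    [c2]. The induction differentiates the identity, so it needs it on a neighbourhood of each
    radius. *)
Lemma radDn_mode (R : \bar K) (j : int) (f : K * K -> C) (fj : K -> C) (a b : nat) :
  (0 < R)%E -> smooth f -> mode_fun R j f fj ->
  forall r, pos_itv0R R r ->
  radDn (- j + a%:Z) b (radDn j a fj) r = c2 ^+ (a + b) * axis (jet_of f a b) r.
Proof.
move=> R0 sf mf.
have c2K (n : nat) (z w : C) : w = s2 * z -> c2 ^+ n * z = c2 ^+ n.+1 * w.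
  by move=> ->; rewrite exprSr -!mulrA (mulrA c2) c2_s2 mul1r.
have base : forall a r, pos_itv0R R r -> radDn j a fj r = c2 ^+ a * axis (jet_of f a 0) r.
  elim=> [|a' IH] r Rr.
    by rewrite mul1r -[LHS]/(fj r) -(mode_fun_hat R0 mf).1//; case: Rr => r0 ?; split=> //; exact: ltW.
  have [H _ _ _] := mode_step R0 (smooth_jet_of a' 0 sf) (jet_of_mode a' 0 R0 sf mf).
  have nr : \forall t \near r, radDn j a' fj t = c2 ^+ a' * axis (jet_of f a' 0) t.
    by apply: filterS (near_pos_itv0R Rr) => t; exact: IH.
  have [_ E] := radD_near (j - a'%:Z) nr (cderivable_axis r (smooth_jet_of a' 0 sf)).
  rewrite [LHS]E; apply: c2K; rewrite -[LHS]/(axis (dzeta (jet_of f a' 0)) r) H//.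
  by rewrite addr0.
elim: b => [|b IH] r Rr; first by rewrite addn0; exact: base.
have [_ H _ _] := mode_step R0 (smooth_jet_of a b sf) (jet_of_mode a b R0 sf mf).
have nr : \forall t \near r, radDn (- j + a%:Z) b (radDn j a fj) t = c2 ^+ (a + b) * axis (jet_of f a b) t.
  by apply: filterS (near_pos_itv0R Rr) => t; exact: IH.
have [_ E] := radD_near (- j + a%:Z - b%:Z) nr (cderivable_axis r (smooth_jet_of a b sf)).
rewrite [LHS]E addnS; apply: c2K; rewrite -[LHS]/(axis (dzetabar (jet_of f a b)) r) H//.
by congr (_ * radD _ _ _); ring.
Qed.

Lemma radDn_mode_derivable (R : \bar K) (j : int) (f : K * K -> C) (fj : K -> C) (a b : nat) :
  (0 < R)%E -> smooth f -> mode_fun R j f fj ->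
  forall r, pos_itv0R R r -> cderivable (radDn (- j + a%:Z) b (radDn j a fj)) r (1 : K).
Proof.
move=> R0 sf mf r Rr.
have nr : \forall t \near r, radDn (- j + a%:Z) b (radDn j a fj) t = c2 ^+ (a + b) * axis (jet_of f a b) t.
  by apply: filterS (near_pos_itv0R Rr) => t; exact: radDn_mode.
by have [] := radD_near 0 nr (cderivable_axis r (smooth_jet_of a b sf)).
Qed.

Lemma ccont_within_eq (A : set K) (f g : K -> C) : (forall r, A r -> f r = g r) ->
  ccont f -> ccontinuous_within A g.
Proof.
move=> fg [c1 c2']; split.
- apply: (@subspace_eq_continuous _ A _ (re_part f)); last exact: continuous_subspaceT.
  by move=> r; rewrite inE => Ar; rewrite /re_part fg.
- apply: (@subspace_eq_continuous _ A _ (im_part f)); last exact: continuous_subspaceT.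
  by move=> r; rewrite inE => Ar; rewrite /im_part fg.
Qed.

(** The continuous extension of an iterated radial derivative is a planar derivative read on the
    axis. Its boundary condition holds because a function of nonzero mode vanishes at the origin. *)
Lemma mode_radial_test (R : \bar K) (j : int) (f : K * K -> C) (fj : K -> C) :
  (0 < R)%E -> test_fun R f -> mode_fun R j f fj -> radial_test_fun R j fj.
Proof.
move=> R0 /(test_funP f R0)[sf [r0 [r00 r0R supp]]] mf.
have [ax hatE] := mode_fun_hat R0 mf.
have cjet a b : ccont (jet_of f a b) by have := smooth_jet_of a b sf => /smoothP/(_ [::])[].
split.
- have sub : closure [set r | itv0R R r /\ fj r != 0] `<=` `[0, r0]%classic.
    apply: closure_sub_closed; first exact: interval_closed.
    move=> r [/= [r0' rR] fr]; rewrite in_itv/= r0' /= leNgt.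
    apply: contra_neqN fr => r0r; rewrite -ax//; apply: supp.
    by rewrite pnorm_axis// (le_lt_trans r00).
  split.
    by apply: subclosed_compact sub; [exact: closed_closure|exact: segment_compact].
  move=> r /sub/=; rewrite in_itv/= => /andP[? rr0]; split => //.
  by apply: le_lt_trans r0R; rewrite lee_fin.
- by apply: (ccont_within_eq ax); apply: ccont_axis; exact: (cjet 0%N 0%N).
move=> n i le_in; split.
- by move=> m mi r Rr; exact: (radDn_mode_derivable m 0 R0 sf mf Rr).
- by move=> m mi r Rr; exact: (radDn_mode_derivable i m R0 sf mf Rr).
exists (fun r => c2 ^+ n * axis (jet_of f i (n - i)) r); split.
- apply: (@ccont_within_eq _ (fun r => 0 + c2 ^+ n * axis (jet_of f i (n - i)) r)).
    by move=> r _; rewrite add0r.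
  by apply: ccont_comb; [exact: ccont_cst|apply: ccont_axis; exact: cjet].
- by move=> r Rr; rewrite (radDn_mode i (n - i) R0 sf mf Rr) subnKC.
have -> : j + n%:Z - 2 * i%:Z = j + (n - i)%:Z - i%:Z by rewrite -{1}(subnKC le_in) PoszD; ring.
have [->|m0] := eqVneq (j + (n - i)%:Z - i%:Z) 0; first by rewrite mul0r.
have d0 : disc R (0 : K * K) by rewrite -[disc R _]/(is_true ((pnorm (0 : K * K))%:E < R)%E) pnorm0.
have := jet_of_mode i (n - i) R0 sf mf d0.
rewrite /hat uvec0 exp0rz (negbTE m0) mul0r => E.
by rewrite /axis -[(0, 0)]/(0 : K * K) E !mulr0.
Qed.

Lemma within_comp (A : set K) (h c : K -> K) : {within A, continuous h} ->
  continuous c -> (forall r, A (c r)) -> continuous (h \o c).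
Proof.
move=> /subspace_continuousP hA cc Ac r.
apply: (cvg_comp c h _ (hA _ (Ac r))).
move=> B HB; have Hc : \forall x \near r, A (c x) -> B (c x) := cc r _ HB.
suff : \forall x \near r, B (c x) by [].
near=> x; have : A (c x) -> B (c x) by near: x.
by apply; exact: Ac.
Unshelve. all: by end_near. Qed.

(** For [d >= 0], an even retraction of the line onto [[0, d]]: composition with it turns continuity
    on [[0, R)] into continuity on the line. *)
Definition clamp (d r : K) : K := Num.min `|r| d.

Lemma continuous_clamp (d : K) : continuous (clamp d).
Proof.
move=> r; apply: (@continuous_min _ _ (fun r : K => `|r|) (fun=> d) r).
  exact: norm_continuous.
exact: cvg_cst.
Qed.

Lemma clamp_itv0R (R : \bar K) (d r : K) : 0 <= d -> (d%:E < R)%E -> itv0R R (clamp d r).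
Proof.
move=> d0 dR; split; first by rewrite le_min normr_ge0.
by apply: le_lt_trans dR; rewrite lee_fin ge_min lexx orbT.
Qed.

Lemma ccont_within_clamp (R : \bar K) (d : K) (f : K -> C) : 0 <= d -> (d%:E < R)%E ->
  ccontinuous_within (itv0R R) f -> ccont (fun r => f (clamp d r)).
Proof.
move=> d0 dR [c1 c2']; have Ac r := clamp_itv0R r d0 dR.
by split; [exact: (within_comp c1 (@continuous_clamp d) Ac)|exact: (within_comp c2' (@continuous_clamp d) Ac)].
Qed.

Lemma clamp_id (d r : K) : 0 <= r -> r <= d -> clamp d r = r.
Proof. by move=> r0 rd; rewrite /clamp ger0_norm//; apply/min_idPl. Qed.

Lemma ccont_within_eq0 (R : \bar K) (f g : K -> C) : (0 < R)%E ->
  ccontinuous_within (itv0R R) f -> ccontinuous_within (itv0R R) g ->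
  (forall r, pos_itv0R R r -> f r = g r) -> f 0 = g 0.
Proof.
move=> R0 cf cg fg; have [d d0 dR] := ex_small_radius R0.
have c := ccont_comb (-1) (ccont_within_clamp (ltW d0) dR cf) (ccont_within_clamp (ltW d0) dR cg).
have E r : 0 < r -> r < d -> f (clamp d r) + -1 * g (clamp d r) = 0.
  move=> r0 rd; rewrite clamp_id ?ltW// fg ?mulN1r ?subrr//.
  by split=> //; apply: lt_trans dR; rewrite lte_fin.
have E0 : f (clamp d 0) + -1 * g (clamp d 0) = 0.
  apply: complexP.
  - apply: (continuous_eq0_right d0 c.1) => r r0 rd.
    by rewrite /re_part E.
  - apply: (continuous_eq0_right d0 c.2) => r r0 rd.
    by rewrite /im_part E.
have c0 : clamp d 0 = 0 by apply: clamp_id => //; exact: ltW.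
by move: E0; rewrite c0 mulN1r => /eqP; rewrite subr_eq0 => /eqP.
Qed.

Lemma radDn_eq0 (R : \bar K) (r0 : K) (j : int) (n : nat) (f : K -> C) :
  0 <= r0 -> (forall t, r0 < t -> (t%:E < R)%E -> f t = 0) ->
  forall t, r0 < t -> (t%:E < R)%E -> radDn j n f t = 0.
Proof.
move=> r00 f0; elim: n => [//|n IH] t rt tR /=.
have nz : \forall u \near t, 0 = radDn j n f u.
  have Rt : pos_itv0R R t by split => //; exact: le_lt_trans rt.
  near=> u; have [_ uR] : pos_itv0R R u by near: u; exact: near_pos_itv0R.
  by rewrite IH//; near: u; exact: lt_nbhsr.
rewrite /radD (is_cder_val (is_cder_near nz (is_cder_cst _ _ _))) -(nbhs_singleton nz).
by rewrite mulr0 addr0.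
Unshelve. all: by end_near. Qed.

(* D_(m+1) D_(-m) = D_(1-m) D_m, written with the derivatives as data. *)
Lemma radD_comm (m : int) (r : K) (h p q : K -> C) (h1 p1 : C) : 0 < r ->
  (\forall t \near r, q t = p t + (2 * m%:~R / t)%:C * h t) ->
  is_cder r (1 : K) h h1 -> is_cder r (1 : K) p p1 ->
  p r = h1 - (m%:~R / r)%:C * h r ->
  radD (m + 1) p r = radD (1 - m) q r.
Proof.
move=> r0 qE dh dp pr.
have rn : r != 0 by rewrite gt_eqF.
have dinv : is_cder r (1 : K) (fun t : K => (2 * m%:~R / t)%:C) ((- (2 * m%:~R / r ^+ 2))%:C).
  split; last exact: is_derive_cst.
  have D := is_deriveM (is_derive_cst (2 * m%:~R : K) r 1) (is_deriveV (rn : (idfun : K -> K) r != 0) (is_derive_id r 1)).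
  apply: (is_derive_eq D); rewrite -![_ *: _]/(_ * _) /=.
  by rewrite /cst mulr0 addr0 mulr1 mulrN.
have qE' : \forall t \near r, p t + (2 * m%:~R / t)%:C * h t = q t by apply: filterS qE.
have dq := is_cder_near qE' (is_cderD dp (is_cderM dinv dh)).
rewrite /radD (is_cder_val dp) (is_cder_val dq) (nbhs_singleton qE) pr.
rewrite intrB intrD mulr1z.
have E (a b : K) (x y : C) : a = b -> x = y -> a%:C * x = b%:C * y by move=> -> ->.
apply: complexP; rewrite !ReImE /=; field; exact: rn.
Qed.

(** The radial counterpart of commuting dzeta past [b] copies of dzetabar; the inductive step is
    [radD_comm]. *)
Lemma radDn_comm (R : \bar K) (j : int) (phi : K -> C) :
  (forall a b, radDn_exists R (- j + a%:Z) b (radDn j a phi)) ->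
  forall a b r, pos_itv0R R r ->
  radD (j + b%:Z - a%:Z) (radDn (- j + a%:Z) b (radDn j a phi)) r =
  radDn (- j + a.+1%:Z) b (radDn j a.+1 phi) r.
Proof.
move=> dphi a; elim=> [|b IH] r Rr; first by rewrite addr0.
pose h := radDn (- j + a%:Z) b (radDn j a phi).
have dh : forall t, pos_itv0R R t -> is_cder t (1 : K) h (cderive (1 : K) h t).
  by move=> t Rt; apply: cderivableP; exact: (dphi a b.+1 b (ltnSn b) t Rt).
have dp : forall t, pos_itv0R R t -> is_cder t (1 : K) (radDn (- j + a%:Z) b.+1 (radDn j a phi))
    (cderive (1 : K) (radDn (- j + a%:Z) b.+1 (radDn j a phi)) t).
  by move=> t Rt; apply: cderivableP; exact: (dphi a b.+2 b.+1 (ltnSn _) t Rt).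
have r0 : 0 < r by case: Rr.
have Em : - j + a%:Z - b%:Z = - (j + b%:Z - a%:Z) by ring.
have pE t : radDn (- j + a%:Z) b.+1 (radDn j a phi) t =
    cderive (1 : K) h t - ((j + b%:Z - a%:Z)%:~R / t)%:C * h t.
  by rewrite -[LHS]/(radD (- j + a%:Z - b%:Z) h t) Em /radD mulrNz mulNr rmorphN mulNr.
(* With m = j + b - a, the left side is D_m of [h] by induction, the first term on the right is
   D_(-m) of [h], and the two operators differ by 2m/t. *)
have qE : \forall t \near r, radDn (- j + a.+1%:Z) b (radDn j a.+1 phi) t =
    radDn (- j + a%:Z) b.+1 (radDn j a phi) t + (2 * (j + b%:Z - a%:Z)%:~R / t)%:C * h t.
  apply: filterS (near_pos_itv0R Rr) => t Rt; rewrite -IH// pE /radD -/h.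
  have -> : (2 * (j + b%:Z - a%:Z)%:~R / t)%:C = ((j + b%:Z - a%:Z)%:~R / t)%:C + ((j + b%:Z - a%:Z)%:~R / t)%:C :> C.
    by rewrite -rmorphD -mulrDl -mulr2n mulr_natl.
  by ring.
have := radD_comm r0 qE (dh r Rr) (dp r Rr) (pE r).
have -> : j + b%:Z - a%:Z + 1 = j + b.+1%:Z - a%:Z by rewrite -addn1 PoszD; ring.
have -> : 1 - (j + b%:Z - a%:Z) = - j + a.+1%:Z - b%:Z by rewrite -addn1 PoszD; ring.
by [].
Qed.

End RadialTest.

(** * From a radial test function to a planar one *)

Section RadialJet.
Context {K : realType}.
Local Notation C := K[i].
Local Notation Re := (@complex.Re K).
Local Notation Im := (@complex.Im K).
Local Notation s2 := (((Num.sqrt 2)^-1)%:C : C).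

Lemma hat_mode_fun (R : \bar K) (m : int) (f : K * K -> C) (fm : K -> C) : (0 < R)%E ->
  (forall p, disc R p -> f p = hat m fm p) -> (m != 0 -> fm 0 = 0) -> mode_fun R m f fm.
Proof.
move=> R0 H f0; split=> // r t r0 rR.
have np : pnorm (polar r t) = r by exact: pnorm_polar.
rewrite H; last by rewrite -[disc R _]/(is_true ((pnorm (polar r t))%:E < R)%E) np.
rewrite /hat np; have [rp|] := ltP 0 r.
  by rewrite uvec_polar// expi_int.
move=> r0'; have -> : r = 0 by apply/eqP; rewrite eq_le r0' r0.
have [->|m0] := eqVneq m 0; first by rewrite mul0r expi0.
by rewrite f0// !mulr0.
Qed.

(** The third clause of [radial_test_fun], taken at [n = a + b] and [i = a], supplies for each pair
    of indices an extension to 0 of the iterated radial derivative. Scaled by powers of [s2], these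
    are the profiles given to [hat_jet]. *)
Lemma radial_jet (R : \bar K) (j : int) (phi : K -> C) : (0 < R)%E ->
  radial_test_fun R j phi ->
  exists F : nat -> nat -> K * K -> C,
    [/\ jet F, mode_fun R j (F 0%N 0%N) phi,
      exists R0, [/\ 0 <= R0, (R0%:E < R)%E & forall p, R0 < pnorm p -> F 0%N 0%N p = 0]
    & forall a b p, disc R p -> p != 0 -> F a b p =
        hat (j + b%:Z - a%:Z) (fun r => s2 ^+ (a + b) * radDn (- j + a%:Z) b (radDn j a phi) r) p].
Proof.
move=> R0 [[csupp supp] cphi Hphi].
have [r0 [r00 r0R suppr]] : exists r0, [/\ 0 <= r0, (r0%:E < R)%E &
    forall r, itv0R R r -> r0 < r -> phi r = 0].
  have h1 x : closure [set r | itv0R R r /\ phi r != 0] x -> (`|x|%:E < R)%E.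
    by move=> /supp[x0 xR]; rewrite ger0_norm.
  have [r0 [r00 r0R Hr]] := compact_radius R0 (@norm_continuous _ K) (@normr_ge0 _ K) csupp h1.
  exists r0; split=> // r rR rr; apply/eqP; apply: contraTT rr => pr.
  rewrite -leNgt; apply: (le_trans (ler_norm _)); apply: Hr.
  by apply: subset_closure; split.
have Hab (ab : nat * nat) : exists g : K -> C, [/\ ccontinuous_within (itv0R R) g,
    forall r, pos_itv0R R r -> g r = radDn (- j + ab.1%:Z) ab.2 (radDn j ab.1 phi) r
  & (j + ab.2%:Z - ab.1%:Z)%:~R * g 0 = 0].
  have [_ _ [g [cg gE g0]]] := Hphi (ab.1 + ab.2)%N ab.1 (leq_addr _ _).
  exists g; split=> //; first by move=> r Rr; rewrite gE// addKn.
  rewrite -[RHS]g0; congr (_%:~R * _); rewrite PoszD; ring.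
have {Hab}[g Hg] := choice Hab.
have dphi a b : radDn_exists R (- j + a%:Z) b (radDn j a phi).
  by have [_ H _] := Hphi (a + b)%N a (leq_addr _ _); rewrite addKn in H.
have gz a b r : r0 < r -> (r%:E < R)%E -> g (a, b) r = 0.
  move=> rr rR; have [_ gE _] := Hg (a, b); rewrite gE; last by split=> //; exact: le_lt_trans rr.
  apply: (@radDn_eq0 _ R r0) => // t rt tR; apply: (@radDn_eq0 _ R r0) => // u ru uR.
  by apply: suppr => //; split => //; apply/ltW; exact: le_lt_trans ru.
(* All profiles vanish beyond [r0], so clamping at some [r1] strictly between [r0] and [R] does not
   alter them and makes them continuous on the line. *)
have [r1 r01 r1R] : exists2 r1, r0 < r1 & (r1%:E < R)%E.
  move: r0R; case: (R) => [R'| |] //=; last by exists (r0 + 1); rewrite ?ltry ?ltrDl.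
  by rewrite lte_fin => h; exists ((r0 + R') / 2); rewrite ?lte_fin ?midf_lt.
(* The values of [phi] beyond [R] carry no information, so the profiles are set to 0 there. *)
pose G a b r : C := if (r%:E < R)%E then s2 ^+ (a + b) * g (a, b) r else 0.
have Gz a b r : r0 < r -> G a b r = 0.
  by move=> rr; rewrite /G; case: ifPn => // rR; rewrite gz// mulr0.
have cG a b : ccont (fun r : K => G a b `|r|).
  have [cg _ _] := Hg (a, b).
  have r10 : 0 <= r1 by apply/ltW; exact: le_lt_trans r01.
  have := ccont_comb (s2 ^+ (a + b)) (ccont_cst _ 0) (ccont_within_clamp r10 r1R cg).
  congr ccont; apply/funext => r; rewrite add0r.
  have [rr|rr] := leP `|r| r1.
    rewrite /clamp min_l// /G ifT//.
    by apply: le_lt_trans r1R; rewrite lee_fin.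
  by rewrite Gz ?(lt_trans r01)// /clamp min_r ?ltW// gz// mulr0.
have G0 a b : j + b%:Z - a%:Z != 0 -> G a b 0 = 0.
  move=> m0; rewrite /G R0; have [_ _ /eqP] := Hg (a, b).
  rewrite mulf_eq0 intr_eq0 (negbTE m0)/= => /eqP ->.
  by rewrite mulr0.
have GE a b r : pos_itv0R R r -> G a b r = s2 ^+ (a + b) * radDn (- j + a%:Z) b (radDn j a phi) r.
  by move=> Rr; have [_ gE _] := Hg (a, b); case: (Rr) => _ rR; rewrite /G rR gE.
have dG a b (r : K) : 0 < r -> exists g', [/\ is_cder r (1 : K) (G a b) g',
     s2 * (g' + ((j + b%:Z - a%:Z)%:~R / r)%:C * G a b r) = G a.+1 b r
   & s2 * (g' - ((j + b%:Z - a%:Z)%:~R / r)%:C * G a b r) = G a b.+1 r].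
  move=> rp; have [rr|rr] := ltP r0 r.
    exists 0; rewrite !Gz// !mulr0 addr0 subr0 mulr0; split=> //.
    have nz : \forall t \near r, 0 = G a b t.
      by near=> t; rewrite Gz//; near: t; exact: lt_nbhsr.
    exact: is_cder_near nz (is_cder_cst _ _ _).
  have Rr : pos_itv0R R r by split=> //; apply: le_lt_trans r0R; rewrite lee_fin.
  pose h := radDn (- j + a%:Z) b (radDn j a phi).
  have dh : is_cder r (1 : K) h (cderive (1 : K) h r).
    by apply: cderivableP; exact: (dphi a b.+1 b (ltnSn b) r Rr).
  exists (s2 ^+ (a + b) * cderive (1 : K) h r); split.
  - apply: is_cder_near (is_cderZ _ dh).
    by apply: filterS (near_pos_itv0R Rr) => t Rt; rewrite GE.
  - rewrite !GE// mulrCA -mulrDr mulrA -exprS; congr (_ * _).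
    by rewrite -(radDn_comm dphi).
  - rewrite !GE// mulrCA -mulrBr mulrA -exprS addnS; congr (_ * _).
    rewrite -[RHS]/(radD (- j + a%:Z - b%:Z) h r) /radD.
    have -> : - j + a%:Z - b%:Z = - (j + b%:Z - a%:Z) by ring.
    by rewrite mulrNz mulNr rmorphN mulNr.
exists (fun a b => hat (j + b%:Z - a%:Z) (G a b)); split.
- exact: hat_jet.
- have z0 : itv0R R 0 by split.
  (* [phi] and its extension agree at positive radii and are both continuous up to 0. *)
  have phi0 : g (0%N, 0%N) 0 = phi 0.
    have [cg gE _] := Hg (0%N, 0%N).
    by apply: (ccont_within_eq0 R0 cg cphi) => r Rr; rewrite gE.
  have Gphi r : itv0R R r -> G 0%N 0%N r = phi r.
    move=> [rge rR]; have [rp|rle] := ltP 0 r; first by rewrite GE// mul1r.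
    have -> : r = 0 by apply/eqP; rewrite eq_le rle rge.
    by rewrite /G R0 mul1r phi0.
  rewrite addr0 subr0; apply: hat_mode_fun => //.
    by move=> p Rp; rewrite /hat Gphi//; split=> //; exact: pnorm_ge0.
  by move=> j0; rewrite -Gphi// G0// addr0 subr0.
- exists r0; split=> // p rp; rewrite /hat Gz ?mulr0//.
- move=> a b p Rp p0; rewrite /hat GE//; split=> //; exact: pnorm_gt0.
Unshelve. all: by end_near. Qed.

End RadialJet.

(** * Integrals of complex-valued functions *)

Section ComplexIntegral.
Context {K : realType}.
Local Notation C := K[i].
Local Notation Re := (@complex.Re K).
Local Notation Im := (@complex.Im K).
Local Notation normc := (@Normc.normc K).
Notation mu := (@lebesgue_measure K).
Notation P := (@plane_measure K).
Notation plane := (measurableTypeR K * measurableTypeR K)%type.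

(** The plane carries the product sigma-algebra, so an open set is written as a countable union of
    boxes with rational corners. *)
Lemma open_plane_measurable (U : set (K * K)) : open U -> measurable (U : set plane).
Proof.
move=> oU.
pose box (q : rat * rat * (rat * rat)) : set plane :=
  `](ratr q.1.1 : K), ratr q.1.2[%classic `*` `](ratr q.2.1 : K), ratr q.2.2[%classic.
pose B q : set plane := if `[< box q `<=` U >] then box q else set0.
have -> : U = \bigcup_q B q.
  apply/seteqP; split=> [p Up|p [q _]]; last by rewrite /B; case: ifPn => // /asboolP h /h.
  have /near_square[e e0 He] : \forall q \near p, U q by exact: open_nbhs_nbhs.
  have [a a1] := rat_in_itvoo (ltac:(by rewrite ltrBlDr ltrDl) : p.1 - e < p.1).
  have [b b1] := rat_in_itvoo (ltac:(by rewrite ltrDl) : p.1 < p.1 + e).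
  have [c c1] := rat_in_itvoo (ltac:(by rewrite ltrBlDr ltrDl) : p.2 - e < p.2).
  have [d d1] := rat_in_itvoo (ltac:(by rewrite ltrDl) : p.2 < p.2 + e).
  move: a1 b1 c1 d1; rewrite !in_itv/= => /andP[a1 a2] /andP[b1 b2] /andP[c1 c2] /andP[d1 d2].
  exists ((a, b), (c, d)) => //; rewrite /B; case: ifPn => [_|/asboolP[]].
    by split; rewrite /= in_itv/=; apply/andP; split.
  move=> [x y] [/=]; rewrite !in_itv/= => /andP[x1 x2] /andP[y1 y2].
  by apply: He; rewrite ler_norml; apply/andP; split; lra.
apply: countable_bigcupT_measurable; first exact: countableP.
by move=> q; rewrite /B; case: ifPn => // _; exact: measurableX.
Qed.

Lemma continuous_plane_measurable (f : K * K -> K) : continuous f ->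
  measurable_fun setT (f : plane -> measurableTypeR K).
Proof.
move=> /continuousP cf; apply: (measurability _ (RGenOpens.measurableE K)).
move=> _ [_ [a [b ->] <-]]; rewrite setTI; apply: open_plane_measurable.
exact/cf/interval_open.
Qed.

Lemma normc_ge_part (z : C) : `|Re z| <= normc z /\ `|Im z| <= normc z.
Proof.
by case: z => a b; rewrite /Normc.normc /=; split; rewrite -sqrtr_sqr ler_wsqrtr// ?lerDl ?lerDr sqr_ge0.
Qed.

Lemma normc_ge0 (z : C) : 0 <= normc z.
Proof. by case: z => a b; exact: sqrtr_ge0. Qed.

Lemma normc_le_parts (z : C) : normc z <= `|Re z| + `|Im z|.
Proof.
case: z => a b /=; rewrite -[leRHS]ger0_norm ?addr_ge0// -sqrtr_sqr ler_wsqrtr//.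
by rewrite sqrrD !real_normK ?num_real// lerD2r lerDl mulrn_wge0// mulr_ge0.
Qed.

Lemma normc_expi (t : K) : normc (expi t) = 1.
Proof. by rewrite /Normc.normc /= cos2Dsin2 sqrtr1. Qed.

Section General.
Context d (T : measurableType d) (m : {measure set T -> \bar K}).
Implicit Types (A : set T) (f g : T -> C).

Definition cintegrable A f :=
  m.-integrable A (fun x => (re_part f x)%:E) /\ m.-integrable A (fun x => (im_part f x)%:E).

Definition cmeasurable A f := measurable_fun A (re_part f) /\ measurable_fun A (im_part f).

Lemma cmeasurableM A f g : cmeasurable A f -> cmeasurable A g -> cmeasurable A (fun x => f x * g x).
Proof.
move=> [f1 f2] [g1 g2]; split.
- rewrite (_ : re_part _ = fun x => re_part f x * re_part g x - im_part f x * im_part g x).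
    by apply: measurable_funB; exact: measurable_funM.
  by apply/funext => x; rewrite /re_part cReM.
- rewrite (_ : im_part _ = fun x => re_part f x * im_part g x + im_part f x * re_part g x).
    by apply: measurable_funD; exact: measurable_funM.
  by apply/funext => x; rewrite /im_part cImM.
Qed.

Lemma cmeasurable_cst A (c : C) : cmeasurable A (fun=> c).
Proof. by split; exact: measurable_cst. Qed.

Lemma eq_cintegral A f g : (forall x, A x -> f x = g x) -> cintegral m A f = cintegral m A g.
Proof.
by move=> fg; rewrite /cintegral; congr (_ +i* _); apply: eq_Rintegral => x /set_mem Ax;
  rewrite /re_part /im_part fg.
Qed.

Lemma cintegral_mkcond A f :
  cintegral m A f = cintegral m setT (fun x => if x \in A then f x else 0).
Proof.
rewrite /cintegral; congr (_ +i* _); rewrite Rintegral_mkcond; apply: eq_Rintegral => x _.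
  by rewrite patchE /re_part; case: ifPn.
by rewrite patchE /im_part; case: ifPn.
Qed.

Lemma cintegralZ A (c : C) f : measurable A -> cintegrable A f ->
  cintegral m A (fun x => c * f x) = c * cintegral m A f.
Proof.
move=> mA [i1 i2]; apply: complexP; rewrite ?cReM ?cImM /cintegral /=.
- rewrite -!RintegralZl// -RintegralB//.
  + by apply: eq_Rintegral => x _; rewrite /re_part cReM.
  + exact: (integrableZl mA (Re c) i1).
  + exact: (integrableZl mA (Im c) i2).
- rewrite -!RintegralZl// -RintegralD//.
  + by apply: eq_Rintegral => x _; rewrite /im_part cImM.
  + exact: (integrableZl mA (Re c) i2).
  + exact: (integrableZl mA (Im c) i1).
Qed.

Lemma cintegralD A f g : measurable A -> cintegrable A f -> cintegrable A g ->
  cintegral m A (fun x => f x + g x) = cintegral m A f + cintegral m A g.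
Proof.
move=> mA [i1 i2] [j1 j2]; apply: complexP; rewrite ?cReD ?cImD /cintegral /= -RintegralD//.
  by apply: eq_Rintegral => x _; rewrite /re_part cReD.
by apply: eq_Rintegral => x _; rewrite /im_part cImD.
Qed.

Lemma le_cintegrable A f (g : T -> K) : measurable A -> cmeasurable A f ->
  (forall x, A x -> normc (f x) <= g x) -> m.-integrable A (fun x => (g x)%:E) -> cintegrable A f.
Proof.
move=> mA [f1 f2] fg ig; split.
- apply: (le_integrable mA _ _ ig); first exact/measurable_EFinP.
  move=> x Ax; rewrite lee_fin; apply: (le_trans (normc_ge_part _).1).
  exact: (le_trans (fg _ Ax) (ler_norm _)).
- apply: (le_integrable mA _ _ ig); first exact/measurable_EFinP.
  move=> x Ax; rewrite lee_fin; apply: (le_trans (normc_ge_part _).2).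
  exact: (le_trans (fg _ Ax) (ler_norm _)).
Qed.

Lemma cintegral_ae_eq A f g : measurable A -> cmeasurable A f -> cmeasurable A g ->
  {ae m, forall x, A x -> f x = g x} -> cintegral m A f = cintegral m A g.
Proof.
move=> mA [f1 f2] [g1 g2] fg; rewrite /cintegral /Rintegral; congr (fine _ +i* fine _).
- apply: ae_eq_integral => //; try exact/measurable_EFinP.
  by apply: ae_mono fg => x h Ax; rewrite /re_part h.
- apply: ae_eq_integral => //; try exact/measurable_EFinP.
  by apply: ae_mono fg => x h Ax; rewrite /im_part h.
Qed.

End General.

(** Every section is asked to be integrable, so that each inner integral is finite and [fine] loses
    nothing inside. *)
Lemma cFubini d1 d2 (T1 : measurableType d1) (T2 : measurableType d2)
    (m1 : {sigma_finite_measure set T1 -> \bar K}) (m2 : {sigma_finite_measure set T2 -> \bar K})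
    (f : T1 * T2 -> C) :
  cintegrable (m1 \x m2)%E setT f ->
  (forall x, cintegrable m2 setT (fun y => f (x, y))) ->
  (forall y, cintegrable m1 setT (fun x => f (x, y))) ->
  cintegral m1 setT (fun x => cintegral m2 setT (fun y => f (x, y))) =
  cintegral m2 setT (fun y => cintegral m1 setT (fun x => f (x, y))).
Proof.
move=> [i1 i2] j2 j1; rewrite /cintegral /Rintegral; congr (fine _ +i* fine _).
- transitivity (\int[m1]_x \int[m2]_y (re_part f (x, y))%:E)%E.
    by apply: eq_integral => x _; rewrite fineK//; apply: integrable_fin_num => //; have [] := j2 x.
  transitivity (\int[m2]_y \int[m1]_x (re_part f (x, y))%:E)%E; first exact: (Fubini (f := fun z => (re_part f z)%:E) i1).
  by apply: eq_integral => y _; rewrite /re_part /= fineK//; apply: integrable_fin_num => //; have [] := j1 y.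
- transitivity (\int[m1]_x \int[m2]_y (im_part f (x, y))%:E)%E.
    by apply: eq_integral => x _; rewrite fineK//; apply: integrable_fin_num => //; have [] := j2 x.
  transitivity (\int[m2]_y \int[m1]_x (im_part f (x, y))%:E)%E; first exact: (Fubini (f := fun z => (im_part f z)%:E) i2).
  by apply: eq_integral => y _; rewrite /im_part /= fineK//; apply: integrable_fin_num => //; have [] := j1 y.
Qed.

Lemma integral_measure_preserving d (T : measurableType d) (m : {measure set T -> \bar K})
    (phi : T -> T) (g : T -> \bar K) : measurable_fun setT phi ->
  (forall A, measurable A -> m (phi @^-1` A) = m A) ->
  measurable_fun setT g -> (\int[m]_x g (phi x) = \int[m]_x g x)%E.
Proof.
move=> mphi mP mg; have [m' m'E] := ex_pushforward_measure m mphi.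
have ge0 (h : T -> \bar K) : measurable_fun setT h -> (forall p, (0 <= h p)%E) ->
    (\int[m]_p h (phi p) = \int[m]_p h p)%E.
  move=> mh h0; rewrite -(ge0_integral_ex_pushforward mphi m'E mh h0).
  by apply: eq_measure_integral => A mA _; rewrite m'E; exact: mP.
rewrite integralE [RHS]integralE; congr (_ - _)%E.
- transitivity (\int[m]_p (g^\+ (phi p)))%E; first by apply: eq_integral => p _; rewrite !funeposE.
  by apply: (ge0 (g^\+)%E); [exact: measurable_funepos | move=> p; exact: funepos_ge0].
- transitivity (\int[m]_p (g^\- (phi p)))%E; first by apply: eq_integral => p _; rewrite !funenegE.
  by apply: (ge0 (g^\-)%E); [exact: measurable_funeneg | move=> p; exact: funeneg_ge0].
Qed.

Lemma cintegral_measure_preserving d (T : measurableType d) (m : {measure set T -> \bar K})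
    (phi : T -> T) (g : T -> C) : measurable_fun setT phi ->
  (forall A, measurable A -> m (phi @^-1` A) = m A) ->
  cmeasurable setT g -> cintegral m setT (fun x => g (phi x)) = cintegral m setT g.
Proof.
move=> mphi mP [g1 g2]; rewrite /cintegral /Rintegral; congr (fine _ +i* fine _).
- apply: (integral_measure_preserving (g := fun p => (re_part g p)%:E) mphi mP).
  exact/measurable_EFinP.
- apply: (integral_measure_preserving (g := fun p => (im_part g p)%:E) mphi mP).
  exact/measurable_EFinP.
Qed.

Lemma cintegral_rotcs (c s : K) (g : plane -> C) : c ^+ 2 + s ^+ 2 = 1 ->
  cmeasurable setT g -> cintegral P setT (fun p => g (rotcs c s p)) = cintegral P setT g.
Proof.
move=> cs mg; apply: cintegral_measure_preserving => //; first exact: measurable_rotcs.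
by move=> A mA; exact: plane_measure_rotcs.
Qed.

End ComplexIntegral.

(** * Angular averages *)

Section AngularAverage.
Context {K : realType}.
Local Notation C := K[i].
Local Notation Re := (@complex.Re K).
Local Notation Im := (@complex.Im K).
Local Notation normc := (@Normc.normc K).
Notation mu := (@lebesgue_measure K).
Notation P := (@plane_measure K).
Notation plane := (measurableTypeR K * measurableTypeR K)%type.
Local Notation rot t p := (rotcs (cos t) (sin t) p).

Lemma integrable_indic_lty d (T : measurableType d) (m : {measure set T -> \bar K}) (A : set T) :
  measurable A -> (m A < +oo)%E -> m.-integrable setT (fun x => (\1_A x)%:E).
Proof.
move=> mA Aoo; apply/integrableP; split.
  by apply/measurable_EFinP; exact: measurable_indic.
rewrite (_ : (\int[m]_x _)%E = m A)//.
transitivity (\int[m]_x (\1_A x)%:E)%E; last by rewrite integral_indic// setIT.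
by apply: eq_integral => x _; rewrite /= ger0_norm// indicE.
Qed.

Lemma ccont_measurable (h : K * K -> C) : ccont h -> cmeasurable setT (h : plane -> C).
Proof. by move=> [h1 h2]; split; exact: continuous_plane_measurable. Qed.

Lemma cmeasurable_comp d1 d2 (T1 : measurableType d1) (T2 : measurableType d2)
    (f : T2 -> C) (h : T1 -> T2) : measurable_fun setT h ->
  cmeasurable setT f -> cmeasurable setT (fun x => f (h x)).
Proof. by move=> mh [f1 f2]; split; [exact: (measurableT_comp f1 mh)|exact: (measurableT_comp f2 mh)]. Qed.

Lemma cmeasurable_restrict d (T : measurableType d) (A : set T) (f : T -> C) : measurable A ->
  cmeasurable A f -> cmeasurable setT (fun x => if x \in A then f x else 0).
Proof.
move=> mA [f1 f2]; split.
- rewrite (_ : re_part _ = re_part f \_ A); first exact/(measurable_restrictT _ mA).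
  by apply/funext => x; rewrite patchE /re_part; case: ifP.
- rewrite (_ : im_part _ = im_part f \_ A); first exact/(measurable_restrictT _ mA).
  by apply/funext => x; rewrite patchE /im_part; case: ifP.
Qed.

Lemma cmeasurable_expi (k : K) :
  cmeasurable setT (fun t : measurableTypeR K => expi (k * t)).
Proof.
have mk : measurable_fun setT (fun t : measurableTypeR K => k * t : measurableTypeR K).
  exact: measurable_funM.
by split; [exact: (measurableT_comp measurable_cosR mk)|exact: (measurableT_comp measurable_sinR mk)].
Qed.

Lemma ccont_bounded (h : K * K -> C) (R0 : K) : ccont h ->
  (forall p, R0 < pnorm p -> h p = 0) -> exists2 M, 0 <= M & forall p, normc (h p) <= M.
Proof.
move=> [h1 h2] h0; have cK := @compact_pnorm_le K R0.
have bd (u : K * K -> K) : continuous u -> exists2 M, 0 <= M & forall p, pnorm p <= R0 -> `|u p| <= M.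
  move=> cu; have /compact_bounded[M [_ Mu]] := continuous_compact (continuous_subspaceT cu) cK.
  exists (`|M| + 1) => [|p pR]; first by rewrite addr_ge0.
  apply: (Mu (`|M| + 1)); first by rewrite (le_lt_trans (ler_norm _))// ltrDl.
  by exists p.
have [M1 M10 H1] := bd _ h1; have [M2 M20 H2] := bd _ h2.
exists (M1 + M2) => [|p]; first by rewrite addr_ge0.
have [pR|pR] := leP (pnorm p) R0.
  by apply: (le_trans (normc_le_parts _)); rewrite lerD ?H1 ?H2.
by rewrite h0// /Normc.normc /= !expr0n addr0 sqrtr0 addr_ge0.
Qed.

Lemma plane_measure_ball_lty (R0 : K) : (P [set p | (pnorm p <= R0)%R] < +oo)%E.
Proof.
have mB (r : K) : measurable [set p : plane | pnorm p <= r].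
  rewrite -[X in measurable X]setTI (_ : [set p | _] = pnorm @^-1` `]-oo, r]); last first.
    by apply/seteqP; split=> p /=; rewrite in_itv.
  exact: measurable_pnorm.
apply: (@le_lt_trans _ _ (P (`[- R0, R0] `*` `[- R0, R0]))).
  apply: le_measure; rewrite ?inE//; first exact: measurableX.
  move=> p /= pR; have [p1 p2] := pnorm_ge_coord p.
  by split; rewrite /= in_itv/= -ler_norml; apply: le_trans pR.
rewrite plane_measure_setX// lebesgue_measure_itv /=.
by case: ifPn => _; rewrite -?EFinN -?EFinD -?EFinM ?mule0 ltry.
Qed.

Lemma ae_rotcs (c s : K) (Q : K * K -> Prop) : c ^+ 2 + s ^+ 2 = 1 ->
  {ae P, forall p, Q p} -> {ae P, forall p, Q (rotcs c s p)}.
Proof.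
move=> cs [N [mN N0 sN]]; exists (rotcs c s @^-1` N); split.
- by rewrite -[X in measurable X]setTI; exact: measurable_rotcs.
- by rewrite (plane_measure_rotcs cs mN).
- by move=> p /= nQ; exact: sN.
Qed.

Lemma ae_and d (T : measurableType d) (m : {measure set T -> \bar K}) (Q1 Q2 : T -> Prop) :
  {ae m, forall x, Q1 x} -> {ae m, forall x, Q2 x} -> {ae m, forall x, Q1 x /\ Q2 x}.
Proof.
move=> n1 n2; apply: (negligibleS _ (negligibleU n1 n2)) => x /= /not_andP[]; [left|right]; done.
Qed.

(** For [c t] = exp(-i m t) this is 2 pi times the mode [m] component of [h] in its angular Fourier
    expansion. *)
Definition angproj (c : K -> C) (h : K * K -> C) (p : K * K) : C :=
  cintegral mu `[0, 2 * pi]%classic (fun t => c t * h (rot t p)).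

Lemma rot_inv (t : K) p : rotcs (cos t) (- sin t) (rot t p) = p.
Proof.
have := cos2Dsin2 t; case: p => x y; rewrite /rotcs /= => e.
congr pair.
  by transitivity ((cos t ^+ 2 + sin t ^+ 2) * x); [ring|rewrite e mul1r].
by transitivity ((cos t ^+ 2 + sin t ^+ 2) * y); [ring|rewrite e mul1r].
Qed.

Section Average.
Variables (R : \bar K) (k : int) (F : K * K -> C) (fk : K -> C) (h : K * K -> C) (R0 : K).
Hypotheses (F2 : square_integrable P (disc R) F) (Fk : mode_fun_ae R k F fk).
Hypotheses (ch : ccont h) (h0 : forall p, R0 < pnorm p -> h p = 0).

Let F0 (p : plane) : C := if p \in disc R then F p else 0.
(** Since [a <= 1 + a ^+ 2], a multiple of this dominates [F0] times a bounded function supported in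
    the ball: it turns square integrability into integrability. *)
Let w (p : plane) : K := \1_[set p : plane | pnorm p <= R0] p + normc (F0 p) ^+ 2.

Let normc0 : normc 0 = 0.
Proof. by rewrite /Normc.normc /= !expr0n addr0 sqrtr0. Qed.

Let cmeas_F0 : cmeasurable setT F0.
Proof. by case: F2 => f1 f2 _; apply: cmeasurable_restrict; [exact: measurable_disc|]. Qed.

Let mB : measurable [set p : plane | pnorm p <= R0].
Proof.
rewrite -[X in measurable X]setTI (_ : [set p | _] = pnorm @^-1` `]-oo, R0]); last first.
  by apply/seteqP; split=> p /=; rewrite in_itv.
exact: measurable_pnorm.
Qed.

Let integrable_w : P.-integrable setT (fun p => (w p)%:E).
Proof.
apply: (@eq_integrable _ _ _ P _ measurableT
  ((fun p => (\1_[set p : plane | pnorm p <= R0] p)%:E) \+ (fun p => (normc (F0 p) ^+ 2)%:E))%E).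
  by move=> p _; rewrite /w EFinD.
apply: integrableD => //.
- by apply: integrable_indic_lty => //; exact: plane_measure_ball_lty.
- rewrite (_ : (fun p => _) = (fun p => ((normc (F p)) ^+ 2)%:E) \_ (disc R)).
    by apply: (integrable_mkcond _ (@measurable_disc K R)).1; case: F2.
  by apply/funext => p; rewrite patchE /F0; case: ifP => // _; rewrite normc0 expr0n.
Qed.

Let w_ge0 p : 0 <= w p. Proof. by rewrite addr_ge0 ?sqr_ge0// indicE. Qed.

Let bound (M : K) (z : C) p q : 0 <= M -> (forall p, normc (h p) <= M) -> normc z = 1 ->
  pnorm q = pnorm p -> normc (F0 p * (z * h q)) <= M * w p.
Proof.
move=> M0 hM z1 qp; rewrite Normc.normcM Normc.normcM z1 mul1r.
have [pR|pR] := leP (pnorm p) R0; last by rewrite h0 ?qp// normc0 mulr0 mulr_ge0.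
rewrite mulrC ler_pM ?normc_ge0// /w indicE mem_set//=.
have := normc_ge0 (F0 p); set a := normc _ => a0; nra.
Qed.

Let I := cintegral P (disc R) (fun p => F p * h p).

(** Rotating the variable moves the rotation from [h] to [F0], where the mode relation turns it into
    exp(-i k t), which cancels. *)
Let slice (t : K) : cintegral P setT (fun p => F0 p * (expi (k%:~R * t) * h (rot t p))) = I.
Proof.
pose G q := F0 (rotcs (cos t) (- sin t) q) * (expi (k%:~R * t) * h q).
have cs : cos t ^+ 2 + (- sin t) ^+ 2 = 1 by rewrite sqrrN cos2Dsin2.
have mG : cmeasurable setT G.
  apply: cmeasurableM; first by apply: cmeasurable_comp => //; exact: measurable_rotcs.
  by apply: cmeasurableM; [exact: cmeasurable_cst|exact: ccont_measurable].
have -> : cintegral P setT (fun p => F0 p * (expi (k%:~R * t) * h (rot t p))) =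
    cintegral P setT (fun p => G (rot t p)).
  by apply: eq_cintegral => p _; rewrite /G rot_inv.
rewrite (cintegral_rotcs (cos2Dsin2 t) mG) /I [RHS]cintegral_mkcond.
apply: cintegral_ae_eq => //.
  have := cmeasurableM cmeas_F0 (ccont_measurable ch).
  congr (cmeasurable _ _); apply/funext => p; rewrite /F0.
  by case: ifP => // _; rewrite mul0r.
(* The mode relation is used at the point and at its rotated image, off one null set for each. *)
have aF := Fk; have arF := ae_rotcs cs Fk.
apply: (ae_mono _ (ae_and aF arF)) => p [H1 H2] _.
have pr := pnorm_rotcs p cs.
have dE : (rotcs (cos t) (- sin t) p \in disc R) = (p \in disc R).
  have dE q q' : pnorm q = pnorm q' -> disc R q -> disc R q'.
    by move=> e; rewrite -[disc R q]/(is_true ((pnorm q)%:E < R)%E) e.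
  by apply/idP/idP => /set_mem h1; apply/mem_set; move: h1; apply: dE.
rewrite /G /F0 dE; case: ifPn => [pD|_]; last by rewrite mul0r.
have [s ps] := polarP p.
have rp : rotcs (cos t) (- sin t) p = polar (pnorm p) (s - t).
  by rewrite {1}ps -cosN -sinN rot_polar.
rewrite (H1 (set_mem pD) _ _ (sqrtr_ge0 _) ps).
rewrite (H2 _ _ _ (sqrtr_ge0 _) rp); last by apply: set_mem; rewrite dE.
rewrite mulrA; congr (_ * _).
by rewrite mulrAC -expiD; congr (expi _ * _); ring.
Qed.

(** By [slice] the integral is the same for every angle; integrate over a period and exchange the
    two integrals. *)
Lemma angular_average :
  (2 * pi)%:C * I = cintegral P (disc R) (fun p => F p * angproj (fun t => expi (k%:~R * t)) h p).
Proof.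
have [M M0 hM] := ccont_bounded ch h0.
pose A : set (measurableTypeR K) := `[0, 2 * pi]%classic.
have mA : measurable A by exact: measurable_itv.
(* The cutoff to one period is put in the integrand, so that Fubini is applied on whole spaces. *)
pose e (t : measurableTypeR K) : C := if t \in A then expi (k%:~R * t) else 0.
pose Phi (q : plane * measurableTypeR K) := F0 q.1 * (e q.2 * h (rot q.2 q.1)).
have me : cmeasurable setT e.
  apply: (cmeasurable_restrict mA); have [m1 m2] := cmeasurable_expi k%:~R.
  by split; apply: measurable_funTS.
have mPhi : cmeasurable setT Phi.
  apply: cmeasurableM; first by apply: cmeasurable_comp => //; exact: measurable_fst.
  apply: cmeasurableM; first by apply: (cmeasurable_comp _ me); exact: measurable_snd.
  by apply: (cmeasurable_comp _ (ccont_measurable ch)); exact: measurable_rot.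
have PhiE t p : normc (Phi (p, t)) <= M * w p * \1_A t.
  rewrite indicE /Phi /e /=; case: ifP => _; last by rewrite mul0r mulr0 normc0 mulr0.
  rewrite mulr1; apply: bound => //; first exact: normc_expi.
  exact: pnorm_rotcs (cos2Dsin2 _).
have muA : (mu A < +oo)%E.
  by rewrite /A lebesgue_measure_itv /=; case: ifPn => // _; rewrite ?ltry// -EFinD ltry.
have iA : mu.-integrable setT (fun t => (\1_A t)%:E).
  exact: integrable_indic_lty.
have iMw : P.-integrable setT (fun p => (M * w p)%:E).
  apply: (@eq_integrable _ _ _ P _ measurableT (fun p => M%:E * (w p)%:E)%E).
    by move=> p _; rewrite EFinM.
  exact: (integrableZl measurableT M integrable_w).
have mMw : measurable_fun setT (fun p : plane => M * w p).
  by have /integrableP[/measurable_EFinP] := iMw.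
have mg : measurable_fun setT (fun q : plane * measurableTypeR K => M * w q.1 * \1_A q.2).
  apply: measurable_funM; first exact: (measurableT_comp mMw measurable_fst).
  by apply: (measurableT_comp _ measurable_snd); exact: measurable_indic.
have iPhi : cintegrable (planeS \x mu)%E setT Phi.
  apply: (@le_cintegrable _ _ _ _ _ _ (fun q => M * w q.1 * \1_A q.2)) => //.
    by move=> [p t] _; exact: PhiE.
  apply/integrable12ltyP; first exact/measurable_EFinP.
  rewrite (_ : (\int[_]_x _)%E = (\int[P]_p ((M * w p)%:E * mu A))%E); last first.
    apply: eq_integral => p _.
    transitivity (\int[mu]_t ((M * w p)%:E * (\1_A t)%:E))%E.
      apply: eq_integral => t _; rewrite /= ger0_norm ?EFinM//.
      by rewrite mulr_ge0 ?mulr_ge0// indicE.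
    by rewrite integralZl// integral_indic// setIT.
  have := integrableZr measurableT (fine (mu A)) iMw.
  rewrite fineK; last by rewrite ge0_fin_numE.
  by move=> /(integrable_fin_num measurableT); rewrite fin_numE => /andP[_]; rewrite ltey.
have i2 p : cintegrable mu setT (fun t => Phi (p, t)).
  apply: (@le_cintegrable _ _ _ _ _ _ (fun t => M * w p * \1_A t)) => //.
    by apply: (cmeasurable_comp _ mPhi); exact: measurable_pair1.
  apply: (@eq_integrable _ _ _ mu _ measurableT (fun t => (M * w p)%:E * (\1_A t)%:E)%E).
    by move=> t _; rewrite EFinM.
  exact: integrableZl.
have i1 t : cintegrable planeS setT (fun p => Phi (p, t)).
  apply: (@le_cintegrable _ _ _ _ _ _ (fun p => M * w p)) => //.
    by apply: (cmeasurable_comp _ mPhi); exact: measurable_pair2.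
  move=> p _; apply: (le_trans (PhiE t p)); rewrite ler_piMr ?mulr_ge0//.
have lhs : cintegral mu setT (fun t => cintegral planeS setT (fun p => Phi (p, t))) = (2 * pi)%:C * I.
  transitivity (cintegral mu A (fun=> I)).
    rewrite [RHS]cintegral_mkcond; apply: eq_cintegral => t _.
    rewrite /Phi /e /=; case: ifP => _; first exact: slice.
    rewrite (_ : (fun p => _) = fun=> 0); last by apply/funext => p; rewrite mul0r mulr0.
    by rewrite /cintegral !Rintegral_cst// !mul0r.
  have -> : cintegral mu A (fun=> I) = (Re I * fine (mu A)) +i* (Im I * fine (mu A)).
    by rewrite /cintegral; congr (_ +i* _); exact: Rintegral_cst.
  rewrite /A lebesgue_measure_itv /=.
  have pi0 := pi_gt0 K; rewrite lte_fin mulr_gt0//= subr0.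
  by apply: complexP; rewrite ?ReImE /=; ring.
rewrite -lhs -(cFubini iPhi i2 i1) [RHS]cintegral_mkcond.
apply: eq_cintegral => p _; rewrite /Phi /=.
have [pD|pD] := boolP (p \in disc R); last first.
  rewrite /F0 (negbTE pD).
  rewrite (_ : (fun t => _) = fun=> 0); last by apply/funext => t; rewrite mul0r.
  by rewrite /cintegral !Rintegral_cst// !mul0r.
rewrite cintegralZ//.
  rewrite /F0 pD /angproj; congr (_ * _); rewrite [RHS]cintegral_mkcond.
  by apply: eq_cintegral => t _; rewrite /e; case: ifP; rewrite ?mul0r.
apply: (@le_cintegrable _ _ _ _ _ _ (fun t => M * \1_A t)) => //.
- apply: cmeasurableM => //; apply: (cmeasurable_comp _ (ccont_measurable ch)).
  by apply: (measurableT_comp (@measurable_rot K) (g := fun t => (p, t))); exact: measurable_pair1.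
- move=> t _; rewrite Normc.normcM /e indicE; case: ifP => _; last by rewrite normc0 mul0r mulr0.
  by rewrite normc_expi mul1r mulr1.
- apply: (@eq_integrable _ _ _ mu _ measurableT (fun t => M%:E * (\1_A t)%:E)%E).
    by move=> t _; rewrite EFinM.
  exact: integrableZl.
Qed.

End Average.
End AngularAverage.

(** * Smoothness and mode of the angular average *)

Section Projection.
Context {K : realType}.
Local Notation C := K[i].
Local Notation Re := (@complex.Re K).
Local Notation Im := (@complex.Im K).
Local Notation normc := (@Normc.normc K).
Notation mu := (@lebesgue_measure K).
Notation P := (@plane_measure K).
Notation plane := (measurableTypeR K * measurableTypeR K)%type.
Local Notation rot t p := (rotcs (cos t) (sin t) p).
Local Notation s2 := (((Num.sqrt 2)^-1)%:C : C).

Lemma Rintegral_itv_shift (h : K -> K) (s a b : K) : continuous h ->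
  Rintegral mu `]a, b]%classic (fun t => h (s + t)) = Rintegral mu `](a + s), (b + s)]%classic h.
Proof.
move=> ch; have mh : measurable_fun setT (h : measurableTypeR K -> measurableTypeR K).
  exact: continuous_measurable_fun.
rewrite Rintegral_mkcond [RHS]Rintegral_mkcond /Rintegral; congr fine.
pose g (t : measurableTypeR K) : \bar K := ((h \_ `](a + s), (b + s)]) t)%:E.
pose phi (t : measurableTypeR K) : measurableTypeR K := (t : K) + s.
transitivity (\int[mu]_t g (phi t))%E.
  apply: eq_integral => t _; rewrite /g /phi !patchE (addrC t); congr (if _ then _ else _)%:E.
  by apply/idP/idP => /set_mem/=; rewrite in_itv => H; apply/mem_set; rewrite /= in_itv /=;
    move: H; rewrite /= (addrC s) ltrD2r lerD2r.
apply: (integral_measure_preserving (phi := phi) (g := g)).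
- exact: measurable_funD.
- by move=> A mA; exact: lebesgue_measure_shift.
- apply/measurable_EFinP; apply/(measurable_restrictT _ (measurable_itv _)).
  exact: measurable_funTS.
Qed.

(** The pieces []0, s]] and []2 pi, 2 pi + s]] contribute equally; gluing half-open intervals does
    the rest. *)
Lemma Rintegral_periodic (h : K -> K) (s : K) : continuous h -> (forall u, h (u + 2 * pi) = h u) ->
  Rintegral mu `[0, 2 * pi]%classic (fun t => h (s + t)) = Rintegral mu `[0, 2 * pi]%classic h.
Proof.
have pi0 : 0 <= 2 * pi :> K by rewrite mulr_ge0// ltW// pi_gt0.
have ih (g : K -> K) a b : continuous g -> mu.-integrable `]a, b]%classic (EFin \o g).
  move=> cg; apply: (@integrableS _ _ _ mu `[a, b]%classic) => //.
    by apply: subset_itvr; rewrite bnd_simp.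
  by apply: continuous_compact_integrable; [exact: segment_compact|exact: continuous_subspaceT].
have cs (g : K -> K) u : continuous g -> continuous (fun t => g (u + t)).
  move=> cg t; apply: (@continuous_comp _ _ _ (fun t => u + t) g); last exact: cg.
  by apply: cvgD; [exact: cvg_cst|exact: cvg_id].
have toc (g : K -> K) : continuous g ->
    Rintegral mu `[0, 2 * pi]%classic g = Rintegral mu `]0, 2 * pi]%classic g.
  by move=> cg; rewrite Rintegral_itv_obnd_cbnd//; exact: ih.
(* For negative [s], the nonnegative case is applied to the shifted function with [- s]. *)
wlog s0 : h s / 0 <= s => [W ch ph|ch ph].
  have [s0|/ltW s0] := leP 0 s; first exact: W.
  rewrite -(W (fun t => h (s + t)) (- s)); last 1 first.
  - by move=> u; rewrite addrA ph.
  - by apply: eq_Rintegral => t _; rewrite addrA subrr add0r.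
  - by rewrite oppr_ge0.
  - exact: cs.
pose I a b := Rintegral mu `]a, b]%classic h.
have chas a b c : a <= b -> b <= c -> I a b + I b c = I a c.
  move=> ab bc; rewrite /I -(@Rintegral_itvB _ h (BRight a) (BRight c) b) ?bnd_simp//; last exact: ih.
  by rewrite addrC subrK.
rewrite !toc//; last exact: cs.
rewrite Rintegral_itv_shift// add0r -/(I _ _) -/(I 0 (2 * pi)).
have e : I (2 * pi) (2 * pi + s) = I 0 s.
  rewrite /I (addrC _ s) -{1}(add0r (2 * pi)) -Rintegral_itv_shift//.
  by apply: eq_Rintegral => t _; rewrite addrC ph.
have := chas 0 s (2 * pi + s) s0; rewrite lerDr => /(_ pi0).
have := chas 0 (2 * pi) (2 * pi + s) pi0; rewrite lerDl => /(_ s0).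
rewrite e; lra.
Qed.

Lemma cintegral_periodic (g : K -> C) (s : K) : ccont g -> (forall u, g (u + 2 * pi) = g u) ->
  cintegral mu `[0, 2 * pi]%classic (fun t => g (s + t)) = cintegral mu `[0, 2 * pi]%classic g.
Proof.
move=> [c1 c2] pg; rewrite /cintegral; congr (_ +i* _).
- by apply: (Rintegral_periodic (h := re_part g)) => // u; rewrite /re_part pg.
- by apply: (Rintegral_periodic (h := im_part g)) => // u; rewrite /im_part pg.
Qed.

Section UnderIntegral.
Context d (Y : measurableType d) (m : {measure set Y -> \bar K}) (A : set Y).
Hypotheses (mA : measurable A) (Aoo : (m A < +oo)%E).

Lemma integrable_cst_lty (M : K) : m.-integrable A (EFin \o (fun=> M)).
Proof.
apply/integrableP; split; first by apply/measurable_EFinP; exact: measurable_cst.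
rewrite (_ : (\int[m]_(x in A) _)%E = (`|M|%:E * m A)%E); last by rewrite -integral_cst.
by rewrite lte_mul_pinfty// lee_fin.
Qed.

Lemma integrable_bounded (g : Y -> K) (M : K) : measurable_fun A g ->
  (forall t, `|g t| <= M) -> m.-integrable A (EFin \o g).
Proof.
move=> mg gM; apply: (le_integrable mA _ _ (integrable_cst_lty M)); first exact/measurable_EFinP.
by move=> t _; rewrite /= lee_fin (le_trans (gM t))// ler_norm.
Qed.

(** The bound [M] is global, so the interval of radius 1 around [a] serves as the neighbourhood in
    the domination theorem. *)
Lemma is_derive_under_integral (f f' : K -> Y -> K) (a M : K) :
  (forall x, measurable_fun A (f x)) -> (forall x t, `|f x t| <= M) ->
  (forall x t, `|f' x t| <= M) -> (forall x t, is_derive x (1 : K) (f ^~ t) (f' x t)) ->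
  is_derive a (1 : K) (fun x => Rintegral m A (f x)) (Rintegral m A (f' a)).
Proof.
move=> mf fM f'M df.
have iM := integrable_cst_lty `|M|.
have intf x : m.-integrable A (EFin \o f x) by exact: (integrable_bounded (mf x) (fM x)).
have Ia : a \in `]a - 1, a + 1[%R by rewrite in_itv/= ltrBlDr !ltrDl ltr01.
have d1 x t : partial1of2 f x t = f' x t by rewrite partial1of2E; have [] := df x t.
have Gub x t : `]a - 1, a + 1[%classic x -> A t -> `|partial1of2 f x t| <= `|M|.
  by move=> _ _; rewrite d1 (le_trans (f'M x t))// ler_norm.
have der x t : `]a - 1, a + 1[%classic x -> A t -> derivable (f ^~ t) x 1.
  by move=> _ _; have [] := df x t.
have D := derivable_under_integral mA Ia (fun x _ => intf x) der (fun=> normr_ge0 M) iM Gub.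
have E := differentiation_under_integral mA Ia (fun x _ => intf x) der (fun=> normr_ge0 M) iM Gub.
apply: DeriveDef => //; rewrite -derive1E E.
by apply: eq_Rintegral => t _; exact: d1.
Qed.

Lemma is_cder_under_integral (f f' : K -> Y -> C) (a M : K) :
  (forall x, cmeasurable A (f x)) -> (forall x t, normc (f x t) <= M) ->
  (forall x t, normc (f' x t) <= M) -> (forall x t, is_cder x (1 : K) (f ^~ t) (f' x t)) ->
  is_cder a (1 : K) (fun x => cintegral m A (f x)) (cintegral m A (f' a)).
Proof.
move=> mf fM f'M df; split.
- apply: (@is_derive_under_integral (fun x t => Re (f x t)) (fun x t => Re (f' x t)) a M) => x.
  + by case: (mf x).
  + by move=> t; exact: le_trans (normc_ge_part _).1 (fM x t).
  + by move=> t; exact: le_trans (normc_ge_part _).1 (f'M x t).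
  + by move=> t; case: (df x t).
- apply: (@is_derive_under_integral (fun x t => Im (f x t)) (fun x t => Im (f' x t)) a M) => x.
  + by case: (mf x).
  + by move=> t; exact: le_trans (normc_ge_part _).2 (fM x t).
  + by move=> t; exact: le_trans (normc_ge_part _).2 (f'M x t).
  + by move=> t; case: (df x t).
Qed.

Lemma le_cintegral (f : Y -> C) (M : K) : cmeasurable A f -> (forall t, normc (f t) <= M) ->
  `|Re (cintegral m A f)| <= M * fine (m A) /\ `|Im (cintegral m A f)| <= M * fine (m A).
Proof.
have le (g : Y -> K) : measurable_fun A g -> (forall t, `|g t| <= M) ->
    `|Rintegral m A g| <= M * fine (m A).
  move=> mg gM.
  have ig := integrable_bounded mg gM.
  apply: (le_trans (le_normr_Rintegral mA ig)).
  rewrite -(Rintegral_cst _ mA); apply: le_Rintegral => //; last exact: integrable_cst_lty.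
  by rewrite (_ : _ \o _ = abse \o (EFin \o g))//; exact: integrable_abse.
move=> [f1 f2] fM; split.
- by apply: le => // t; exact: le_trans (normc_ge_part _).1 (fM t).
- by apply: le => // t; exact: le_trans (normc_ge_part _).2 (fM t).
Qed.
End UnderIntegral.

Lemma is_cder_affine (V W : normedModType K) (f : V -> C) (g : W -> C) (p v : V) (q w : W) l :
  (forall h : K, f (h *: v + p) = g (h *: w + q)) -> is_cder q w g l -> is_cder p v f l.
Proof.
move=> fg dg; apply: (@is_cder_line _ _ p v f (fun u => g (u *: w + q)) 0 l _).2; first by move=> h; rewrite addr0 fg.
by apply: (@is_cder_line _ _ q w g (fun u => g (u *: w + q)) 0 l _).1 => // h; rewrite addr0.
Qed.

Lemma is_cder_dir (f fx fy : K * K -> C) (p : K * K) (a b : K) :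
  (forall q, is_cder q ex f (fx q)) -> is_cder p ey f (fy p) -> ccont fx ->
  is_cder p (a, b) f (a%:C * fx p + b%:C * fy p).
Proof.
move=> dx [y1 y2] [c1 c2]; split; rewrite !ReImE /= !mul0r ?subr0 ?addr0.
- apply: (@is_derive_dir _ (re_part f) (re_part fx) (re_part fy)) => //; last exact: c1.
  by move=> q; case: (dx q).
- apply: (@is_derive_dir _ (im_part f) (im_part fx) (im_part fy)) => //; last exact: c2.
  by move=> q; case: (dx q).
Qed.

(** The derivative along the rotated basis vector, written with [u] for dzeta and [v] for dzetabar:
    the first picks up exp(i t), the second its conjugate. *)
Lemma rot_partial_ex (t : K) (u v : C) :
  (cos t)%:C * (s2 * (u + v)) + (sin t)%:C * (s2 * 'i%C * (u - v)) =
  s2 * (expi t * u + conjc (expi t) * v).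
Proof. by case: u => u1 u2; case: v => v1 v2; apply: complexP; rewrite !ReImE /=; ring. Qed.

Lemma rot_partial_ey (t : K) (u v : C) :
  (- sin t)%:C * (s2 * (u + v)) + (cos t)%:C * (s2 * 'i%C * (u - v)) =
  s2 * 'i%C * (expi t * u - conjc (expi t) * v).
Proof. by case: u => u1 u2; case: v => v1 v2; apply: complexP; rewrite !ReImE /=; ring. Qed.

(** The frequency [m + a - b] moves with the indices exactly so as to absorb the factors exp(i t)
    and exp(-i t) of the chain rule. *)
Lemma jet_rot (F : nat -> nat -> K * K -> C) (m : int) (t : K) : jet F ->
  forall a b, let G a b p := expi ((m + a%:Z - b%:Z)%:~R * t) * F a b (rot t p) in
  (forall p, is_cder p ex (G a b) (s2 * (G a.+1 b p + G a b.+1 p))) /\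
  (forall p, is_cder p ey (G a b) (s2 * 'i%C * (G a.+1 b p - G a b.+1 p))).
Proof.
move=> jF a b G; have [cF dx dy] := jF a b.
have cFx : ccont (fun p => s2 * (F a.+1 b p + F a b.+1 p)).
  have [c1 _ _] := jF a.+1 b; have [c2 _ _] := jF a b.+1.
  rewrite (_ : (fun p => _) = fun p => 0 + s2 * (F a.+1 b p + 1 * F a b.+1 p)).
    by apply: ccont_comb; [exact: ccont_cst|exact: ccont_comb].
  by apply/funext => p; rewrite add0r mul1r.
have e1 : expi ((m + a.+1%:Z - b%:Z)%:~R * t) = expi ((m + a%:Z - b%:Z)%:~R * t) * expi t.
  rewrite -expiD; congr expi; rewrite (_ : m + a.+1%:Z - b%:Z = (m + a%:Z - b%:Z) + 1); last by lia.
  by rewrite intrD mulrDl mul1r.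
have e2 : expi ((m + a%:Z - b.+1%:Z)%:~R * t) = expi ((m + a%:Z - b%:Z)%:~R * t) * conjc (expi t).
  rewrite -expiN -expiD; congr expi; rewrite (_ : m + a%:Z - b.+1%:Z = (m + a%:Z - b%:Z) - 1); last by lia.
  by rewrite (intrD _ _ (-1)) mulrDl mulN1r.
split=> p.
- apply: is_cder_eq.
    apply: is_cderZ; apply: (@is_cder_affine _ _ _ (F a b) p ex (rot t p) (cos t, sin t)).
      move=> h; congr (F a b _); case: p => x y; rewrite /rotcs /ex /=.
      rewrite -[LHS]/(cos t * (h * 1 + x) - sin t * (h * 0 + y), sin t * (h * 1 + x) + cos t * (h * 0 + y)).
      rewrite -[RHS]/(h * cos t + (cos t * x - sin t * y), h * sin t + (sin t * x + cos t * y)).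
      by congr pair; ring.
    exact: (@is_cder_dir (F a b) (fun p => s2 * (F a.+1 b p + F a b.+1 p))
      (fun p => s2 * 'i%C * (F a.+1 b p - F a b.+1 p)) _ (cos t) (sin t) dx (dy _) cFx).
  by rewrite rot_partial_ex /G e1 e2; move: (expi (_ * t)) (expi t) (conjc (expi t)) => x y z; ring.
- apply: is_cder_eq.
    apply: is_cderZ; apply: (@is_cder_affine _ _ _ (F a b) p ey (rot t p) (- sin t, cos t)).
      move=> h; congr (F a b _); case: p => x y; rewrite /rotcs /ey /=.
      rewrite -[LHS]/(cos t * (h * 0 + x) - sin t * (h * 1 + y), sin t * (h * 0 + x) + cos t * (h * 1 + y)).
      rewrite -[RHS]/(h * - sin t + (cos t * x - sin t * y), h * cos t + (sin t * x + cos t * y)).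
      by congr pair; ring.
    exact: (@is_cder_dir (F a b) (fun p => s2 * (F a.+1 b p + F a b.+1 p))
      (fun p => s2 * 'i%C * (F a.+1 b p - F a b.+1 p)) _ (- sin t) (cos t) dx (dy _) cFx).
  by rewrite rot_partial_ey /G e1 e2; move: (expi (_ * t)) (expi t) (conjc (expi t)) => x y z; ring.
Qed.

Lemma measurable_rot_at (p : K * K) :
  measurable_fun setT (fun t => rot t p : plane).
Proof.
by apply: (measurableT_comp (@measurable_rot K) (g := fun t => (p, t))); exact: measurable_pair1.
Qed.

(** Continuity and bounded support make every member of [F] bounded. This permits differentiation
    under the integral, and the resulting bounded partial derivatives give continuity. *)
Lemma jet_angproj (F : nat -> nat -> K * K -> C) (m : int) (R0 : K) : jet F ->
  (forall a b p, R0 < pnorm p -> F a b p = 0) ->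
  jet (fun a b => angproj (fun t => expi ((m + a%:Z - b%:Z)%:~R * t)) (F a b)).
Proof.
move=> jF F0; pose A : set (measurableTypeR K) := `[0, 2 * pi]%classic.
have mA : measurable A by exact: measurable_itv.
have Aoo : (mu A < +oo)%E.
  by rewrite /A lebesgue_measure_itv /=; case: ifPn => // _; rewrite ?ltry// -EFinD ltry.
pose G t a b p := expi ((m + a%:Z - b%:Z)%:~R * t) * F a b (rot t p).
have mG a b p : cmeasurable A (fun t => G t a b p).
  have [cF _ _] := jF a b.
  suff [m1 m2] : cmeasurable setT (fun t => G t a b p) by split; exact: measurable_funTS.
  apply: cmeasurableM; first exact: cmeasurable_expi.
  exact: (cmeasurable_comp (measurable_rot_at p) (ccont_measurable cF)).
have bG a b : exists M, forall t p, normc (G t a b p) <= M.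
  have [cF _ _] := jF a b; have [M M0 HM] := ccont_bounded cF (F0 a b).
  by exists M => t p; rewrite Normc.normcM normc_expi mul1r.
pose Psi a b := angproj (fun t => expi ((m + a%:Z - b%:Z)%:~R * t)) (F a b).
have PsiE a b p : Psi a b p = cintegral mu A (fun t => G t a b p) by [].
have iG a b p : cintegrable mu A (fun t => G t a b p).
  have [M HM] := bG a b; have [m1 m2] := mG a b p.
  split; apply: (integrable_bounded mA Aoo (M := M)) => // t.
  - exact: (le_trans (normc_ge_part _).1 (HM t p)).
  - exact: (le_trans (normc_ge_part _).2 (HM t p)).
have lin (c d : C) a b a' b' p :
    cintegral mu A (fun t => c * (G t a b p + d * G t a' b' p)) = c * (Psi a b p + d * Psi a' b' p).
  have iZ (e : C) a1 b1 : cintegrable mu A (fun t => e * G t a1 b1 p).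
    have [M HM] := bG a1 b1.
    have mZ : cmeasurable A (fun t => e * G t a1 b1 p).
      by apply: cmeasurableM => //; exact: cmeasurable_cst.
    have nZ t : normc (e * G t a1 b1 p) <= normc e * M.
      by rewrite Normc.normcM ler_wpM2l// normc_ge0.
    case: mZ => m1 m2; split; apply: (integrable_bounded mA Aoo (M := normc e * M)) => // t.
    - exact: (le_trans (normc_ge_part _).1 (nZ t)).
    - exact: (le_trans (normc_ge_part _).2 (nZ t)).
  rewrite (_ : (fun t => _) = fun t => c * G t a b p + (c * d) * G t a' b' p); last first.
    by apply/funext => t; ring.
  by rewrite cintegralD// !cintegralZ// -!PsiE; ring.
have dom (c d : C) a b a' b' : exists M, forall t p, normc (c * (G t a b p + d * G t a' b' p)) <= M.
  have [M HM] := bG a b; have [M' HM'] := bG a' b'.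
  exists (normc c * (M + normc d * M')) => t p; rewrite Normc.normcM ler_wpM2l ?normc_ge0//.
  apply: (le_trans (le_normcD _ _)); rewrite lerD// Normc.normcM ler_wpM2l ?normc_ge0//.
have dPx a b p : is_cder p ex (Psi a b) (s2 * (Psi a.+1 b p + Psi a b.+1 p)).
  rewrite -[X in _ + X]mul1r -lin; case: p => x y; apply/is_cder_exP.
  have [M HM] := bG a b; have [M' HM'] := dom s2 1 a.+1 b a b.+1.
  apply: (@is_cder_under_integral _ _ mu A mA Aoo (fun u t => G t a b (u, y))
    (fun u t => s2 * (G t a.+1 b (u, y) + 1 * G t a b.+1 (u, y))) x (Num.max M M')) => u.
  - exact: mG.
  - by move=> t; rewrite le_max HM.
  - by move=> t; rewrite le_max HM' orbT.
  - by move=> t; apply/is_cder_exP; rewrite mul1r; have [+ _] := jet_rot m t jF a b; apply.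
have dPy a b p : is_cder p ey (Psi a b) (s2 * 'i%C * (Psi a.+1 b p - Psi a b.+1 p)).
  rewrite -[X in _ + X]mulN1r -lin; case: p => x y; apply/is_cder_eyP.
  have [M HM] := bG a b; have [M' HM'] := dom (s2 * 'i%C) (- 1) a.+1 b a b.+1.
  apply: (@is_cder_under_integral _ _ mu A mA Aoo (fun u t => G t a b (x, u))
    (fun u t => s2 * 'i%C * (G t a.+1 b (x, u) + (- 1) * G t a b.+1 (x, u))) y (Num.max M M')) => u.
  - exact: mG.
  - by move=> t; rewrite le_max HM.
  - by move=> t; rewrite le_max HM' orbT.
  - by move=> t; apply/is_cder_eyP; rewrite mulN1r; have [_ +] := jet_rot m t jF a b; apply.
have bPsi (c d : C) a b a' b' : exists M, forall p,
    `|Re (c * (Psi a b p + d * Psi a' b' p))| <= M /\ `|Im (c * (Psi a b p + d * Psi a' b' p))| <= M.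
  have [M HM] := dom c d a b a' b'; exists (M * fine (mu A)) => p; rewrite -lin.
  apply: le_cintegral => //.
  apply: cmeasurableM; first exact: cmeasurable_cst.
  have [m1 m2] := mG a b p; have [m3 m4] := mG a' b' p.
  have [m5 m6] : cmeasurable A (fun t => d * G t a' b' p).
    by apply: cmeasurableM => //; exact: cmeasurable_cst.
  split; [rewrite (_ : re_part _ = fun t => re_part (G ^~ a ^~ b ^~ p) t + re_part (fun t => d * G t a' b' p) t)|
          rewrite (_ : im_part _ = fun t => im_part (G ^~ a ^~ b ^~ p) t + im_part (fun t => d * G t a' b' p) t)].
  - exact: measurable_funD.
  - by apply/funext => t; rewrite /re_part cReD.
  - exact: measurable_funD.
  - by apply/funext => t; rewrite /im_part cImD.
move=> a b; split; [|exact: dPx|exact: dPy].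
have [Mx HMx] := bPsi s2 1 a.+1 b a b.+1.
have [My HMy] := bPsi (s2 * 'i%C) (-1) a.+1 b a b.+1.
have Hx p := HMx p; have Hy p := HMy p.
split.
- apply: (@bounded_partials_continuous _ (re_part (Psi a b))
    (fun p => Re (s2 * (Psi a.+1 b p + 1 * Psi a b.+1 p)))
    (fun p => Re (s2 * 'i%C * (Psi a.+1 b p + -1 * Psi a b.+1 p))) (Num.max Mx My)) => p.
  + by rewrite mul1r; case: (dPx a b p).
  + by rewrite mulN1r; case: (dPy a b p).
  + by rewrite le_max (Hx p).1.
  + by rewrite le_max (Hy p).1 orbT.
- apply: (@bounded_partials_continuous _ (im_part (Psi a b))
    (fun p => Im (s2 * (Psi a.+1 b p + 1 * Psi a b.+1 p)))
    (fun p => Im (s2 * 'i%C * (Psi a.+1 b p + -1 * Psi a b.+1 p))) (Num.max Mx My)) => p.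
  + by rewrite mul1r; case: (dPx a b p).
  + by rewrite mulN1r; case: (dPy a b p).
  + by rewrite le_max (Hx p).2.
  + by rewrite le_max (Hy p).2 orbT.
Qed.

Lemma angproj_out (c : K -> C) (h : K * K -> C) (R0 : K) (p : K * K) :
  (forall q, R0 < pnorm q -> h q = 0) -> R0 < pnorm p -> angproj c h p = 0.
Proof.
move=> h0 pR; rewrite /angproj.
rewrite (@eq_cintegral _ _ _ mu _ _ (fun=> 0)) => [|t _].
  by rewrite /cintegral; congr (_ +i* _); rewrite Rintegral_cst// mul0r.
by rewrite h0 ?mulr0// pnorm_rotcs// cos2Dsin2.
Qed.

Lemma ccont_expi (m : K) : ccont (fun u : K => expi (m * u)).
Proof.
have cm : continuous (fun u : K => m * u) by move=> u; apply: cvgMr; exact: cvg_id.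
split=> u.
- by apply: (@continuous_comp _ _ _ (fun u => m * u) cos); [exact: cm|exact: continuous_cos].
- by apply: (@continuous_comp _ _ _ (fun u => m * u) sin); [exact: cm|exact: continuous_sin].
Qed.

Lemma ccont_comp (T U : topologicalType) (c : T -> U) (f : U -> C) :
  continuous c -> ccont f -> ccont (fun x => f (c x)).
Proof.
move=> cc [f1 f2]; split=> x.
- by apply: (@continuous_comp _ _ _ c (re_part f)); [exact: cc|exact: f1].
- by apply: (@continuous_comp _ _ _ c (im_part f)); [exact: cc|exact: f2].
Qed.

Lemma ccontM (T : topologicalType) (f g : T -> C) : ccont f -> ccont g -> ccont (fun x => f x * g x).
Proof. by move=> [f1 f2] [g1 g2]; split=> x; have [] := @ccont_atM _ _ x f g (conj (f1 x) (f2 x)) (conj (g1 x) (g2 x)). Qed.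

Lemma ccont_integrable (f : K -> C) (a b : K) : ccont f -> cintegrable mu `[a, b]%classic f.
Proof.
by move=> [f1 f2]; split; apply: continuous_compact_integrable; first [exact: segment_compact|
  exact: continuous_subspaceT].
Qed.

(** Turning the point by [s] translates the integration variable, which periodicity undoes; the
    factor exp(i j s) remains. *)
Lemma mode_angproj (R : \bar K) (j : int) (h : K * K -> C) : ccont h ->
  mode_fun R j (angproj (fun t => expi ((- j)%:~R * t)) h)
    (axis (angproj (fun t => expi ((- j)%:~R * t)) h)).
Proof.
move=> ch; set Q := angproj _ h.
have main r s : Q (polar r s) = expi (j%:~R * s) * Q (r, 0).
  pose g u := expi ((- j)%:~R * u) * h (polar r u).
  have pr u : rot u (r, 0) = polar r u by rewrite -(add0r u) -(rot_polar r 0 u) add0r; congr rotcs; rewrite /polar cos0 sin0 mulr1 mulr0.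
  have cg : ccont g.
    apply: ccontM; first exact: ccont_expi.
    apply: (ccont_comp (c := polar r)) => // u.
    have c1 : r * cos v @[v --> u] --> r * cos u by apply: cvgMr; exact: continuous_cos.
    have c2 : r * sin v @[v --> u] --> r * sin u by apply: cvgMr; exact: continuous_sin.
    exact: (cvg_pair c1 c2).
  have cgs : ccont (fun t => g (s + t)).
    by apply: ccont_comp => // u; apply: cvgD; [exact: cvg_cst|exact: cvg_id].
  have -> : Q (r, 0) = cintegral mu `[0, 2 * pi]%classic g.
    by rewrite /Q /angproj; apply: eq_cintegral => t _; rewrite pr.
  rewrite -(cintegral_periodic s cg) => [|u]; last first.
    have e2 : expi (u + 2 * pi) = expi u.
      by rewrite expiD mulr_natl /expi cos2pi sin2pi -/(expi u); apply: complexP; rewrite !ReImE /=; ring.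
    rewrite /g !expi_int e2; congr (_ * h _); move: e2 => [e3 e4].
    by rewrite /polar e3 e4.
  rewrite -cintegralZ//; last exact: ccont_integrable.
  rewrite /Q /angproj; apply: eq_cintegral => t _.
  rewrite rot_polar /g mulrA -expiD; congr (expi _ * _).
  by rewrite mulrNz; ring.
split=> [r t r0 rR|j0]; first exact: main.
(* At radius 0 all angles give the same point, and this one gives the factor -1. *)
have := main 0 (pi / j%:~R); rewrite mulrCA mulfV ?intr_eq0// mulr1 expi_pi mulN1r.
rewrite /polar !mul0r -/(axis Q 0) => /eqP; rewrite -addr_eq0 => /eqP.
case: (axis Q 0) => x y /= [e1 e2]; congr (_ +i* _); lra.
Qed.

End Projection.

(** * The two equivalences *)

Section Assembly.
Context {K : realType}.
Local Notation C := K[i].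
Local Notation Re := (@complex.Re K).
Local Notation Im := (@complex.Im K).
Local Notation normc := (@Normc.normc K).
Notation mu := (@lebesgue_measure K).
Notation P := (@plane_measure K).
Notation plane := (measurableTypeR K * measurableTypeR K)%type.
Local Notation s2 := (((Num.sqrt 2)^-1)%:C : C).
Local Notation c2 := ((Num.sqrt 2)%:C : C).

(** The region beyond [R0] is open, so derivatives vanish where the function does. *)
Lemma jet_eq0 (F : nat -> nat -> K * K -> C) (R0 : K) : jet F ->
  (forall p, R0 < pnorm p -> F 0%N 0%N p = 0) -> forall a b p, R0 < pnorm p -> F a b p = 0.
Proof.
move=> jF F0.
have der0 (f : K * K -> C) p : (forall q, R0 < pnorm q -> f q = 0) -> R0 < pnorm p ->
    cderive ex f p = 0 /\ cderive ey f p = 0.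
  move=> f0 pR; have nf : \forall q \near p, 0 = f q.
    have nq : \forall q \near p, R0 < pnorm q.
      by have := @continuous_pnorm K p => /cvgr_gt; apply.
    by apply: filterS nq => q qR; rewrite f0.
  by split; exact: is_cder_val (is_cder_near nf (is_cder_cst _ _ 0)).
elim=> [|a IH] b p pR.
  elim: b p pR => [|b IH] p pR; first exact: F0.
  by rewrite -(jet_dzetabar jF) /dzetabar; have [-> ->] := der0 _ _ IH pR; rewrite !mulr0 addr0 mulr0.
rewrite -(jet_dzeta jF) /dzeta; have [-> ->] := der0 _ _ (IH b) pR.
by rewrite mulr0 subr0 mulr0.
Qed.

Lemma ccont_jet (F : nat -> nat -> K * K -> C) : jet F -> forall a b, ccont (F a b).
Proof. by move=> jF a b; case: (jF a b). Qed.

Lemma cintegral_radial : exists2 kap : K, 0 < kap &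
  forall (R : \bar K) (G : plane -> C) (H : K -> C),
  cmeasurable (disc R) G -> {ae P, forall p, disc R p -> G p = H (pnorm p)} ->
  cintegral P (disc R) G = kap%:C * cintegral mu (pos_itv0R R) (fun r => H r * r%:C).
Proof.
have [kap kap0 kapE] := @Rintegral_radial K; exists kap => // R G H [m1 m2] GH.
have e1 := kapE R _ (fun r => Re (H r)) m1 (ae_mono (fun p h Rp => congr1 Re (h Rp)) GH).
have e2 := kapE R _ (fun r => Im (H r)) m2 (ae_mono (fun p h Rp => congr1 Im (h Rp)) GH).
rewrite /cintegral e1 e2; apply: complexP; rewrite !ReImE /= mul0r ?subr0 ?addr0; congr (_ * _).
- by apply: eq_Rintegral => r _; rewrite /re_part !ReImE /= mulr0 subr0.
- by apply: eq_Rintegral => r _; rewrite /im_part !ReImE /= mulr0 add0r.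
Qed.

(** The angular factors of modes [k] and [- k] cancel and leave a radial integrand. [kap] is chosen
    before all other data, hence is common to both sides of the identity to be proved. *)
Lemma cintegral_mode_pairing : exists2 kap : K, 0 < kap &
  forall (R : \bar K) (k : int) (f F : K * K -> C) (fk Q : K -> C),
  square_integrable P (disc R) f -> mode_fun_ae R k f fk -> ccont F ->
  (forall p, disc R p -> p != 0 -> F p = hat (- k) Q p) ->
  cintegral P (disc R) (fun p => f p * F p) =
  kap%:C * cintegral mu (pos_itv0R R) (fun r => fk r * Q r * r%:C).
Proof.
have [kap kap0 kapE] := cintegral_radial; exists kap => // R k f F fk Q [f1 f2 _] fm cF FQ.
apply: (kapE R _ (fun r => fk r * Q r)).
  apply: cmeasurableM => //; have [m1 m2] := ccont_measurable cF.
  by split; exact: measurable_funTS.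
(* [Q] describes [F] only off the origin, which is a null set. *)
have ae0 : {ae P, forall p : plane, p != 0}.
  exists ([set (0 : K)] `*` [set (0 : K)]); split.
  - exact: measurableX.
  - by rewrite plane_measure_setX// lebesgue_measure_set1 mul0e.
  - by move=> p /= /negP; rewrite negbK => /eqP ->.
apply: (ae_mono _ (ae_and fm ae0)) => p [H p0] Rp.
have [e|[t [r0 pt up]]] := uvecP p; first by rewrite e eqxx in p0.
rewrite (H Rp _ _ (ltW r0) pt) FQ// /hat up expi_int.
rewrite mulrACA -expfzDr ?subrr ?expr0z ?mul1r//.
by rewrite -up uvec_neq0.
Qed.

Lemma sqrt2_powR (n : nat) : s2 ^+ n = (2 `^ (- (n%:R / 2)))%:C.
Proof.
rewrite -rmorphXn /=; congr (_%:C).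
rewrite powRN exprVn; congr (_^-1).
by rewrite mulrC powRrM powR12_sqrt// powR_mulrn// sqrtr_ge0.
Qed.

Section Equivalence.
Variables (R : \bar K) (k : int) (n i : nat) (f g : K * K -> C) (fk gk : K -> C).
Hypotheses (R_gt0 : (0 < R)%E) (le_in : (i <= n)%N).
Hypotheses (f_L2 : square_integrable P (disc R) f) (f_mode : mode_fun_ae R k f fk).
Hypotheses (g_L2 : square_integrable P (disc R) g)
  (g_mode : mode_fun_ae R (k + n%:Z - 2 * i%:Z) g gk).
Local Notation j := (- k - n%:Z + 2 * i%:Z).

Lemma weak_deriv_mode : weak_deriv R n i f g <->
   forall phi : K * K -> K[i], mode_test_fun R j phi ->
     (-1) ^+ n * cintegral P (disc R) (fun p => f p * iter i dzeta (iter (n - i) dzetabar phi) p)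
     = cintegral P (disc R) (fun p => g p * phi p).
Proof.
split=> [W phi [tphi _]|W phi /(test_funP phi R_gt0)[sphi [R0 [R00 R0R phi0]]]].
  have jphi := jet_of_jet ((test_funP phi R_gt0).1 tphi).1.
  rewrite -(W phi tphi); congr (_ * _); apply: eq_cintegral => p _.
  by rewrite (jet_iter_swap jphi i (n - i)).
have jphi := jet_of_jet sphi.
have F0 := jet_eq0 jphi phi0.
(* At index (0, 0) the frequency is [- j], the mode of [g]; at index (i, n - i) it has become [k],
   the mode of [f]. So [angular_average] applies on both sides. *)
have jPsi := jet_angproj (- j) jphi F0.
set Psi := (fun a b => angproj _ _) in jPsi.
have PsiE : Psi 0%N 0%N = angproj (fun t => expi ((- j)%:~R * t)) phi.
  by rewrite /Psi addr0 subr0.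
have mPsi : mode_test_fun R j (Psi 0%N 0%N).
  split; last first.
    by exists (axis (Psi 0%N 0%N)); rewrite PsiE; exact: mode_angproj (ccont_jet jphi 0 0).
  apply/(test_funP _ R_gt0); split; first exact: jet_smooth.
  by exists R0; split => // p pR; rewrite PsiE; exact: angproj_out phi0 pR.
have := W _ mPsi; rewrite (jet_iter_swap jPsi).
have -> : Psi i (n - i)%N = angproj (fun t => expi (k%:~R * t)) (jet_of phi i (n - i)).
  rewrite /Psi (_ : - j + i%:Z - (n - i)%N%:Z = k)//.
  by rewrite -{1}(subnKC le_in) PoszD; ring.
rewrite PsiE (_ : - j = k + n%:Z - 2 * i%:Z); last by ring.
rewrite -(angular_average f_L2 f_mode (ccont_jet jphi i (n - i)) (F0 i (n - i)%N)).
rewrite -(angular_average g_L2 g_mode (ccont_jet jphi 0 0) phi0).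
(* Both sides now carry the factor 2 pi. *)
rewrite mulrCA => /mulfI; apply.
have := pi_gt0 K => pi0; apply/eqP => -[/eqP]; rewrite mulf_eq0 pnatr_eq0 /=.
by rewrite gt_eqF.
Qed.

(** Stated for any jet with the radial derivatives of [phi] as profiles off the origin, so that it
    serves both for the jet built from a radial function and for the jet of a given planar one. *)
Lemma mode_radial_pairing (F : nat -> nat -> K * K -> C) (phi : K -> C) : jet F ->
  (forall a b p, disc R p -> p != 0 -> F a b p =
     hat (j + b%:Z - a%:Z) (fun r => s2 ^+ (a + b) * radDn (- j + a%:Z) b (radDn j a phi) r) p) ->
  (-1) ^+ n * cintegral P (disc R)
      (fun p => f p * iter i dzeta (iter (n - i) dzetabar (F 0%N 0%N)) p)
    = cintegral P (disc R) (fun p => g p * F 0%N 0%N p) <->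
  (-1) ^+ n * cintegral mu (pos_itv0R R)
      (fun r => fk r * (2 `^ (- (n%:R / 2)))%:C
                * radDn (k + n%:Z - i%:Z) (n - i) (radDn j i phi) r * r%:C)
    = cintegral mu (pos_itv0R R) (fun r => gk r * phi r * r%:C).
Proof.
move=> jF FE; rewrite (jet_iter_swap jF).
have [kap kap0 kapE] := cintegral_mode_pairing.
rewrite (kapE R k f (F i (n - i)%N) fk (fun r => s2 ^+ n * radDn (k + n%:Z - i%:Z) (n - i) (radDn j i phi) r))//; last 2 first.
- exact: ccont_jet.
- move=> p Rp p0; rewrite FE// subnKC//; congr (hat _ _ _).
    by rewrite -{1}(subnKC le_in) PoszD; ring.
  apply/funext => r; congr (_ * radDn _ _ _ _); ring.
rewrite (kapE R (k + n%:Z - 2 * i%:Z) g (F 0%N 0%N) gk phi)//; last 2 first.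
- exact: ccont_jet.
- move=> p Rp p0; rewrite FE// addr0 subr0; congr (hat _ _ _); first by ring.
  by apply/funext => r; rewrite expr0 mul1r.
rewrite mulrCA; under eq_cintegral do rewrite mulrA sqrt2_powR.
have k0 : kap%:C != 0 :> C by apply/eqP => -[/eqP]; rewrite gt_eqF.
by split=> [/(mulfI k0)|->].
Qed.

Lemma mode_radial :
  (forall phi : K * K -> K[i], mode_test_fun R j phi ->
     (-1) ^+ n * cintegral P (disc R) (fun p => f p * iter i dzeta (iter (n - i) dzetabar phi) p)
     = cintegral P (disc R) (fun p => g p * phi p)) <->
  forall phi : K -> K[i], radial_test_fun R j phi ->
     (-1) ^+ n * cintegral mu (pos_itv0R R)
      (fun r => fk r * (2 `^ (- (n%:R / 2)))%:C
                * radDn (k + n%:Z - i%:Z) (n - i) (radDn j i phi) r * r%:C)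
    = cintegral mu (pos_itv0R R) (fun r => gk r * phi r * r%:C).
Proof.
split=> H phi.
  move=> /(radial_jet R_gt0)[F [jF mF supp FE]].
  apply/(mode_radial_pairing jF FE); apply: H; split; last by exists phi.
  by apply/(test_funP _ R_gt0); split => //; exact: jet_smooth.
move=> [tphi [fj mfj]]; have sphi := ((test_funP phi R_gt0).1 tphi).1.
have jphi := jet_of_jet sphi.
have FE a b p : disc R p -> p != 0 -> jet_of phi a b p =
     hat (j + b%:Z - a%:Z) (fun r => s2 ^+ (a + b) * radDn (- j + a%:Z) b (radDn j a fj) r) p.
  move=> Rp p0; rewrite (jet_of_mode a b R_gt0 sphi mfj Rp) /hat.
  rewrite (radDn_mode a b R_gt0 sphi mfj); last by split; [exact: pnorm_gt0|exact: Rp].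
  by rewrite (mulrA (s2 ^+ _)) -exprMn (mulrC s2) c2_s2 expr1n mul1r.
apply/(mode_radial_pairing jphi FE); apply: H.
exact: mode_radial_test mfj.
Qed.

End Equivalence.
End Assembly.

Theorem lemma1p2 (K : realType) (R : \bar K) (R_gt0 : (0 < R)%E)
    (k : int) (n i : nat) (le_in : (i <= n)%N)
    (f g : K * K -> K[i]) (fk gk : K -> K[i])
    (f_L2 : square_integrable plane_measure (disc R) f)
    (f_mode : mode_fun_ae R k f fk)
    (g_L2 : square_integrable plane_measure (disc R) g)
    (g_mode : mode_fun_ae R (k + n%:Z - 2 * i%:Z) g gk) :
  (weak_deriv R n i f g
   <->
   forall phi : K * K -> K[i],
     mode_test_fun R (- k - n%:Z + 2 * i%:Z) phi ->
     (-1) ^+ n * cintegral plane_measure (disc R)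
                   (fun p => f p * iter i dzeta (iter (n - i) dzetabar phi) p)
     = cintegral plane_measure (disc R) (fun p => g p * phi p))
  /\
  ((forall phi : K * K -> K[i],
     mode_test_fun R (- k - n%:Z + 2 * i%:Z) phi ->
     (-1) ^+ n * cintegral plane_measure (disc R)
                   (fun p => f p * iter i dzeta (iter (n - i) dzetabar phi) p)
     = cintegral plane_measure (disc R) (fun p => g p * phi p))
   <->
   forall phi : K -> K[i],
     radial_test_fun R (- k - n%:Z + 2 * i%:Z) phi ->
     (-1) ^+ n * cintegral lebesgue_measure (pos_itv0R R)
                   (fun r => fk r * (2 `^ (- (n%:R / 2)))%:C
                             * radDn (k + n%:Z - i%:Z) (n - i)
                                 (radDn (- k - n%:Z + 2 * i%:Z) i phi) r
                             * r%:C)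
     = cintegral lebesgue_measure (pos_itv0R R)
         (fun r => gk r * phi r * r%:C)).
Proof.
split; first exact: (weak_deriv_mode R_gt0 le_in f_L2 f_mode g_L2 g_mode).
exact: (mode_radial R_gt0 le_in f_L2 f_mode g_L2 g_mode).
Qed.
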